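(* Let $H$ be a finite set of connected fully commutative permutations each of whose heaps contains at least two entries in each internal column. If $$F(x)=\sum_{n\ge 0}\bigl|S_{n+1}^{\{[321]\}}(H)\bigr|\,x^n$$ is a rational (respectively, algebraic) generating function, then $$\sum_{n\ge 0}\bigl|S_{n+1}^{\{[3421],[4231],[4312],[4321]\}}(H)\bigr|\,x^n\quad\text{and}\quad \sum_{n\ge 0}\bigl|S_{n+1}^{\{[3421],[4312],[4321]\}}(H)\bigr|\,x^n$$ are also rational (respectively, algebraic).
   Context: The symmetric group $S_n$ is generated by the adjacent transpositions $s_1,\dots,s_{n-1}$, with $s_i=(i\;\,i+1)$. Reduced expressions for $w$ are words in the $s_i$ of minimal length representing $w$; $\mathrm{supp}(w)$ is the set of generators occurring in any (equivalently every) reduced expression of $w$. A permutation $w\in S_n$ is connected if the subscripts of the generators in $\mathrm{supp}(w)$ form a nonempty interval in $\{1,\dots,n-1\}$. Two reduced expressions of $w$ lie in the same commutativity class if they differ by a sequence of moves $s_is_j\mapsto s_js_i$ with $|i-j|\ge 2$; $w$ is fully commutative if it has exactly one commutativity class. Heaps: for a reduced expression $\mathsf w=\mathsf w_1\cdots\mathsf w_k$, the heap of $\mathsf w$ is the poset on $\{1,\dots,k\}$ given by the transitive closure of: $a\prec b$ if $a<b$ and $\mathsf w_a$ does not commute with $\mathsf w_b$, with element $a$ labeled by $\mathsf w_a$. Up to labeled isomorphism it depends only on the commutativity class; a fully commutative permutation has a unique heap. Entries labeled $s_i$ form column $i$. If $w$ is fully commutative and connected with $\mathrm{supp}(w)=\{s_i,s_{i+1},\dots,s_j\}$,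 then columns $i+1,\dots,j-1$ are the internal columns of the heap of $w$. Heap containment: an orientation preserving Coxeter embedding $f:\{s_1,\dots,s_{k-1}\}\to\{s_1,\dots,s_{n-1}\}$ is an injective map such that for each $m\in\{2,3\}$, $(s_is_j)^m=1$ if and only if $(f(s_i)f(s_j))^m=1$, and such that the subscript of $f(s_i)$ is less than that of $f(s_j)$ whenever $i<j$; it is applied letterwise to words. A permutation $w\in S_n$ heap-contains $h\in S_k$ if there are commutativity classes of $w$ and $h$, represented by reduced expressions $\mathsf w$ and $\mathsf h$, and such an $f$ for which the heap of $f(\mathsf h)$ is contained as a convex labeled subposet of the heap of $\mathsf w$ (a subposet $Q$ of $P$ is convex if $x<y<z$ in $P$ with $x,z\in Q$ implies $y\in Q$). Otherwise $w$ heap-avoids $h$. For a set $P$ of permutations, $S_{n}^{P}(H)$ denotes the set of $w\in S_{n}$ that avoid every $p\in P$ as a classical (one-line) permutation pattern and that heap-avoid every $h\in H$. The constant term of $F(x)$ is defined to be $1$, corresponding to the empty heap. *)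

(* Defs.v *)
From HB Require Import structures.
From Stdlib Require Import Relations.
From mathcomp Require Import all_boot all_order all_fingroup all_algebra.
From mathcomp Require Import finmap boolp.

Set Implicit Arguments.
Unset Strict Implicit.
Unset Printing Implicit Defensive.

Import GRing.Theory.

Local Open Scope nat_scope.

(* Indices are 0-based: ['S_n] permutes {0,...,n-1} and the generators are
   indexed by ['I_n.-1], so that [adj i] is the transposition (i i+1).
   Products of permutations in MathComp compose from left to right. With the
   opposite convention every word is reversed and every heap is replaced by its
   dual, simultaneously for the containing and for the contained permutation,
   so heap containment and all notions below are unaffected. *)

Section Words.

Variable n : nat.

Fact adj_ltl (i : 'I_n.-1) : i < n.
Proof. by apply: ltnW; rewrite -ltn_predRL. Qed.

Fact adj_ltr (i : 'I_n.-1) : i.+1 < n.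
Proof. by rewrite -ltn_predRL. Qed.

Definition adj (i : 'I_n.-1) : 'S_n :=
  tperm (Ordinal (adj_ltl i)) (Ordinal (adj_ltr i)).

Definition word_perm (u : seq 'I_n.-1) : 'S_n := (\prod_(i <- u) adj i)%g.

Definition reduced_expr (w : 'S_n) (u : seq 'I_n.-1) : Prop :=
  word_perm u = w /\
  forall v : seq 'I_n.-1, word_perm v = w -> size u <= size v.

Definition in_supp (w : 'S_n) (i : 'I_n.-1) : Prop :=
  exists2 u, reduced_expr w u & i \in u.

Definition supp_interval (w : 'S_n) (i j : 'I_n.-1) : Prop :=
  i <= j /\ forall c : 'I_n.-1, in_supp w c <-> i <= c <= j.

Definition connected_perm (w : 'S_n) : Prop :=
  exists i j : 'I_n.-1, supp_interval w i j.

Definition comm_move (u v : seq 'I_n.-1) : Prop :=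
  exists (x y : seq 'I_n.-1) (i j : 'I_n.-1),
    [/\ (i.+2 <= j) || (j.+2 <= i),
        u = x ++ [:: i; j] ++ y & v = x ++ [:: j; i] ++ y].

Definition comm_equiv : seq 'I_n.-1 -> seq 'I_n.-1 -> Prop :=
  clos_refl_trans (seq 'I_n.-1) comm_move.

Definition fully_commutative (w : 'S_n) : Prop :=
  exists2 u, reduced_expr w u & forall v, reduced_expr w v -> comm_equiv u v.

Definition heap_label (u : seq 'I_n.-1) (a : 'I_(size u)) : 'I_n.-1 :=
  tnth (in_tuple u) a.

(* A generator commutes with itself, so two entries with the same label are
   not related by [heap_step]; in a reduced word they are related by the
   transitive closure, since a neighbouring generator occurs between them. *)
Definition heap_step (u : seq 'I_n.-1) : rel 'I_(size u) :=
  fun a b => (a < b) &&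
    (adj (heap_label a) * adj (heap_label b)
       != adj (heap_label b) * adj (heap_label a))%g.

Definition heap_le (u : seq 'I_n.-1) : rel 'I_(size u) :=
  connect (@heap_step u).

Definition heap_lt (u : seq 'I_n.-1) : rel 'I_(size u) :=
  fun a b => (a != b) && heap_le a b.

Definition column_size (u : seq 'I_n.-1) (c : 'I_n.-1) : nat :=
  #|[set a : 'I_(size u) | heap_label a == c]|.

Definition two_in_internal_columns (w : 'S_n) : Prop :=
  forall i j : 'I_n.-1, supp_interval w i j ->
  forall u, reduced_expr w u ->
  forall c : 'I_n.-1, i < c < j -> 2 <= column_size u c.

Definition convex_labeled_subposet (u v : seq 'I_n.-1) : Prop :=
  exists phi : 'I_(size u) -> 'I_(size v),
    [/\ injective phi,
        forall a, heap_label (phi a) = heap_label a,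
        forall a b, heap_le (phi a) (phi b) = heap_le a b
      & forall a c y, heap_lt (phi a) y -> heap_lt y (phi c) ->
          exists b, y = phi b].

End Words.

Definition coxeter_embedding (k n : nat) (f : 'I_k.-1 -> 'I_n.-1) : Prop :=
  [/\ injective f,
      forall m, m \in [:: 2; 3] -> forall i j,
        ((adj i * adj j) ^+ m = 1)%g <-> ((adj (f i) * adj (f j)) ^+ m = 1)%g
    & forall i j : 'I_k.-1, i < j -> f i < f j].

Definition heap_contains (n k : nat) (w : 'S_n) (h : 'S_k) : Prop :=
  exists (u : seq 'I_n.-1) (v : seq 'I_k.-1) (f : 'I_k.-1 -> 'I_n.-1),
    [/\ reduced_expr w u, reduced_expr h v, coxeter_embedding f
      & convex_labeled_subposet (map f v) u].

(* A classical pattern is given by its one-line notation. *)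
Definition pattern_contains (n : nat) (w : 'S_n) (p : seq nat) : Prop :=
  exists f : 'I_(size p) -> 'I_n,
    {homo f : a b / a < b} /\
    forall a b, (w (f a) < w (f b)) = (nth 0 p a < nth 0 p b).

Definition avoiders (P : seq (seq nat)) (H : {fset {k : nat & 'S_k}})
    (n : nat) : {set 'S_n} :=
  [set w : 'S_n | `[< (forall p, p \in P -> ~ pattern_contains w p) /\
                      (forall h, h \in H -> ~ heap_contains w (tagged h)) >]].

(* Formal power series over the rationals, as coefficient sequences. *)
Definition fps : Type := nat -> rat.

Local Open Scope ring_scope.

Definition fps_poly (p : {poly rat}) : fps := fun n => p`_n.

Definition fps_mul (F G : fps) : fps :=
  fun n => \sum_(i < n.+1) F i * G (n - i)%N.

Definition fps_exp (F : fps) (k : nat) : fps :=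
  iter k (fps_mul F) (fps_poly 1).

Definition rational_fps (F : fps) : Prop :=
  exists p q : {poly rat},
    q != 0 /\ forall n, fps_mul (fps_poly q) F n = fps_poly p n.

(* P is a polynomial in y with coefficients in Q[x], and P(x, F(x)) = 0. *)
Definition algebraic_fps (F : fps) : Prop :=
  exists P : {poly {poly rat}}, P != 0 /\
    forall n, \sum_(k < size P) fps_mul (fps_poly P`_k) (fps_exp F k) n = 0.

(* For H made of connected permutations the constant term is 1, since no
   member of H is then heap-contained in the identity of S_1. *)
Definition avoiders_gf (P : seq (seq nat)) (H : {fset {k : nat & 'S_k}}) :
  fps := fun n => #|avoiders P H n.+1|%:R.

(* Main.v *)
(* Let w avoid 3421, 4312 and 4321. The middles of the 321 patterns of w are fixed
   points, each having exactly one larger entry on its left and one smaller entry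
   on its right, and removing them leaves a 321-avoiding permutation. Recording at
   each position the directions in which it is left and reached, and the middles,
   therefore encodes w as a bicoloured Motzkin path whose height is the number of
   entries in a column of the heap; the middles are extra level steps at height 1,
   absent for [321] and not consecutive when 4231 is also avoided.

   A permutation w heap-contains h exactly when w = a h' b with lengths adding up,
   where h' is a translate of h. Since the internal columns of h have at least two
   entries, this says that the heap of h lies between the two boundary paths of the
   heap of w, which only involves a window of the word of w.

   If H is not empty, a path avoiding H has bounded height, as anything fits in a
   sufficiently high heap; its words are then recognized by a finite automaton and
   all the series are rational. This covers the elements of H whose support is not
   the full set of generators, for which containment also depends on the position.
   If H is empty, cutting the paths at height 1 expresses the series of the two
   larger classes rationally in that of the bicoloured Motzkin paths, which is
   quadratic and is itself a rational function of the series F and x. *)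
From HB Require Import structures.
Require Import Defs.
From mathcomp Require Import all_boot all_order all_fingroup all_algebra.
From mathcomp Require Import finmap boolp.
From mathcomp Require Import zify ring.

Set Implicit Arguments.
Unset Strict Implicit.
Unset Printing Implicit Defensive.

Import GRing.Theory.

Local Open Scope nat_scope.

(** * Formal power series *)

Local Open Scope ring_scope.

(** Words disappear early: [heap_containsP] turns containment into a factorization with nested
    inversion sets, and from then on a column of the heap of [h] is the number of strands crossing a
    cut. The obstacle is the middles of 321 in [w]: when a strand of [h] is such a middle, its
    direction in [h] is not the label recorded in [w]. A middle has one inversion on each side,
    hence moves by at most one place inside [h]. A step to the left does not disturb the count of
    rightward strands, and a step to the right is excluded as soon as [h] has an internal column.
    Supports of one or two columns remain; they are treated by counting leftward strands instead, or
    by locating [h] inside the 321 itself. When [H] is empty, the height 1 equation of each class is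
    linear in its series, with [X * X * C] as the only other unknown. The equation of the
    321-avoiders is solved for this product, which is then substituted in the other two;
    algebraicity comes from eliminating [C] by its quadratic equation. *)

Definition series : Type := fps.

HB.instance Definition _ := gen_eqMixin series.
HB.instance Definition _ := gen_choiceMixin series.

Definition trunc (N : nat) (F : series) : {poly rat} := \poly_(i < N) F i.

(** Low coefficients only see truncations, so the ring laws of series are inherited from those of
    polynomials. *)
Lemma fps_mul_trunc N (F G : series) n : (n < N)%N ->
  fps_mul F G n = (trunc N F * trunc N G)`_n.
Proof.
move=> lt_nN; rewrite coefM; apply: eq_bigr => i _.
have lt_iN : (i < N)%N by apply: leq_ltn_trans lt_nN; rewrite -ltnS.
by rewrite !coef_poly lt_iN (leq_ltn_trans (leq_subr _ _) lt_nN).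
Qed.

Definition series_add (F G : series) : series := fun n => F n + G n.
Definition series_opp (F : series) : series := fun n => - F n.
Definition series_zero : series := fun _ => 0.

Lemma series_addA : associative series_add.
Proof. by move=> F G K; apply: funext => n; rewrite /series_add addrA. Qed.

Lemma series_addC : commutative series_add.
Proof. by move=> F G; apply: funext => n; rewrite /series_add addrC. Qed.

Lemma series_add0 : left_id series_zero series_add.
Proof. by move=> F; apply: funext => n; rewrite /series_add add0r. Qed.

Lemma series_addN : left_inverse series_zero series_opp series_add.
Proof. by move=> F; apply: funext => n; rewrite /series_add addNr. Qed.

HB.instance Definition _ :=
  GRing.isZmodule.Build series series_addA series_addC series_add0 series_addN.

Lemma coef_trunc_mul N (F G : series) n : (n < N)%N ->
  (trunc N (fps_mul F G))`_n = (trunc N F * trunc N G)`_n.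
Proof. by move=> lt_nN; rewrite coef_poly lt_nN (fps_mul_trunc _ _ lt_nN). Qed.

Lemma series_mulA : associative (fps_mul : series -> series -> series).
Proof.
move=> F G K; apply: funext => n.
rewrite !(@fps_mul_trunc n.+1) //.
have E1 : (trunc n.+1 F * trunc n.+1 (fps_mul G K))`_n =
          (trunc n.+1 F * (trunc n.+1 G * trunc n.+1 K))`_n.
  rewrite !coefM; apply: eq_bigr => i _; congr (_ * _).
  by rewrite coef_trunc_mul // ltnS leq_subr.
have E2 : (trunc n.+1 (fps_mul F G) * trunc n.+1 K)`_n =
          (trunc n.+1 F * trunc n.+1 G * trunc n.+1 K)`_n.
  rewrite [LHS]coefM [RHS]coefM; apply: eq_bigr => i _; congr (_ * _).
  by rewrite coef_trunc_mul.
by rewrite E1 E2 mulrA.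
Qed.

Lemma series_mulC : commutative (fps_mul : series -> series -> series).
Proof.
by move=> F G; apply: funext => n; rewrite !(@fps_mul_trunc n.+1) // mulrC.
Qed.

Lemma fps_poly_mul (p : {poly rat}) (F : series) n :
  fps_mul (fps_poly p) F n = \sum_(i < n.+1) p`_i * F (n - i)%N.
Proof. by []. Qed.

Lemma series_mul1 : left_id (fps_poly 1 : series) fps_mul.
Proof.
move=> F; apply: funext => n; rewrite fps_poly_mul big_ord_recl /= coef1 mul1r.
by rewrite subn0 big1 ?addr0 // => i _; rewrite coef1 mul0r.
Qed.

Lemma series_mulDl :
  left_distributive (fps_mul : series -> series -> series) series_add.
Proof.
move=> F G K; apply: funext => n; rewrite /series_add /fps_mul -big_split.
by apply: eq_bigr => i _; rewrite mulrDl.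
Qed.

Lemma series_1_neq0 : (fps_poly 1 : series) != (0 : series).
Proof. by apply/eqP => /(congr1 (fun F => F 0%N)); rewrite /fps_poly coef1. Qed.

HB.instance Definition _ := GRing.Zmodule_isComNzRing.Build series
  series_mulA series_mulC series_mul1 series_mulDl series_1_neq0.

Definition ps (p : {poly rat}) : series := fps_poly p.

Lemma ps_additive : zmod_morphism ps.
Proof. by move=> p q; apply: funext => n; rewrite /ps /fps_poly coefB. Qed.

Lemma ps_multiplicative : monoid_morphism ps.
Proof.
by split=> // p q; apply: funext => n; rewrite /ps /fps_poly coefM.
Qed.

HB.instance Definition _ := GRing.isZmodMorphism.Build {poly rat} series ps
  ps_additive.
HB.instance Definition _ := GRing.isMonoidMorphism.Build {poly rat} series ps
  ps_multiplicative.

Lemma seriesDE (F G : series) n : (F + G) n = F n + G n.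
Proof. by []. Qed.

Lemma series_sumE (I : Type) (r : seq I) (P : pred I) (F : I -> series) n :
  (\sum_(i <- r | P i) F i) n = \sum_(i <- r | P i) F i n.
Proof. by elim/big_rec2: _ => // i y x _ <-; rewrite seriesDE. Qed.

Lemma ps_inj : injective ps.
Proof.
by move=> p q epq; apply/polyP => i; apply: (congr1 (fun F : series =>
  F i) epq).
Qed.

Lemma psX0 (F : series) : (ps 'X * F) 0%N = 0.
Proof. by rewrite [LHS]big_ord1 /ps /fps_poly coefX mul0r. Qed.

Lemma psXS (F : series) n : (ps 'X * F) n.+1 = F n.
Proof.
rewrite [LHS]big_ord_recl [X in X + _]/= /ps /fps_poly coefX mul0r add0r.
rewrite big_ord_recl big1 => [|i _]; last by rewrite coefX mul0r.
by rewrite coefX mul1r addr0 subSS subn0.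
Qed.

(** The lowest nonzero coefficient of [q] would survive in the product. This certifies that a
    denominator is nonzero when it factors through such a [D]. *)
Lemma ps_mul_eq0 (q : {poly rat}) (D : series) :
  D 0%N != 0 -> ps q * D = 0 -> q = 0.
Proof.
move=> D0 qD; apply/polyP => n; rewrite coef0.
elim/ltn_ind: n => n IH.
have: fps_mul (fps_poly q) D n = 0 := congr1 (fun F : series => F n) qD.
rewrite fps_poly_mul big_ord_recr big1 => [|i _].
  by rewrite /= add0r subnn => /eqP; rewrite mulf_eq0 (negbTE D0) orbF => /eqP.
by rewrite (IH i) ?mul0r ?ltn_ord.
Qed.

Lemma rational_fpsP (F : series) :
  rational_fps F <-> exists p q : {poly rat}, q != 0 /\ ps q * F = ps p.
Proof.
split=> -[p [q [q0 e]]]; exists p, q; split=> //.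
  exact: funext.
by move=> n; apply: (congr1 (fun F : series => F n) e).
Qed.

Lemma fps_expE (F : series) k : fps_exp F k = F ^+ k.
Proof. by elim: k => // k IH; rewrite exprS -IH. Qed.

Lemma algebraic_fpsP (F : series) :
  algebraic_fps F <->
  exists P : {poly {poly rat}}, P != 0 /\ (map_poly ps P).[F] = 0.
Proof.
have E P : (map_poly ps P).[F] = \sum_(k < size P) ps P`_k * F ^+ k.
  have ps0 : ps 0 = 0 := rmorph0 _.
  rewrite horner_coef size_map_inj_poly //; last exact: ps_inj.
  by apply: eq_bigr => i _; rewrite coef_map.
split=> -[P [P0 e]]; exists P; split=> //.
  rewrite E; apply: funext => n; rewrite series_sumE -[RHS](e n).
  by apply: eq_bigr => i _; rewrite fps_expE.
move=> n; move/(congr1 (fun F : series => F n)): e.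
rewrite E series_sumE => e; rewrite -[RHS]e.
by apply: eq_bigr => i _; rewrite fps_expE.
Qed.

Lemma rational_algebraic (F : series) : rational_fps F -> algebraic_fps F.
Proof.
move=> /rational_fpsP[p [q [q0 e]]]; apply/algebraic_fpsP.
exists (q *: 'X - p%:P); split.
  apply/eqP => /(congr1 (fun P : {poly {poly rat}} => P`_1)).
  rewrite coefB coefZ coefX coefC subr0 mulr1 coef0 => q00.
  by rewrite q00 eqxx in q0.
rewrite rmorphB /= map_polyZ map_polyX map_polyC /= !hornerE e.
by rewrite subrr.
Qed.

(** The denominator is the reversed list of the [l i]: the coefficient of [q * F] at [n >= d] is
    then the recurrence at [n - d], so the product is a polynomial of size at most [d]. *)
Lemma rational_of_recurrence (F : series) d (l : 'I_d.+1 -> rat) :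
  (exists i, l i != 0) -> (forall n, \sum_(i < d.+1) l i * F (n + i)%N = 0) ->
  rational_fps F.
Proof.
move=> [i0 li0] rec.
pose q : {poly rat} := \poly_(j < d.+1) l (rev_ord (inord j)).
exists (trunc d (ps q * F)), q; split.
  apply/eqP => /(congr1 (fun p : {poly rat} => p`_(rev_ord i0))).
  rewrite coef0 coef_poly ltn_ord inord_val rev_ordK => l0.
  by rewrite l0 eqxx in li0.
move=> n; rewrite /fps_poly coef_poly; case: ltnP => // le_dn.
rewrite -[RHS](rec (n - d)%N) (reindex_inj rev_ord_inj) /=.
rewrite fps_poly_mul -(subnK le_dn); set m := (n - d)%N.
have -> : (m + d).+1 = (d.+1 + m)%N by rewrite addSn addnC.
rewrite big_split_ord /= addrC big1 ?add0r => [|i _]; last first.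
  by rewrite coef_poly ltnNge leq_addr mul0r.
apply: eq_bigr => i _.
rewrite coef_poly ltn_ord inord_val /=; congr (_ * F _).
by have := ltn_ord i; lia.
Qed.

(** * Rationality of the series counted by a finite automaton *)

Definition nb_accepted (A Q : finType) (step : Q -> A -> Q) (acc : pred Q) n
    (q : Q) : nat := #|[set z : n.-tuple A | acc (foldl step q z)]|.

Lemma card_tuple_cons (A : finType) n (P : pred (seq A)) :
  #|[set z : n.+1.-tuple A | P z]| =
  (\sum_(a : A) #|[set z : n.-tuple A | P (a :: z)]|)%N.
Proof.
rewrite -sum1dep_card.
under [RHS]eq_bigr => a _ do rewrite -sum1dep_card big_mkcond.
rewrite big_mkcond pair_big /=.
rewrite (reindex (fun p : A * n.-tuple A => [tuple of p.1 :: p.2])) /=;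
  last first.
  exists (fun z : n.+1.-tuple A => (thead z, [tuple of behead z])).
    by move=> [a z] _; rewrite /= theadE; congr (_, _); apply: val_inj.
  by move=> z _; rewrite [RHS]tuple_eta; apply: val_inj.
by [].
Qed.

Lemma nb_acceptedS (A Q : finType) (step : Q -> A -> Q) (acc : pred Q) n q :
  nb_accepted step acc n.+1 q =
    (\sum_(a : A) nb_accepted step acc n (step q a))%N.
Proof.
exact: (card_tuple_cons n (fun z : seq A => acc (foldl step q z))).
Qed.

(* The counting vectors indexed by the states live in a space of finite dimension,
   so they satisfy a linear dependence, which the automaton propagates. *)
Lemma rational_automaton (A Q : finType) (step : Q -> A -> Q) (acc : pred Q)
    (q0 : Q) (F : series) :
  (forall n, F n = (nb_accepted step acc n.+1 q0)%:R) -> rational_fps F.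
Proof.
move=> FE; set d := #|Q|.
pose C : 'M[rat]_(d.+1, d) :=
  \matrix_(i, j) (nb_accepted step acc i (enum_val j))%:R.
have kC : kermx C != 0.
  rewrite -mxrank_eq0 mxrank_ker subn_eq0 -ltnNge ltnS.
  exact: rank_leq_col.
have [v vC v0] : exists2 v : 'rV_d.+1, v *m C = 0 & v != 0.
  have /row_subPn[i] : ~~ (kermx C <= (0 : 'M[rat]_d.+1))%MS by rewrite submx0.
  rewrite submx0 => v0.
  exists (row i (kermx C)) => //.
  by apply: sub_kermxP; rewrite row_sub.
have rec n : forall q, \sum_(i < d.+1) v 0 i * (nb_accepted step acc (n +
  i) q)%:R = 0.
  elim: n => [|n IH] q.
    have := congr1 (fun M : 'rV_d => M 0 (enum_rank q)) vC.
    rewrite !mxE => vCq; rewrite -[RHS]vCq.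
    by apply: eq_bigr => i _; rewrite mxE enum_rankK.
  under eq_bigr => i _ do rewrite addSn nb_acceptedS natr_sum mulr_sumr.
  by rewrite exchange_big big1 // => a _; rewrite IH.
apply: (@rational_of_recurrence _ d (fun i => v 0 i)).
  by case/rV0Pn: v0 => i vi; exists i.
by move=> n; rewrite -[RHS](rec n.+1 q0); apply: eq_bigr => i _;
  rewrite FE addSn.
Qed.

(** * Lattice walks *)

(** Congruence modulo [X ^ n]. A factor [X] gains one order ([agreeX]), which makes fixed point
    equations contracting. *)
Definition agree n (F G : series) := forall i, (i < n)%N -> F i = G i.

Lemma agreeD n (F F' G G' : series) :
  agree n F F' -> agree n G G' -> agree n (F + G) (F' + G').
Proof. by move=> eF eG i lt_in; rewrite !seriesDE eF ?eG. Qed.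

Lemma agreeMl n (K F G : series) : agree n F G -> agree n (K * F) (K * G).
Proof.
move=> e i lt_in; rewrite [LHS]/GRing.mul [RHS]/GRing.mul /= /fps_mul.
by apply: eq_bigr => j _; rewrite e //; lia.
Qed.

Lemma agree_mul n (F F' G G' : series) :
  agree n F F' -> agree n G G' -> agree n (F * G) (F' * G').
Proof.
move=> eF eG i lt_in; rewrite (agreeMl F eG) // mulrC (agreeMl G' eF) //.
by rewrite mulrC.
Qed.

Lemma agreeX n (F G : series) :
  agree n F G -> agree n.+1 (ps 'X * F) (ps 'X * G).
Proof. by move=> e [|i] lt_in; rewrite ?psX0 ?psXS ?e. Qed.

Lemma agree_eq (F G : series) : (forall n, agree n F G) -> F = G.
Proof. by move=> e; apply: funext => n; apply: (e n.+1). Qed.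

(** The solution is the limit of the iterates of the contracting map [Phi]; the iterate of index
    [n.+1] already has the right coefficient at [n]. *)
Lemma bicolored_motzkin_series :
  exists C : series, C = 1 + ps 'X * (C *+ 2 + ps 'X * (C * C)).
Proof.
pose Phi (F : series) : series := 1 + ps 'X * (F *+ 2 + ps 'X * (F * F)).
have PhiE n F G : agree n F G -> agree n.+1 (Phi F) (Phi G).
  move=> e; apply: agreeD => //; apply: agreeX; rewrite !mulr2n.
  by apply: agreeD; [apply: agreeD | apply: agreeMl; apply: agree_mul].
have stable n k : agree n (iter n Phi 0) (iter (n + k) Phi 0).
  by elim: n => // n IH; rewrite addSn !iterS; apply: PhiE.
pose C : series := fun n => iter n.+1 Phi 0 n.
exists C; apply: agree_eq => n i lt_in.
have eC m : agree m C (iter m Phi 0).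
  by move=> j lt_jm; rewrite -(subnKC lt_jm); apply: (stable j.+1).
exact/esym/(PhiE i _ _ (eC i)).
Qed.

Lemma series1E n : (1 : series) n = (n == 0%N)%:R.
Proof. exact: coef1. Qed.

(* The letter of a permutation at position [p] is [Some (a, b)] where [a] tells
   whether [p] is sent to the right and [b] whether the value [p] comes from the
   left; it is [None] if [p] is fixed and is the middle of a 321. *)
Definition letter : Type := option (bool * bool).

HB.instance Definition _ := Finite.on letter.

(* Words of letters as lattice walks from height [e] to 0, where the height is
   the number of entries in a column of the heap.  The letter [None] is allowed
   at height 1 only, and subject to [m], applied to whether it follows another
   [None]. *)
Fixpoint walk (m : bool -> bool) (pm : bool) (e : nat) (z : seq letter) :
    bool :=
  match z with
  | [::] => e == 0%N
  | None :: z' => [&& m pm, e == 1%N & walk m true e z']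
  | Some (a, b) :: z' => (b ==> (0 < e)%N) && walk m false (e + a - b) z'
  end.

Definition nb_walks m pm e n := #|[set z : n.-tuple letter | walk m pm e z]|.

Lemma sum_letter (f : letter -> nat) :
  (\sum_(l : letter) f l)%N =
  (f None + f (Some (true, true)) + f (Some (false, false))
    + f (Some (true, false)) + f (Some (false, true)))%N.
Proof.
rewrite (bigD1 None) //= (bigD1 (Some (true, true))) //=.
rewrite (bigD1 (Some (false, false))) //= (bigD1 (Some (true, false))) //=.
rewrite (bigD1 (Some (false, true))) //= big1 ?addn0 ?addnA //.
by move=> [[[] []]|].
Qed.

Lemma card_set_andb (T : finType) (b : bool) (P : pred T) :
  #|[set z | b && P z]| = (b * #|[set z | P z]|)%N.
Proof.
by case: b => /=; rewrite ?mul1n // mul0n; apply/eqP; rewrite cards_eq0;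
  apply/eqP/setP => z; rewrite !inE.
Qed.

Lemma nb_walks0 m pm e : nb_walks m pm e 0 = (e == 0%N).
Proof.
rewrite /nb_walks; have [->|e0] := eqVneq e 0%N.
  have -> : [set z : 0.-tuple letter | walk m pm 0 z] = setT.
    by apply/setP => z; rewrite !inE tuple0.
  by rewrite cardsT card_tuple expn0.
by apply/eqP; rewrite cards_eq0; apply/eqP/setP => z;
  rewrite !inE tuple0 /= (negbTE e0).
Qed.

(** One term per first letter, in the order of [sum_letter]. The letters with second component
    [true] need a positive height, whence the factors [0 < e]. *)
Lemma nb_walksS m pm e n : nb_walks m pm e n.+1 =
  (m pm && (e == 1) * nb_walks m true e n + (0 < e) * nb_walks m false e n
   + nb_walks m false e n + nb_walks m false e.+1 n
   + (0 < e) * nb_walks m false e.-1 n)%N.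
Proof.
rewrite /nb_walks (card_tuple_cons n (walk m pm e)) sum_letter /=.
rewrite !addn0 !addn1 !subn0 !subn1 /=.
under eq_finset => z do rewrite andbA.
by rewrite !card_set_andb.
Qed.

Section Walks.

Variable m : bool -> bool.

Definition walk_series pm e : series := fun n => (nb_walks m pm e n)%:R.

Local Notation B := (walk_series false).
Local Notation B' := (walk_series true).
Local Notation X := (ps 'X).

Lemma walk_seriesE pm e :
  walk_series pm e = (e == 0%N)%:R + X *
    ((m pm && (e == 1%N))%:R * B' e + (0 < e)%N%:R * B e + B e + B e.+1
     + (0 < e)%N%:R * B e.-1).
Proof.
have natE (b : bool) (F : series) i : (b%:R * F) i = b%:R * F i.
  by case: b; rewrite ?mul1r // !mul0r.
apply: funext => -[|n]; rewrite seriesDE ?psX0 ?psXS.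
  rewrite addr0 /walk_series nb_walks0; case: (e == 0%N) => //.
  exact/esym/(series1E 0).
rewrite !seriesDE !natE /walk_series nb_walksS !natrD !natrM.
suff -> : ((e == 0%N)%:R : series) n.+1 = 0 by rewrite add0r.
by case: (e == 0%N) => //; apply: (series1E n.+1).
Qed.

Lemma walk_series0 : B 0 = 1 + X * (B 0 + B 1).
Proof. by rewrite [LHS]walk_seriesE andbF /= ?(mulr0n, mulr1n); ring. Qed.

Lemma walk_series1 pm :
  walk_series pm 1 = X * ((m pm)%:R * B' 1 + B 1 *+ 2 + B 2 + B 0).
Proof. by rewrite [LHS]walk_seriesE andbT /= ?(mulr0n, mulr1n); ring. Qed.

Lemma walk_seriesSS e :
  B e.+2 = X * (B e.+2 *+ 2 + B e.+3 + B e.+1).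
Proof. by rewrite [LHS]walk_seriesE andbF /= ?(mulr0n, mulr1n); ring. Qed.

Variable C : series.
Hypothesis CE : C = 1 + X * (C *+ 2 + X * (C * C)).

(* Above height 1 a walk never uses [None], so each extra level contributes the
   same factor, that of the bicoloured Motzkin walks. *)
Lemma walk_series_step e : B e.+2 = X * C * B e.+1.
Proof.
(* Both sides satisfy the same recursion with a factor [X] in front, so agreement modulo [X ^ n] at
   all heights yields one more coefficient. *)
apply: agree_eq => n; elim: n e => // n IH e.
rewrite walk_seriesSS [in X in agree _ _ X]CE.
have -> : X * (1 + X * (C *+ 2 + X * (C * C))) * B e.+1 =
    X * ((X * C * B e.+1) *+ 2 + X * C * (X * C * B e.+1) + B e.+1) by ring.
apply: agreeX; apply: agreeD => //.
apply: agreeD; first by rewrite !mulr2n; apply: agreeD.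
by move=> i lt_in; rewrite IH //; apply: agreeMl lt_in.
Qed.

End Walks.

Lemma psX_inj (F G : series) : ps 'X * F = ps 'X * G -> F = G.
Proof.
by move=> e; apply: funext => n; rewrite -(psXS F) -(psXS G) e.
Qed.

Definition walk_gf m : series := fun n => (nb_walks m false 0 n.+1)%:R.

Lemma walk_series_gf m : walk_series m false 0 = 1 + ps 'X * walk_gf m.
Proof.
apply: funext => -[|n]; rewrite seriesDE ?psX0 ?psXS.
  by rewrite /walk_series nb_walks0 addr0 series1E.
suff -> : (1 : series) n.+1 = 0 by rewrite add0r.
by rewrite series1E.
Qed.

(** The height 0 equation [walk_series0] is solved for the series at height 1, after cancelling
    [X]. *)
Lemma walk_series1_gf m :
  walk_series m false 1 = (1 - ps 'X) * walk_gf m - 1.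
Proof.
apply: psX_inj; have := walk_series0 m; rewrite walk_series_gf => e.
rewrite [in LHS](_ : walk_series m false 1 = 1 + ps 'X * walk_gf m
  + walk_series m false 1 - (1 + ps 'X * walk_gf m)); last by ring.
by rewrite mulrBr -[X in X - _](addKr 1) -e; ring.
Qed.

(** * Eliminating the bicoloured Motzkin series *)

Section WalkTransfer.

Local Notation X := (ps 'X).

Section WalkEquation.

Variables (a c d : {poly rat}) (C g : series).
Hypothesis CE : C = 1 + X * (C *+ 2 + X * (C * C)).

(** By [walk_series1_gf] this is the series from height 1, and [1 + X * g] is the one from height 0.
    The hypothesis [bE] is the height 1 equation in which the series from height 2 has been replaced
    by [X * C * b]; the classes differ only in [a], [c] and [d]. *)
Let b := (1 - X) * g - 1.

Hypothesis bE : ps a * b - ps c * (1 + X * g) = ps d * (X * X * C) * b.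

(** Multiplying the quadratic equation of [C] by [(d * X * b) ^+ 2] makes [C] appear only through
    [d * X * X * C * b], which [bE] expresses by [g]. The hypothesis is the value of the resulting
    polynomial at [y = 0], [x = 1], and shows that it is not zero. *)
Lemma walk_equation_algebraic :
  (a + c).[1] * (a + c).[1] + d.[1] * (a + c).[1] + d.[1] * d.[1] != 0 ->
  algebraic_fps g.
Proof.
move=> nz; apply/algebraic_fpsP.
have [B BE B0] : exists2 B : {poly {poly rat}}, (map_poly ps B).[g] =
  b & B.[0] = -1.
  exists ((1 - 'X)%:P * 'X - 1).
    rewrite rmorphB rmorphM /= !map_polyC map_polyX rmorph1 /=.
    by rewrite !(hornerD, hornerN, hornerM, hornerC, hornerX) rmorphB rmorph1.
  by rewrite !(hornerD, hornerN, hornerM, hornerC, hornerX) mulr0 add0r.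
have [U UE U0] : exists2 U : {poly {poly rat}},
    (map_poly ps U).[g] = ps d * (X * X * C) * b & U.[0] = - (a + c).
  exists (a%:P * B - c%:P * (1 + 'X%:P * 'X)).
    rewrite -bE !(rmorphB, rmorphM, rmorphD,
      rmorph1) /= !map_polyC map_polyX /=.
    by rewrite !(hornerD, hornerN, hornerM, hornerC, hornerX) BE.
  by rewrite !(hornerD, hornerN, hornerM, hornerC, hornerX) B0; ring.
exists (U * U + ('X *+ 2 - 1)%:P * d%:P * U * B +
  ('X%:P * d%:P * B) * ('X%:P * d%:P * B)).
split.
  apply: contra nz => /eqP /(congr1 (fun P : {poly {poly rat}} => P.[0].[1])).
  rewrite !(hornerD, hornerM, hornerC) B0 U0.
  rewrite !(hornerD, hornerN, hornerM, hornerC, hornerX, hornerMn) => e.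
  by apply/eqP; rewrite -[RHS]e; ring.
rewrite !(rmorphD, rmorphM) /= !map_polyC /= !(hornerD, hornerM, hornerC) BE UE.
rewrite !(rmorphB, rmorphN, rmorph1, rmorphMn) /=.
have -> : ps d * (X * X * C) * b * (ps d * (X * X * C) * b) +
   (X *+ 2 - 1) * ps d * (ps d * (X * X * C) * b) * b +
   X * ps d * b * (X * ps d * b) =
   ps d * ps d * X * X * b * b * (1 + X * (C *+ 2 + X * (C * C)) - C) by ring.
by rewrite -CE subrr mulr0.
Qed.

(** Once [X * X * C] is a fraction, [bE] is linear in [g]. The coefficient of [g] is [s] times a
    series with constant term that of [a], hence is nonzero by [ps_mul_eq0]. *)
Lemma walk_equation_rational (s w : {poly rat}) :
  a`_0 != 0 -> s != 0 -> ps s * (X * X * C) = ps w -> rational_fps g.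
Proof.
move=> a0 s0 sw; apply/rational_fpsP.
pose D := (a * s - d * w) * (1 - 'X) - c * 'X * s.
exists ((a * s - d * w) + c * s), D.
have DE : ps D = ps s * ((ps a - ps d * (X * X * C)) * (1 - X) - ps c * X).
  rewrite /D !(rmorphB, rmorphM, rmorph1) /= -sw; ring.
split.
  apply: contra s0 => /eqP D0; apply/eqP.
  apply: (@ps_mul_eq0 _ ((ps a - ps d * (X * X * C)) * (1 - X) - ps c * X)).
    have -> : (ps a - ps d * (X * X * C)) * (1 - X) - ps c * X =
      ps a + X * (- ps a - ps d * X * C * (1 - X) - ps c) by ring.
    by rewrite seriesDE psX0 addr0.
  by rewrite -DE D0 rmorph0.
have e : ps s * (ps a * b - ps c * (1 + X * g)) = ps d * ps w * b.
  by rewrite bE -sw; ring.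
apply/eqP; rewrite -subr_eq0; apply/eqP.
have -> : ps D * g - ps (a * s - d * w + c * s) =
  ps s * (ps a * b - ps c * (1 + X * g)) - ps d * ps w * b.
  rewrite /D /b !(rmorphB, rmorphM, rmorphD, rmorph1); ring.
by rewrite e subrr.
Qed.

(** The relation is read backwards, as an expression of [X * X * C] with denominator [s = q * b]. If
    [q * b] vanished, [bE] would make [X * q * (1 + X * g)] vanish too, and both together force
    [p = q = 0]. *)
Lemma rational_kernel : a = 1 - 'X *+ 2 -> c = 'X -> d = 1 ->
  rational_fps g -> exists s w : {poly rat}, s != 0 /\ ps s * (X * X * C) =
    ps w.
Proof.
move=> aE cE dE /rational_fpsP[p [q [q0 e]]].
exists ((1 - 'X) * p - q), ((1 - 'X *+ 2) * ((1 - 'X) * p - q) - 'X * q - 'X *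
  'X * p).
have XX0 : ('X : {poly rat}) != 0 by rewrite polyX_eq0.
split.
  apply/eqP => s0; have qE : q = (1 - 'X) * p by apply/esym/eqP;
    rewrite -subr_eq0 s0.
  have sb : ps q * b = 0.
    have -> : ps q * b = (1 - X) * (ps q * g) - ps q by rewrite /b; ring.
    by rewrite e -(rmorph1 ps) -rmorphB -rmorphM -rmorphB s0 rmorph0.
  have : 'X * p = 0.
    apply: ps_inj; rewrite rmorph0.
    have -> : ps ('X * p) = X * ps q + X * X * ps p.
      by rewrite qE !(rmorphB, rmorphM, rmorph1); ring.
    have -> : X * ps q + X * X * ps p = - (ps q * (ps a * b - ps c * (1 +
      X * g)))
         + ps a * (ps q * b).
      by rewrite cE -e; ring.
    by rewrite bE sb mulr0 addr0 mulrCA sb mulr0 oppr0.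
  move/eqP; rewrite mulf_eq0 (negbTE XX0) /= => /eqP p0.
  by rewrite qE p0 mulr0 eqxx in q0.
have -> : ps ((1 - 'X) * p - q) = ps q * b.
  rewrite !(rmorphB, rmorphM, rmorph1) /= -e /b; ring.
rewrite !(rmorphB, rmorphM, rmorph1) /= rmorphMn /= -e.
have -> : ps q * b * (X * X * C) = ps q * (ps a * b - ps c * (1 + X * g)).
  by rewrite bE dE rmorph1; ring.
rewrite aE cE rmorphB rmorph1 rmorphMn /b /=; ring.
Qed.

End WalkEquation.

(** Reduces a goal to a known equation up to an identity that [ring] can check. *)
Lemma eq_by_sub (V : zmodType) (x y u v : V) : u = v -> x - y = u - v -> x = y.
Proof. by move=> ->; rewrite subrr => /eqP; rewrite subr_eq0 => /eqP. Qed.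

Lemma walk_gf_transfer :
  (rational_fps (walk_gf (fun=> false)) ->
     rational_fps (walk_gf negb) /\ rational_fps (walk_gf (fun=> true))) /\
  (algebraic_fps (walk_gf negb) /\ algebraic_fps (walk_gf (fun=> true))).
Proof.
have [C CE] := bicolored_motzkin_series.
have step m := walk_series_step m CE 0.
have E0 : ps (1 - 'X *+ 2) * ((1 - X) * walk_gf (fun=> false) - 1) -
    ps 'X * (1 + X * walk_gf (fun=> false)) =
    ps 1 * (X * X * C) * ((1 - X) * walk_gf (fun=> false) - 1).
  rewrite -walk_series1_gf -walk_series_gf rmorphB rmorphMn rmorph1 /=.
  have := walk_series1 (fun=> false) false; rewrite step /= mulr0n.
  set b1 := walk_series _ false 1; set b0 := walk_series _ false 0; move=> e.
  by apply: (eq_by_sub e); ring.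
(* Here the series after a [None] differs from [b1] by lacking its [None] term. Eliminating it
   multiplies the remaining terms by [X * (1 + X)], which gives these coefficients. *)
have E1 : ps (1 - 'X *+ 2 - 'X *+ 2 * 'X) * ((1 - X) * walk_gf negb - 1) -
    ps ('X + 'X * 'X) * (1 + X * walk_gf negb) =
    ps (1 + 'X) * (X * X * C) * ((1 - X) * walk_gf negb - 1).
  rewrite -walk_series1_gf -walk_series_gf !(rmorphB, rmorphD, rmorphM).
  rewrite rmorph1 /=.
  have := walk_series1 negb false; have := walk_series1 negb true.
  rewrite step /= mulr0n mulr1n.
  set b1 := walk_series _ false 1; set b0 := walk_series _ false 0.
  set b1' := walk_series _ true 1 => e' e.
  apply: (@eq_by_sub _ _ _ (b1 + X * b1') (X * (b1' + b1 *+ 2 + X * C * b1 + b0)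
    + X * (X * (0 * b1' + b1 *+ 2 + X * C * b1 + b0))));
        first by rewrite -e' {1}e mul1r.
  ring.
(* An unrestricted [None] is simply a third level step at height 1. *)
have E2 : ps (1 - 'X *+ 3) * ((1 - X) * walk_gf (fun=> true) - 1) -
    ps 'X * (1 + X * walk_gf (fun=> true)) =
    ps 1 * (X * X * C) * ((1 - X) * walk_gf (fun=> true) - 1).
  rewrite -walk_series1_gf -walk_series_gf rmorphB rmorphMn rmorph1 /=.
  have := walk_series1 (fun=> true) false; have := walk_series1 (fun=>
    true) true.
  rewrite step /= mulr1n.
  set b1 := walk_series _ false 1; set b0 := walk_series _ false 0.
  set b1' := walk_series _ true 1 => e' e.
  have eb : b1' = b1 := etrans e' (esym e).
  by rewrite eb in e; apply: (eq_by_sub e); ring.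
split; last first.
  split.
    apply: (walk_equation_algebraic CE E1).
    by rewrite !(hornerD, hornerN, hornerM, hornerC, hornerX, hornerMn).
  apply: (walk_equation_algebraic CE E2).
  by rewrite !(hornerD, hornerN, hornerM, hornerC, hornerX, hornerMn).
move=> /(rational_kernel E0 erefl erefl erefl) [s [w [s0 sw]]].
split.
  apply: (walk_equation_rational E1 _ s0 sw).
  by rewrite !(coefD, coefN, coefMn, coef1, coefX, coefMX).
apply: (walk_equation_rational E2 _ s0 sw).
by rewrite !(coefD, coefN, coefMn, coef1, coefX, coefMX).
Qed.

End WalkTransfer.

Local Close Scope ring_scope.

(** * Inversions and reduced words *)

Section PermOnNat.

Variable n : nat.
Implicit Types (w a b : 'S_n) (x y : 'I_n) (i : 'I_n.-1).

(** Extension by the identity to all of [nat], so that translates and permutations of different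
    sizes compare without transporting ordinals. *)
Definition papp w (k : nat) : nat := if insub k is Some x then val (w x) else k.

Lemma papp_ord w x : papp w x = w x.
Proof. by rewrite /papp insubT // => lt_xn; congr (val (w _));
  apply: val_inj. Qed.

Lemma papp_out w k : n <= k -> papp w k = k.
Proof. by move=> le_nk; rewrite /papp insubF // ltnNge le_nk. Qed.

Variant papp_spec w (k : nat) : nat -> Type :=
  | PappOrd x of k = x : papp_spec w k (w x)
  | PappOut of n <= k : papp_spec w k k.

Lemma pappP w k : papp_spec w k (papp w k).
Proof.
have [le_nk|lt_kn] := leqP n k; first by rewrite papp_out //; constructor.
have /= -> := papp_ord w (Ordinal lt_kn); exact: (@PappOrd w k (Ordinal lt_kn)).
Qed.

Lemma papp_lt w k : (papp w k < n) = (k < n).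
Proof.
by case: pappP => [x ->|le_nk]; rewrite ?ltn_ord.
Qed.

Lemma papp_inj w : injective (papp w).
Proof.
move=> j k; case: (pappP w j) => [x ->|le_nj]; case: (pappP w k) =>
  [y ->|le_nk] e.
- by congr val; apply: (@perm_inj _ w); apply: val_inj.
- by have := ltn_ord (w x); rewrite e ltnNge le_nk.
- by have := ltn_ord (w y); rewrite -e ltnNge le_nj.
- by [].
Qed.

Lemma pappM a b k : papp (a * b)%g k = papp b (papp a k).
Proof.
case: (pappP a k) => [x ->|le_nk]; last by rewrite !papp_out.
by rewrite !papp_ord permM.
Qed.

Lemma papp1 k : papp (1 : 'S_n)%g k = k.
Proof. by case: pappP => // x ->; rewrite perm1. Qed.

Lemma papp_eq a b : papp a =1 papp b -> a = b.
Proof. by move=> e; apply/permP => x; apply: val_inj; have := e x;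
  rewrite !papp_ord. Qed.

Lemma pappK w k : papp w^-1 (papp w k) = k.
Proof. by rewrite -pappM mulgV papp1. Qed.

Lemma pappKV w k : papp w (papp w^-1 k) = k.
Proof. by rewrite -pappM mulVg papp1. Qed.

Definition swap (i k : nat) : nat :=
  if k == i then i.+1 else if k == i.+1 then i else k.

Lemma papp_adj i k : papp (adj i) k = swap i k.
Proof.
case: pappP => [x ->|le_nk].
  rewrite /adj /swap permE /= -!val_eqE /=.
  by case: eqP => // _; case: eqP.
have := ltn_ord i; rewrite /swap; case: eqP => [e|_]; first by lia.
by case: eqP => // e; lia.
Qed.

End PermOnNat.

Lemma descent_between (f : nat -> nat) x y :
  x < y -> f y < f x -> exists i, [/\ x <= i, i < y & f i.+1 < f i].
Proof.
elim: y => // y IH; rewrite ltnS leq_eqVlt => /predU1P[-> lt_f|lt_xy lt_f].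
  by exists y.
have [lt_y|le_y] := ltnP (f y.+1) (f y); first by exists y; rewrite ltnW.
have [i [le_xi lt_iy lt_i]] := IH lt_xy (leq_ltn_trans le_y lt_f).
by exists i; rewrite le_xi lt_i ltnS ltnW.
Qed.

Lemma card_ord_lt n k : k <= n -> #|[set y : 'I_n | y < k]| = k.
Proof.
by move=> le_kn; rewrite -sum1dep_card (big_ord_narrow le_kn) /= big_const_ord
  iter_addn_0 mul1n.
Qed.

Section Inversions.

Variable n : nat.
Implicit Types (w a b : 'S_n) (x y : 'I_n) (i : 'I_n.-1) (u : seq 'I_n.-1).

(** Written with an exclusive or, the relation is symmetric and satisfies the cocycle identity
    [inv_pairM] under composition. *)
Definition inv_pair w x y : bool := (x < y) (+) (w x < w y).

(* Ordered pairs are counted, so this is twice the Coxeter length. *)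
Definition len2 w := \sum_(p : 'I_n * 'I_n) inv_pair w p.1 p.2.

(** Nesting of inversion sets, that is, [a] lies below [a * b] in the weak order; [additiveP] shows
    that this is additivity of lengths. *)
Definition additive a b := forall x y, inv_pair a x y -> inv_pair (a * b)%g x y.

Lemma inv_pairM a b x y :
  inv_pair (a * b)%g x y = inv_pair a x y (+) inv_pair b (a x) (a y).
Proof.
by rewrite /inv_pair !permM; case: (a x < a y);
  rewrite ?addbT ?addbF ?addbN ?addNb ?negbK ?addFb.
Qed.

Lemma inv_pair_sym w x y : inv_pair w x y = inv_pair w y x.
Proof.
have [->//|ne] := eqVneq x y.
have : w x != w y by rewrite (inj_eq perm_inj).
rewrite -!val_eqE /inv_pair /= in ne *.
by case: (ltngtP x y) ne => // _ _; case: (ltngtP (w x) (w y)).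
Qed.

Lemma inv_pairP w x y : x < y -> inv_pair w x y = (w y < w x).
Proof.
move=> lt_xy; rewrite /inv_pair lt_xy /= -leqNgt leq_eqVlt.
by case: eqP => // /val_inj/perm_inj exy; rewrite exy ltnn in lt_xy.
Qed.

(** The inversion set of a product is the symmetric difference of that of [a] and that of [b]
    transported by [a]; pairs inverted by both factors are lost twice. *)
Lemma len2M a b : len2 (a * b)%g +
  2 * \sum_(p : 'I_n * 'I_n) (inv_pair a p.1 p.2 &&
    inv_pair b (a p.1) (a p.2)) =
  len2 a + len2 b.
Proof.
rewrite [len2 b](reindex (fun p : 'I_n * 'I_n => (a p.1, a p.2))) /=;
  last first.
  by exists (fun p => (a^-1 p.1, a^-1 p.2))%g => -[x y] _ /=;
    rewrite ?permK ?permKV.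
rewrite big_distrr /= -!big_split /=; apply: eq_bigr => -[x y] _ /=.
by rewrite inv_pairM; case: (inv_pair a x y); case: (inv_pair b _ _).
Qed.

Lemma additiveP a b : additive a b <-> len2 (a * b)%g = len2 a + len2 b.
Proof.
have := len2M a b; set s := \sum_p _ => e; split=> [ab|l].
  suff s0 : s = 0 by rewrite -e s0 muln0 addn0.
  rewrite /s big1 // => -[x y] _ /=; have := ab x y; rewrite inv_pairM.
  by case: (inv_pair a x y) => //= /(_ isT); case: (inv_pair b _ _).
have s0 : s = 0 by lia.
move=> x y axy; rewrite inv_pairM axy /=; apply/negP => bxy.
move/eqP: s0; rewrite sum_nat_eq0 => /forallP /(_ (x, y)) /=.
by rewrite axy bxy.
Qed.

Lemma len2_le a b : len2 (a * b)%g <= len2 a + len2 b.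
Proof. by rewrite -len2M leq_addr. Qed.

Lemma inv_pair_adj i x y : inv_pair (adj i) x y =
  (nat_of_ord x == i) && (nat_of_ord y == i.+1) || (nat_of_ord x == i.+1) &&
    (nat_of_ord y == i).
Proof.
rewrite /inv_pair -!papp_ord !papp_adj /swap.
by do ![case: eqP => ?]; lia.
Qed.

Lemma len2_adj i : len2 (adj i) = 2.
Proof.
pose p : 'I_n * 'I_n := (Ordinal (adj_ltl i), Ordinal (adj_ltr i)).
rewrite /len2 (bigD1 p) //= (bigD1 (p.2, p.1)) /=; last first.
  by rewrite /p xpair_eqE negb_and -!val_eqE /=; lia.
rewrite !inv_pair_adj /= !eqxx orbT big1 // => -[x y] /=.
rewrite !xpair_eqE -!val_eqE /= inv_pair_adj.
by do ![case: eqP => ?].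
Qed.

Lemma word_perm_cons i u : word_perm (i :: u) = (adj i * word_perm u)%g.
Proof. exact: big_cons. Qed.

Lemma word_perm_cat u v : word_perm (u ++ v) = (word_perm u * word_perm v)%g.
Proof. exact: big_cat. Qed.

Lemma len2_word u : len2 (word_perm u) <= 2 * size u.
Proof.
elim: u => [|i u IH].
  by rewrite /word_perm big_nil /len2 big1 // => p _;
    rewrite /inv_pair !perm1 addbb.
rewrite word_perm_cons; apply: leq_trans (len2_le _ _) _; rewrite len2_adj /=.
lia.
Qed.

Lemma additive_adj w i :
  papp w i.+1 < papp w i -> additive (adj i) (adj i * w)%g.
Proof.
move=> lt_w x y; rewrite mulgA tperm2 mul1g inv_pair_adj => xy.
wlog: x y xy / (nat_of_ord x == i) && (nat_of_ord y == i.+1) => [H|].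
  case/orP: (xy) => xy'; first exact: H.
  by rewrite inv_pair_sym; apply: H; rewrite andbC xy' // orbT.
move=> /andP[/eqP xi /eqP yi]; rewrite inv_pairP ?xi ?yi //.
by rewrite -!papp_ord xi yi.
Qed.

Lemma len2_adj_descent w i :
  papp w i.+1 < papp w i -> len2 w = 2 + len2 (adj i * w)%g.
Proof.
move=> /additive_adj/additiveP; rewrite mulgA tperm2 mul1g => ->.
by rewrite len2_adj.
Qed.

Lemma exists_descent w x y :
  x < y -> w y < w x -> exists i, [/\ x <= i, i < y & papp w i.+1 < papp w i].
Proof.
rewrite -!papp_ord => lt_xy /(descent_between lt_xy)[k [le_xk lt_ky lt_w]].
have lt_kn : k < n.-1 by have := ltn_ord y; lia.
by exists (Ordinal lt_kn).
Qed.

Lemma len2_eq0 w : len2 w = 0 -> w = 1%g.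
Proof.
move=> /eqP; rewrite sum_nat_eq0 => /forallP l0.
have mono x y : (w x < w y) = (x < y).
  by have := l0 (x, y); rewrite /inv_pair /=; case: (x < y); case: (w x < w y).
apply/permP => x; rewrite perm1; apply: val_inj => /=.
have E (z : 'I_n) := card_ord_lt (ltnW (ltn_ord z)).
rewrite -[LHS]E -[RHS]E -(card_imset [set y : 'I_n | y < x] (@perm_inj _ w)).
apply: eq_card => y; rewrite inE; apply/idP/imsetP => [lt_y|[z]].
  by exists (w^-1 y)%g; rewrite ?permKV // inE -mono permKV.
by rewrite inE => lt_z ->; rewrite mono.
Qed.

Lemma exists_word w : exists u, word_perm u = w /\ 2 * size u = len2 w.
Proof.
move: {2}(len2 w) (leqnn (len2 w)) => l; elim: l w => [|l IH] w le_l.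
  exists [::]; rewrite /word_perm big_nil.
  by move: le_l; rewrite leqn0 => /eqP l0; rewrite l0 (len2_eq0 l0).
have [l0|l_neq0] := eqVneq (len2 w) 0; first by apply: IH; rewrite l0.
have [[x y] _ xy] : exists2 p : 'I_n * 'I_n, true & inv_pair w p.1 p.2.
  move: l_neq0; rewrite sum_nat_eq0 negb_forall => /existsP[p p_inv].
  by exists p => //; case: (inv_pair w p.1 p.2) p_inv.
wlog lt_xy : x y xy / x < y => [H|].
  have [|lt_yx|/val_inj exy] := ltngtP x y; first exact: H.
    by apply: (H y x) => //; rewrite inv_pair_sym.
  by rewrite /inv_pair exy !ltnn in xy.
have [|i [_ _ des]] := @exists_descent w x y lt_xy; first by rewrite -inv_pairP.
have lw := len2_adj_descent des.
have [|u [uw su]] := IH (adj i * w)%g; first by lia.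
exists (i :: u); rewrite word_perm_cons uw mulgA tperm2 mul1g; split=> //=.
lia.
Qed.

(** Minimality over all words becomes a numerical equation: [len2_word] bounds every word from below
    and removing descents one by one attains the bound. *)
Lemma reduced_exprP w u :
  reduced_expr w u <-> word_perm u = w /\ 2 * size u = len2 w.
Proof.
split=> [[uw min]|[uw su]].
  split=> //; have [v [vw sv]] := exists_word w.
  by have := min v vw; have := len2_word u; rewrite uw; lia.
by split=> // v vw; have := len2_word v; rewrite vw; lia.
Qed.

End Inversions.

(** * Heap containment as a length-additive factorization *)

(** Two linear extensions of one order give the same product: the head of [L2] is unrelated to
    everything that precedes it in [L1], so it commutes to the front. *)
Lemma prod_commutation (T : eqType) (G : finGroupType) (F : T -> G)
    (step : rel T) (L1 L2 : seq T) :
  (forall a b, a != b -> ~~ step a b -> ~~ step b a -> commute (F a) (F b)) ->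
  uniq L1 -> perm_eq L1 L2 ->
  pairwise (fun a b => ~~ step b a) L1 -> pairwise (fun a b =>
    ~~ step b a) L2 ->
  (\prod_(a <- L1) F a = \prod_(a <- L2) F a)%g.
Proof.
move=> comm; elim: L2 L1 => [|a L2 IH] L1 uL1 eL pL1.
  by move/perm_size: eL; case: L1 {uL1 pL1}.
have aL1 : a \in L1 by rewrite (perm_mem eL) mem_head.
have uL2 : uniq (a :: L2) by rewrite -(perm_uniq eL).
case/splitPr: aL1 eL uL1 pL1 => p q eL uL1 pL1 /= /andP[aL2 pL2].
have eL' : perm_eq (p ++ q) L2
  by rewrite -(perm_cons a) -(permPr eL) perm_sym (perm_catCA p [:: a] q).
rewrite big_cons -(IH (p ++ q)) //; first last.
- by apply: subseq_pairwise pL1; rewrite subseq_cat2l // subseq_cons.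
- by move: uL1; rewrite !cat_uniq /= negb_or -andbA => /and5P[-> _ -> _ ->].
rewrite !big_cat big_cons /= !mulgA; congr (_ * _)%g.
have comm_p b : b \in p -> commute (F b) (F a).
  move=> bp; have ba : b != a.
    by apply: contraTneq uL1 => <-; rewrite cat_uniq /= bp /= andbF.
  have bL2 : b \in L2 by rewrite -(perm_mem eL') mem_cat bp.
  have nab : ~~ step a b.
    by move: pL1; rewrite pairwise_cat =>
      /andP[/allrelP/(_ b a bp (mem_head _ _))].
  by apply: comm => //; apply: (allP aL2).
elim: p comm_p {uL1 eL pL1 eL'} => [|b p IHp] cp;
  first by rewrite big_nil mul1g mulg1.
rewrite big_cons -mulgA IHp; last by move=> c cin; apply: cp;
  rewrite inE cin orbT.
by rewrite !mulgA cp ?mem_head.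
Qed.

Lemma swapK i : involutive (swap i).
Proof.
move=> m; rewrite /swap; case: (m =P i) => [->|ne].
  by rewrite eqxx; case: eqP => //; lia.
by case: (m =P i.+1) => [->|ne']; rewrite ?eqxx //; do 2!case: eqP => //.
Qed.

(** Witness that the square of a product of two adjacent generators is not the identity. *)
Lemma swap_braid i : swap i.+1 (swap i (swap i.+1 (swap i i))) = i.+1.
Proof.
have -> : swap i i = i.+1 by rewrite /swap eqxx.
have -> : swap i.+1 i.+1 = i.+2 by rewrite /swap eqxx.
have -> : swap i i.+2 = i.+2 by rewrite /swap; do 2!(case: eqP; first by lia).
by rewrite /swap eqxx; case: eqP => //; lia.
Qed.

Lemma swapC i j m : i.+1 < j -> swap i (swap j m) = swap j (swap i m).
Proof.
move=> lt_ij; rewrite /swap.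
case: (m =P j) => [->|ne1].
  have -> : (j == i) = false by lia.
  have -> : (j == i.+1) = false by lia.
  have -> : (j.+1 == i) = false by lia.
  have -> : (j.+1 == i.+1) = false by lia.
  by rewrite eqxx.
case: (m =P j.+1) => [->|ne2].
  have -> : (j == i) = false by lia.
  have -> : (j == i.+1) = false by lia.
  have -> : (j.+1 == i) = false by lia.
  have -> : (j.+1 == i.+1) = false by lia.
  by rewrite eqxx; case: eqP => //; lia.
case: (m =P i) => [e3|ne3]; first by do 2!(case: eqP => //; try lia).
by case: (m =P i.+1) => [e4|ne4]; do 2!(case: eqP => //; try lia).
Qed.

Section Shift.

Variables (k n t : nat) (f : 'I_k.-1 -> 'I_n.-1).
Hypothesis fE : forall i, f i = t + i :> nat.

Lemma papp_word_shift v m : papp (word_perm (map f v)) m =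
  if t <= m then t + papp (word_perm v) (m - t) else m.
Proof.
elim: v m => [|i v IH] m /=.
  by rewrite /word_perm !big_nil !papp1; case: leqP => // /subnKC.
rewrite !word_perm_cons !pappM !papp_adj IH /swap fE.
case: (leqP t m) => le_tm.
  have -> : (m == t + i) = (m - t == i) by apply/eqP/eqP; lia.
  have -> : (m == (t + i).+1) = (m - t == i.+1) by apply/eqP/eqP; lia.
  case: eqP => [e|_].
    have -> : t <= (t + i).+1 by lia.
    by have -> : (t + i).+1 - t = i.+1 by lia.
  case: eqP => [e|_]; last by rewrite le_tm.
  by rewrite leq_addr addKn.
have -> : (m == t + i) = false by apply/eqP; lia.
have -> : (m == (t + i).+1) = false by apply/eqP; lia.
by rewrite leqNgt le_tm.
Qed.

Lemma word_shift_eq1 v : word_perm (map f v) = 1%g <-> word_perm v = 1%g.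
Proof.
split=> e; apply: papp_eq => m; rewrite papp1.
  have := papp_word_shift v (t + m); rewrite e papp1 leq_addr addKn.
  by move/addnI.
by rewrite papp_word_shift e papp1; case: leqP => // /subnKC.
Qed.

(** Letter by letter: a first letter that creates a descent still does so after translation. *)
Lemma reduced_shift v : 2 * size v = len2 (word_perm v) ->
  len2 (word_perm (map f v)) = 2 * size v.
Proof.
elim: v => [|i v IH] red.
  by have := len2_word (map f [::]); rewrite muln0 leqn0 => /eqP.
have add : additive (adj i) (word_perm v).
  apply/additiveP; rewrite -word_perm_cons -red len2_adj.
  have := len2_le (adj i) (word_perm v); rewrite -word_perm_cons -red len2_adj.
  by have := len2_word v; rewrite /=; lia.
have red' : 2 * size v = len2 (word_perm v).
  by move/additiveP: add; rewrite -word_perm_cons -red len2_adj /=; lia.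
have des : papp (word_perm (i :: v)) i.+1 < papp (word_perm (i :: v)) i.
  have := add (Ordinal (adj_ltl i)) (Ordinal (adj_ltr i)).
  by rewrite inv_pair_adj !eqxx => /(_ isT);
    rewrite inv_pairP // -!papp_ord -word_perm_cons.
rewrite /= word_perm_cons (@len2_adj_descent _ _ (f i)).
  by rewrite mulgA tperm2 mul1g IH //=; lia.
rewrite -word_perm_cons -map_cons !papp_word_shift fE.
by rewrite -addnS !leq_addr !addKn ltn_add2l.
Qed.

Lemma shift_coxeter_embedding : coxeter_embedding f.
Proof.
split.
- by move=> i j /(congr1 (@nat_of_ord _)); rewrite !fE => /addnI/val_inj.
- move=> m _ i j.
  have E l (c d : 'I_l.-1) : ((adj c * adj d) ^+ m =
    word_perm (flatten (nseq m [:: c; d])))%g.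
    elim: m => [|m IH]; first by rewrite /word_perm big_nil.
    by rewrite expgS IH /= !word_perm_cons mulgA.
  rewrite !E.
  have -> : flatten (nseq m [:: f i; f j]) = map f (flatten (nseq m [:: i; j])).
    by rewrite map_flatten map_nseq.
  by rewrite word_shift_eq1.
- by move=> i j lt_ij; rewrite !fE ltn_add2l.
Qed.

End Shift.

(** Consecutive generators cannot be sent further apart: their images would commute, and the
    condition for [m = 2] would make the originals commute. *)
Lemma coxeter_embedding_shift k n (f : 'I_k.-1 -> 'I_n.-1) :
  coxeter_embedding f -> exists t, forall i, f i = t + i :> nat.
Proof.
move=> [f_inj f_cox f_mono].
have step (i j : 'I_k.-1) : j = i.+1 :> nat -> f j = (f i).+1 :> nat.
  move=> eij; have lt_f : f i < f j by apply: f_mono; rewrite eij.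
  apply/eqP; rewrite eqn_leq lt_f andbT leqNgt; apply/negP => far.
  have /(f_cox 2 isT) : ((adj (f i) * adj (f j)) ^+ 2 = 1)%g.
    apply: papp_eq => m; rewrite expgS expg1 !pappM !papp_adj papp1.
    by rewrite [swap (f i) (swap (f j) _)]swapC // !swapK.
  move=> /(congr1 (fun w => papp w i));
    rewrite expgS expg1 !pappM !papp_adj papp1 eij.
  by rewrite swap_braid; lia.
case: (posnP k.-1) => [k0|k_gt0].
  by exists 0 => i; have := ltn_ord i; rewrite [X in _ < X]k0.
exists (f (Ordinal k_gt0)) => i; case: i => i; elim: i => [|i IH] lt_i.
  by rewrite addn0; congr (nat_of_ord (f _)); apply: val_inj.
by rewrite (step (Ordinal (ltnW lt_i))) // IH addnS.
Qed.

Lemma map_label_enum n (u : seq 'I_n.-1) :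
  [seq heap_label a | a <- enum 'I_(size u)] = u.
Proof. exact: (map_tnth_enum (in_tuple u)). Qed.

Lemma word_perm_label n (u : seq 'I_n.-1) :
  word_perm u = (\prod_(a <- enum 'I_(size u)) adj (heap_label a))%g.
Proof. by rewrite -(big_map (@heap_label n u) xpredT (@adj n)) map_label_enum.
  Qed.

Lemma heap_le_leq n (u : seq 'I_n.-1) (a b : 'I_(size u)) :
  heap_le a b -> a <= b.
Proof.
move=> /connectP[p pth ->]; elim: p a pth =>
  //= c p IH a /andP[/andP[lt_ac _] pth].
exact: leq_trans (ltnW lt_ac) (IH _ pth).
Qed.

(** The entries of [u] are listed anew: first those outside the image [C] lying below some element
    of [C], then [C] in the order of [fv], then the rest. Convexity makes this a linear extension of
    the heap, so the product is unchanged. *)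
Lemma convex_factor n (u fv : seq 'I_n.-1) :
  convex_labeled_subposet fv u ->
  exists x y, word_perm u = word_perm (x ++ fv ++ y) /\
              size u = size (x ++ fv ++ y).
Proof.
move=> [phi [phi_inj phi_lab phi_le phi_conv]].
have [E EE] : exists E, E = enum 'I_(size u) by exists (enum 'I_(size u)).
pose C := [seq phi a | a <- enum 'I_(size fv)].
pose D := [pred y | (y \notin C) && [exists c, heap_lt y (phi c)]].
pose L2 := [seq y <- E | D y] ++ C ++ [seq y <- E | (y \notin C) && ~~ D y].
have uC : uniq C by rewrite map_inj_uniq ?enum_uniq.
have uE : uniq E by rewrite EE enum_uniq.
have EM y : y \in E by rewrite EE mem_enum.
have eL : perm_eq E L2.
  apply: uniq_perm => //.
    rewrite /L2 !cat_uniq uC !(filter_uniq _ uE) /= ?andbT.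
    apply/andP; split; apply/hasPn => y.
    + rewrite mem_cat !mem_filter => /orP[yC|/andP[/andP[_ nD] _]].
        by apply/negP => /andP[/andP[]]; rewrite yC.
      by apply/negP => /andP[Dy]; rewrite Dy in nD.
    + by rewrite mem_filter => /andP[/andP[]].
  by move=> y; rewrite EM !mem_cat !mem_filter !EM /=; case: (y \in C);
    case: [exists _, _].
have EC y : y \in C -> exists c, y = phi c by case/mapP => c _ ->; exists c.
have step_lt (a b : 'I_(size u)) : heap_step a b -> heap_lt a b.
  move=> s; rewrite /heap_lt /heap_le connect1 // andbT.
  by case/andP: s => + _; apply: contraTneq => ->; rewrite ltnn.
have lt_trans (a b c : 'I_(size u)) : heap_lt a b -> heap_lt b c -> heap_lt a c.
  move=> /andP[ab lab] /andP[bc lbc];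
    rewrite /heap_lt /heap_le (connect_trans lab lbc) andbT.
  apply: contra ab => /eqP eac; rewrite -eac in lbc.
  by apply/eqP/val_inj/eqP; rewrite eqn_leq !heap_le_leq.
have pE : pairwise (fun a b : 'I_(size u) => ~~ heap_step b a) E.
  rewrite EE; suff: pairwise (fun a b : 'I_(size u) =>
    a < b) (enum 'I_(size u)).
    apply: sub_pairwise => a b lt_ab; rewrite /heap_step.
    by rewrite ltnNge (ltnW lt_ab).
  rewrite -(pairwise_map val (fun a b => a < b)) val_enum_ord.
  by rewrite -sorted_pairwise ?iota_ltn_sorted //; apply: ltn_trans.
have pC : pairwise (fun a b : 'I_(size u) => ~~ heap_step b a) C.
  rewrite /C pairwise_map.
  have : pairwise (fun a b : 'I_(size fv) => a < b) (enum 'I_(size fv)).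
    rewrite -(pairwise_map val (fun a b => a < b)) val_enum_ord.
    by rewrite -sorted_pairwise ?iota_ltn_sorted //; apply: ltn_trans.
  apply: sub_pairwise => a b lt_ab; apply/negP => s.
  have : heap_le (phi b) (phi a) by apply: connect1.
  by rewrite phi_le => /heap_le_leq; rewrite leqNgt lt_ab.
have pL2 : pairwise (fun a b : 'I_(size u) => ~~ heap_step b a) L2.
  rewrite /L2 !pairwise_cat pC !(subseq_pairwise (filter_subseq _ _) pE) !andbT.
  apply/andP; split; [|apply/andP; split=> //]; apply/allrelP => a b.
  + rewrite mem_filter mem_cat => /andP[/andP[aC /existsP[c lt_ac]] _] bL.
    apply/negP => /step_lt lt_ba.
    case/orP: bL => [/EC[b' eb]|].
      rewrite eb in lt_ba; have [a' ea] := phi_conv _ _ _ lt_ba lt_ac.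
      by rewrite ea map_f ?mem_enum in aC.
    rewrite mem_filter /= => /andP[/andP[bC]]; rewrite bC /=.
    by move=> /negP H _; apply: H; apply/existsP; exists c;
      apply: lt_trans lt_ac.
  + move=> /EC[a' ->]; rewrite mem_filter => /andP[/andP[bC nD] _].
    apply/negP => /step_lt lt_ba; move: nD; rewrite /= bC /= => /negP; apply.
    by apply/existsP; exists a'.
exists [seq heap_label a | a <- E & D a],
  [seq heap_label a | a <- E & (a \notin C) && ~~ D a].
have fvE : fv = map (@heap_label n u) C.
  rewrite /C -map_comp -[LHS](map_label_enum fv); apply: eq_map => a /=.
  by rewrite phi_lab.
have -> : [seq heap_label a | a <- E & D a] ++ fv ++
   [seq heap_label a | a <- E & (a \notin C) && ~~ D a] =
     map (@heap_label n u) L2.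
  by rewrite /L2 !map_cat -fvE.
split; last by rewrite size_map -(perm_size eL) EE size_enum_ord.
rewrite word_perm_label -EE /word_perm big_map.
apply: (@prod_commutation _ _ _ (@heap_step n u)) => //.
move=> a b ab; rewrite /heap_step; case: (ltngtP a b) => [||/val_inj eab];
  last by rewrite eab eqxx in ab.
  by rewrite /= negbK => _ /eqP.
by rewrite /= negbK => _ _ /eqP.
Qed.

(** The heap order refines the order of positions, so a chain between two entries of a contiguous
    factor never leaves it. *)
Lemma factor_convex n (x fv y : seq 'I_n.-1) :
  convex_labeled_subposet fv (x ++ fv ++ y).
Proof.
set u := x ++ fv ++ y.
have lt_phi (a : 'I_(size fv)) : size x + a < size u.
  by rewrite /u !size_cat ltn_add2l ltn_addr.
pose phi a := Ordinal (lt_phi a).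
have labE a : heap_label (phi a) = heap_label a.
  have x0 : 'I_n.-1 := heap_label a.
  rewrite /heap_label !(tnth_nth x0) /= /u nth_cat ltnNge leq_addr /= addKn.
  by rewrite nth_cat ltn_ord.
have stepE a b : heap_step (phi a) (phi b) = heap_step a b.
  by rewrite /heap_step !labE /= ltn_add2l.
have mid (z : 'I_(size u)) (a b : 'I_(size fv)) : phi a <= z -> z <= phi b ->
  exists c, z = phi c.
  move=> /= le1 le2; have lt_z : z - size x < size fv by have := ltn_ord b; lia.
  exists (Ordinal lt_z); apply: val_inj => /=; lia.
exists phi; split=> //.
- by move=> a b /(congr1 val) /= /addnI/val_inj.
- move=> a b; apply/idP/idP => /connectP[p].
    elim: p a => [|c p IH] a /=.
      by move=> _ /(congr1 val) /= /addnI/val_inj ->; apply: connect0.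
    move=> /andP[s pth] eb; have le_c : heap_le c (phi b) by apply/connectP;
      exists p.
    have [||c' ec] := @mid c a b.
    + by case/andP: s => /ltnW.
    + exact: heap_le_leq.
    rewrite ec in s pth eb *; rewrite stepE in s.
    exact: connect_trans (connect1 s) (IH _ pth eb).
  elim: p a => [|c p IH] a /=; first by move=> _ ->; apply: connect0.
  move=> /andP[s pth] eb.
  by apply: connect_trans (IH _ pth eb); apply: connect1; rewrite stepE.
- move=> a c z /andP[_ /heap_le_leq le1] /andP[_ /heap_le_leq le2].
  exact: mid le1 le2.
Qed.

(** A reduced word split in three attains the subadditive bound for the whole product, hence for
    each partial product; conversely reduced words of the factors concatenate to a reduced word. *)
Lemma heap_containsP n k (w : 'S_n) (h : 'S_k) : 1 < k ->
  heap_contains w h <-> exists t (a g b : 'S_n),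
    [/\ t + k <= n,
        forall m, papp g m = if t <= m then t + papp h (m - t) else m,
        w = (a * g * b)%g & additive a g /\ additive (a * g)%g b].
Proof.
move=> k_gt1; split.
  move=> [u [v [f [/reduced_exprP[uw su] /reduced_exprP[vh sv] cox conv]]]].
  have [t tE] := coxeter_embedding_shift cox.
  have [x [y [eu sz]]] := convex_factor conv.
  (* The image of the last generator of [h] yields [t + k <= n]. *)
  have lt_k : k.-2 < k.-1 by lia.
  exists t, (word_perm x), (word_perm (map f v)), (word_perm y); split.
  - have := ltn_ord (f (Ordinal lt_k)); rewrite tE /=; lia.
  - by move=> m; rewrite (papp_word_shift tE) vh.
  - by rewrite -uw eu !word_perm_cat mulgA.
  have := len2_le (word_perm x) (word_perm (map f v)).
  have := len2_le (word_perm x * word_perm (map f v))%g (word_perm y).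
  have := len2_word x; have := len2_word y; have := len2_word (map f v).
  have -> : len2 (word_perm x * word_perm (map f v) * word_perm y)%g =
    2 * size u.
    by rewrite su -uw eu !word_perm_cat mulgA.
  rewrite sz !size_cat => *; split; apply/additiveP; first by lia.
  have -> : len2 (word_perm x * word_perm (map f v) * word_perm y)%g =
    2 * size u.
    by rewrite su -uw eu !word_perm_cat mulgA.
  rewrite sz !size_cat; lia.
move=> [t [a [g [b [le_tk gE wE [add1 add2]]]]]].
have lt_f (i : 'I_k.-1) : t + i < n.-1 by have := ltn_ord i; lia.
pose f i := Ordinal (lt_f i); have tE i : f i = t + i :> nat by [].
have [v [vh sv]] := exists_word h.
have [x [xa sx]] := exists_word a; have [y [yb sy]] := exists_word b.
have gv : word_perm (map f v) = g.
  by apply: papp_eq => m; rewrite (papp_word_shift tE) gE vh.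
exists (x ++ map f v ++ y), v, f; split.
- apply/reduced_exprP; rewrite !word_perm_cat xa gv yb mulgA wE; split=> //.
  move/additiveP: add1 => add1; move/additiveP: add2 => ->; rewrite add1.
  have := @reduced_shift _ _ _ _ tE v; rewrite vh gv => /(_ sv) ->.
  by rewrite !size_cat size_map -sx -sy; lia.
- by apply/reduced_exprP; rewrite vh.
- exact: shift_coxeter_embedding tE.
exact: factor_convex.
Qed.

(** * Heaps of fully commutative permutations *)

Section Displacement.

Variable n : nat.
Implicit Types (w a b : 'S_n) (x y z : 'I_n) (i : 'I_n.-1) (u v : seq 'I_n.-1).

Definition nw w x := [set y : 'I_n | (y < x) && (w x < w y)].
Definition se w x := [set y : 'I_n | (x < y) && (w y < w x)].

(** The positions left of [x] and those with value below [w x] have a common part; [nw] and [se] are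
    the two differences. *)
Lemma displacement w x : w x + #|nw w x| = x + #|se w x|.
Proof.
have E1 : #|[set y : 'I_n | y < x]| = x := card_ord_lt (ltnW (ltn_ord x)).
have E2 : #|[set y : 'I_n | w y < w x]| = w x.
  rewrite -[RHS](card_ord_lt (ltnW (ltn_ord (w x)))).
  rewrite -[in RHS](card_preimset _ (@perm_inj _ w)).
  by apply: eq_card => y; rewrite !inE.
rewrite -{1}E1 -{1}E2.
rewrite -(cardsID [set y : 'I_n | y < x] [set y | w y < w x]).
rewrite -(cardsID [set y : 'I_n | w y < w x] [set y : 'I_n | y < x]) setIC.
have -> : [set y : 'I_n | w y < w x] :\: [set y : 'I_n | y < x] = se w x.
  apply/setP => y; rewrite !inE -leqNgt leq_eqVlt.
  by case: eqP => // /val_inj ->; rewrite !ltnn.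
have -> : [set y : 'I_n | y < x] :\: [set y : 'I_n | w y < w x] = nw w x.
  apply/setP => y; rewrite !inE -leqNgt leq_eqVlt andbC.
  by case: eqP => // /val_inj/perm_inj ->; rewrite !ltnn.
by rewrite addnAC.
Qed.

Definition has321 w := exists x y z, [/\ x < y, y < z, w y < w x & w z < w y].

(** If [a] had already inverted the two strands, [b] would undo that inversion. *)
Lemma additive_inversion a b x y : additive a b -> x < y -> b y < b x ->
  a^-1%g x < a^-1%g y.
Proof.
move=> ab lt_xy lt_b; have := ab (a^-1%g x) (a^-1%g y).
rewrite inv_pairM !permKV (inv_pairP _ lt_xy) lt_b addbT.
by rewrite /inv_pair !permKV lt_xy addbT; case: (_ < _) => // /(_ isT).
Qed.

Lemma additive_has321 a b : additive a b -> has321 b -> has321 (a * b)%g.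
Proof.
move=> ab [x [y [z [xy yz bxy byz]]]].
exists (a^-1 x)%g, (a^-1 y)%g, (a^-1 z)%g; rewrite !permM !permKV.
by split=> //; apply: additive_inversion ab _ _.
Qed.

Lemma no321_nw w x y : ~ has321 w -> x < y -> w y < w x -> nw w x = set0.
Proof.
move=> no321 xy wxy; apply/setP => z; rewrite !inE; apply/negP => /andP[zx wzx].
by apply: no321; exists z, x, y.
Qed.

Lemma no321_se w x y : ~ has321 w -> x < y -> w y < w x -> se w y = set0.
Proof.
move=> no321 xy wxy; apply/setP => z; rewrite !inE; apply/negP => /andP[zx wzx].
by apply: no321; exists x, y, z.
Qed.

Lemma no321_exceedance w x y : ~ has321 w -> x < y -> w y < w x -> x < w x.
Proof.
move=> no321 xy wxy; have := displacement w x.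
rewrite (no321_nw no321 xy wxy) cards0 addn0 => ->.
by rewrite -addn1 leq_add2l; apply/card_gt0P; exists y; rewrite inE xy.
Qed.

Lemma no321_deficiency w x y : ~ has321 w -> x < y -> w y < w x -> w y < y.
Proof.
move=> no321 xy wxy; have := displacement w y.
rewrite (no321_se no321 xy wxy) cards0 addn0 => <-.
by rewrite -addn1 leq_add2l; apply/card_gt0P; exists x; rewrite inE xy.
Qed.

Lemma reduced_cons i u : 2 * size (i :: u) = len2 (word_perm (i :: u)) ->
  additive (adj i) (word_perm u) /\ 2 * size u = len2 (word_perm u).
Proof.
have := len2_le (adj i) (word_perm u); rewrite word_perm_cons len2_adj /=.
have := len2_word u => le1 le2 red; split; last by lia.
by apply/additiveP; rewrite len2_adj; lia.
Qed.

Lemma additive_adj_descent i w : additive (adj i) w ->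
  (adj i * w)%g (Ordinal (adj_ltr i)) < (adj i * w)%g (Ordinal (adj_ltl i)).
Proof.
move=> add; rewrite -inv_pairP //=; apply: add.
by rewrite inv_pair_adj !eqxx.
Qed.

Definition crossing (c : nat) w := #|[set x : 'I_n | (x <= c) && (c < w x)]|.

(** Induction on the word. A first letter other than [c] does not affect the cut at [c]. A first
    letter [c] is a descent, whose left end exceeds the cut and whose right end falls below it
    because there is no 321, so exactly one crossing goes away with it. *)
Lemma count_crossing u (c : 'I_n.-1) : 2 * size u = len2 (word_perm u) ->
  ~ has321 (word_perm u) -> count_mem c u = crossing c (word_perm u).
Proof.
elim: u => [|i u IH] red no321.
  apply/esym/eqP; rewrite /= cards_eq0; apply/eqP/setP => x; rewrite !inE.
  by rewrite /word_perm big_nil perm1; lia.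
have [add red'] := reduced_cons red.
rewrite /= {}IH //; last by move=> /(additive_has321 add);
  rewrite -word_perm_cons.
have := additive_adj_descent add; rewrite -word_perm_cons.
set w := word_perm (i :: u) in no321 *; set w' := word_perm u in add *.
set lo := Ordinal (adj_ltl i); set hi := Ordinal (adj_ltr i) => des.
have wE x : w x = w' (adj i x) by rewrite /w word_perm_cons permM.
have lt_lohi : lo < hi by [].
have [eic|ne_ic] := eqVneq i c; last first.
  rewrite add0n /crossing -(card_preimset _ (@perm_inj _ (adj i))).
  apply: eq_card => x; rewrite !inE -wE -!papp_ord papp_adj /swap; congr (_ &&
    _).
  rewrite -val_eqE /= in ne_ic; case: eqP => [->|_]; first by lia.
  by case: eqP => [->|_]; lia.
have wlo : i < w lo := no321_exceedance no321 lt_lohi des.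
have whi : w hi <= i := no321_deficiency no321 lt_lohi des.
rewrite -eic /crossing [RHS](cardsD1 lo) inE leqnn wlo /=; congr (_ + _).
apply: eq_card => x; rewrite !inE.
have w'lo : w' lo = w hi by rewrite wE /adj tpermR.
have [->|nx] := eqVneq x lo; first by rewrite w'lo leqnn /= ltnNge whi.
rewrite wE /= /adj; case: tpermP => [exl|exh|//];
  first by rewrite exl eqxx in nx.
by rewrite exh /= ltnn.
Qed.

End Displacement.

Lemma comm_equiv_perm_eq n (u v : seq 'I_n.-1) : comm_equiv u v -> perm_eq u v.
Proof.
elim=> {u v} [u v [x [y [i [j [_ -> ->]]]]]|u|u v z _ IH1 _ IH2].
- by rewrite perm_cat2l perm_cat2r; apply/seq.permP => P /=; rewrite addnCA.
- exact: perm_refl.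
- exact: perm_trans IH1 IH2.
Qed.

(* Removing a descent keeps some 321 unless the descents that can be removed are
   those of a 321 in consecutive positions, where a braid relation applies. *)
Lemma has321_two_words n (w : 'S_n) : has321 w -> exists u v,
  [/\ reduced_expr w u, reduced_expr w v & ~~ perm_eq u v].
Proof.
move: {2}(len2 w) (leqnn (len2 w)) => l; elim: l w => [|l IH] w le_l.
  move: le_l; rewrite leqn0 => /eqP/len2_eq0 -> [x [y [z [xy _]]]].
  by rewrite !perm1 => /ltn_trans/(_ xy); rewrite ltnn.
move=> [x [y [z [xy yz wxy wyz]]]].
have [i [xi iy des]] := exists_descent xy wxy.
have [j [yj jz des']] := exists_descent yz wyz.
have push (m : 'I_n.-1) : papp w m.+1 < papp w m -> has321 (adj m * w)%g ->
    exists u v, [/\ reduced_expr w u, reduced_expr w v & ~~ perm_eq u v].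
  move=> desm h; have lw := len2_adj_descent desm.
  have [|u [v [/reduced_exprP[uw su] /reduced_exprP[vw sv] ne]]] := IH _ _ h;
    first by lia.
  exists (m :: u), (m :: v); rewrite perm_cons ne.
  split=> //; apply/reduced_exprP;
    rewrite word_perm_cons ?uw ?vw mulgA tperm2 mul1g;
    by split=> //=; lia.
have keep (m : 'I_n.-1) (p q : 'I_n) : p < q -> ~~ ((p == m :> nat) &&
  (q == m.+1 :> nat)) ->
    adj m p < adj m q.
  move=> lt_pq; have := inv_pair_adj m p q; rewrite /inv_pair lt_pq.
  by case: (_ && _) => //=; case: (adj m p < adj m q) => //; lia.
have surv (m : 'I_n.-1) : ~~ ((x == m :> nat) && (y == m.+1 :> nat)) ->
    ~~ ((y == m :> nat) && (z == m.+1 :> nat)) -> has321 (adj m * w)%g.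
  move=> n1 n2; exists (adj m x), (adj m y), (adj m z).
  by rewrite !permM !tpermK !keep.
have [/andP[/eqP xi' /eqP yi]|ni] := boolP ((x == i :> nat) &&
  (y == i.+1 :> nat)); last first.
  by apply: (push i des); apply: surv => //; lia.
have [/andP[/eqP yj' /eqP zj]|nj] := boolP ((y == j :> nat) &&
  (z == j.+1 :> nat)); last first.
  by apply: (push j des'); apply: surv => //; lia.
(* What remains is a 321 in the consecutive positions [i], [i.+1], [i.+2]. *)
have eji : j = i.+1 :> nat by rewrite -yj' yi.
have sw1 : swap i i = i.+1 by rewrite /swap eqxx.
have sw2 : swap i i.+1 = i by rewrite /swap eqxx; case: eqP => //; lia.
have sw3 : swap i i.+2 = i.+2 by rewrite /swap; do 2!(case: eqP; first by lia).
have sw4 : swap j i = i by rewrite eji /swap; do 2!(case: eqP; first by lia).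
have sw5 : swap j i.+1 = i.+2 by rewrite eji /swap eqxx.
have sw6 : swap j i.+2 = i.+1 by rewrite eji /swap eqxx; case: eqP => //; lia.
have pwx : papp w i = w x by rewrite -xi' papp_ord.
have pwy : papp w i.+1 = w y by rewrite -yi papp_ord.
have pwz : papp w i.+2 = w z by rewrite -eji -zj papp_ord.
have l1 := len2_adj_descent des.
have l2 : len2 (adj i * w)%g = 2 + len2 (adj j * (adj i * w))%g.
  apply: len2_adj_descent; rewrite !pappM !papp_adj eji sw2 sw3 pwx pwz.
  exact: ltn_trans wyz wxy.
have l3 : len2 (adj j * (adj i * w))%g = 2 +
  len2 (adj i * (adj j * (adj i * w)))%g.
  by apply: len2_adj_descent; rewrite !pappM !papp_adj sw4 sw5 sw3 sw1 pwy pwz.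
have [v [vw sv]] := exists_word (adj i * (adj j * (adj i * w)))%g.
have braid : (adj i * adj j * adj i = adj j * adj i * adj j)%g.
  apply: papp_eq => m; rewrite !pappM !papp_adj.
  have [->|n1] := eqVneq m i; first by rewrite sw1 sw5 sw3 sw4 sw1 sw5.
  have [->|n2] := eqVneq m i.+1; first by rewrite sw2 sw4 sw1 sw5 sw3 sw6.
  have [->|n3] := eqVneq m i.+2; first by rewrite sw3 sw6 sw2 sw4.
  have e1 : swap i m = m by rewrite /swap (negbTE n1) (negbTE n2).
  have e2 : swap j m = m by rewrite /swap eji (negbTE n2) (negbTE n3).
  by rewrite e1 e2 e1 e2.
have adjK (m : 'I_n.-1) (g : 'S_n) : (adj m * (adj m * g))%g = g.
  by rewrite mulgA tperm2 mul1g.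
(* The two sides of the braid relation: [i] occurs once more in the first word, so the contents
   differ. *)
exists [:: i, j, i & v], [:: j, i, j & v]; split.
- apply/reduced_exprP; rewrite !word_perm_cons vw !adjK; split=> //=; lia.
- apply/reduced_exprP; rewrite !word_perm_cons vw !mulgA -braid.
  by rewrite -!mulgA !adjK; split=> //=; lia.
apply/negP => /seq.permP/(_ (pred1 i)) /=; rewrite eqxx -!val_eqE /= eji; lia.
Qed.

(** Commutation moves preserve the content of a word, while a 321 provides two reduced words with
    different contents. *)
Lemma fully_commutative_no321 n (w : 'S_n) : fully_commutative w -> ~ has321 w.
Proof.
move=> [u0 _ comm] /has321_two_words[u [v [/comm cu /comm cv]]] /negP; apply.
by apply: perm_trans (comm_equiv_perm_eq cv);
  rewrite perm_sym comm_equiv_perm_eq.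
Qed.

Lemma column_size_count n (u : seq 'I_n.-1) c : column_size u c = count_mem c u.
Proof.
rewrite -[in RHS](map_label_enum u) count_map /column_size cardsE cardE.
rewrite {1}/enum_mem -enumT size_filter.
by apply: eq_count => a.
Qed.

Lemma heap_shape n (h : 'S_n) :
  connected_perm h -> fully_commutative h -> two_in_internal_columns h ->
  exists i j : 'I_n.-1, [/\ i <= j,
    forall c : 'I_n.-1, (0 < crossing c h) = (i <= c <= j)
    & forall c : 'I_n.-1, i < c < j -> 1 < crossing c h].
Proof.
move=> [i [j ij]] fc two; exists i, j.
have no321 := fully_commutative_no321 fc.
have cnt u c : reduced_expr h u -> count_mem c u = crossing c h.
  by move=> /reduced_exprP[uh red]; rewrite -uh (count_crossing c) uh.
have [u [uh su]] := exists_word h;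
  have ru : reduced_expr h u by apply/reduced_exprP.
have [le_ij supp] := ij; split=> // c.
  apply/idP/idP => [|/supp[v rv]];
    last by rewrite -(cnt v) // -has_count has_pred1.
  by rewrite -(cnt u) // -has_count has_pred1 => cu; apply/supp; exists u.
by move=> /(two i j ij u ru); rewrite column_size_count cnt.
Qed.

(** * Permutations as words *)

Section Counting.

Implicit Types (P Q : pred nat) (g k r : nat).

Definition cnt P g := count P (iota 0 g).

Lemma cntS P g : cnt P g.+1 = cnt P g + P g.
Proof. by rewrite /cnt -addn1 iotaD count_cat /= addn0. Qed.

Lemma cnt_le P g k : g <= k -> cnt P g <= cnt P k.
Proof. by move=> /subnKC <-; rewrite /cnt iotaD count_cat leq_addr. Qed.

Lemma cnt_rank_lt P g k : P g -> g < k -> cnt P g < cnt P k.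
Proof. by move=> Pg /(cnt_le P); rewrite cntS Pg addn1. Qed.

Lemma cnt_rank_inj P g k : P g -> P k -> cnt P g = cnt P k -> g = k.
Proof.
move=> Pg Pk e; have [lt_gk|lt_kg|//] := ltngtP g k.
  by have := cnt_rank_lt Pg lt_gk; rewrite e ltnn.
by have := cnt_rank_lt Pk lt_kg; rewrite e ltnn.
Qed.

Lemma cnt_rank_exists P r g : r < cnt P g -> exists k, [/\ k < g,
  P k & cnt P k = r].
Proof.
elim: g => // g IH; rewrite cntS.
have [lt_r _|le_r] := ltnP r (cnt P g).
  by have [k [lt_kg Pk ck]] := IH lt_r; exists k; rewrite ltnS ltnW.
case: (boolP (P g)) => Pg /=; last by rewrite addn0 ltnNge le_r.
by move=> lt_r; exists g; split=> //; lia.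
Qed.

Lemma cnt_card n P g : g <= n -> cnt P g = #|[set x : 'I_n | P x && (x < g)]|.
Proof.
move=> le_gn; rewrite /cnt -[LHS]sum1_count big_mkcond /=.
have -> : iota 0 g = index_iota 0 g by rewrite /index_iota subn0.
rewrite big_mkord -(big_ord_narrow_cond (P := xpredT) (F := fun x : 'I_n =>
  if P x then 1 else 0) le_gn) /=.
rewrite -sum1dep_card big_mkcond [RHS]big_mkcond; apply: eq_bigr => x _.
by case: (P x); case: (x < g).
Qed.

Lemma cnt_map (w : nat -> nat) P Q g k : injective w ->
  (forall x, x < g -> P x -> w x < k /\ Q (w x)) -> cnt P g <= cnt Q k.
Proof.
move=> w_inj wPQ; rewrite /cnt -!size_filter -(size_map w);
  apply: uniq_leq_size.
  by rewrite map_inj_uniq // filter_uniq // iota_uniq.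
move=> y /mapP[x]; rewrite !mem_filter !mem_iota /= => /andP[Px lt_xg] ->.
by have [lt_wx Qw] := wPQ x lt_xg Px; rewrite Qw lt_wx.
Qed.

End Counting.

Definition label : Type := option bool.

HB.instance Definition _ := Finite.on label.

Notation lR := (Some true : label).
Notation lL := (Some false : label).
Notation lM := (None : label).

Lemma cnt_label (s : nat -> label) g :
  cnt (fun k => s k == lR) g + cnt (fun k => s k == lL) g
    + cnt (fun k => s k == lM) g = g.
Proof. by elim: g => // g; rewrite !cntS; case: (s g) => [[]|] /=; lia. Qed.

Section Realization.

Variable n : nat.
Implicit Types (w : 'S_n) (s v : nat -> label).

(** Here [s] labels positions and [v] labels values; [w] matches them increasingly within each
    label, so it is determined by the two labelings through ranks. *)
Definition realizes w s v :=
  (forall k, k < n -> v (papp w k) = s k) /\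
  (forall j k, j < k -> k < n -> s j = s k -> papp w j < papp w k).

Lemma realizes_mono w s v j k : realizes w s v -> j < n -> k < n ->
  s j = s k -> (papp w j < papp w k) = (j < k).
Proof.
move=> [_ mono] lt_jn lt_kn sjk.
have [lt_jk|lt_kj|->] := ltngtP j k; rewrite ?ltnn //; first exact: mono.
by apply/negbTE; rewrite -leqNgt ltnW // mono.
Qed.

Lemma realizes_rank w s v k : realizes w s v -> k < n ->
  cnt (fun j => v j == s k) (papp w k) = cnt (fun j => s j == s k) k.
Proof.
move=> wsv lt_kn; have [wv _] := wsv; apply/eqP; rewrite eqn_leq; apply/andP;
  split.
  apply: (cnt_map (@papp_inj _ w^-1%g)) => y lt_y /eqP vy.
  have lt_y' : papp w^-1 y < n.
    by rewrite papp_lt; apply: ltn_trans lt_y _; rewrite papp_lt.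
  have sy : s (papp w^-1 y) = s k by rewrite -wv // pappKV.
  by rewrite sy eqxx -(realizes_mono wsv) // pappKV.
apply: (cnt_map (@papp_inj _ w)) => y lt_y /eqP sy.
have lt_yn := ltn_trans lt_y lt_kn.
by rewrite wv // sy eqxx (realizes_mono wsv).
Qed.

Lemma realizes_uniq w w' s v : realizes w s v -> realizes w' s v -> w = w'.
Proof.
move=> wsv wsv'; apply: papp_eq => k.
have [le_nk|lt_kn] := leqP n k; first by rewrite !papp_out.
apply: (@cnt_rank_inj (fun j => v j == s k)); first by rewrite wsv.1.
  by rewrite wsv'.1.
by rewrite (realizes_rank wsv) // (realizes_rank wsv').
Qed.

Lemma realizes_exists s v :
  (forall l, cnt (fun k => s k == l) n = cnt (fun k => v k == l) n) ->
  exists w, realizes w s v.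
Proof.
move=> sv.
have ex (k : 'I_n) : exists y : 'I_n, v y = s k /\
    cnt (fun j => v j == s k) y = cnt (fun j => s j == s k) k.
  have : cnt (fun j => s j == s k) k < cnt (fun j => v j == s k) n.
    by rewrite -sv; apply: cnt_rank_lt.
  by move=> /cnt_rank_exists[y [lt_yn /eqP vy cy]]; exists (Ordinal lt_yn).
have /fin_all_exists[f fP] := ex.
have f_inj : injective f.
  move=> j k e; have [vj cj] := fP j; have [vk ck] := fP k.
  have sjk : s j = s k by rewrite -vj e.
  apply: val_inj; apply: (@cnt_rank_inj (fun i => s i == s k));
    rewrite ?sjk //=.
  by move: cj; rewrite sjk => <-; rewrite e ck.
exists (perm f_inj); split=> [k lt_kn|j k lt_jk lt_kn sjk].
  by have := papp_ord (perm f_inj) (Ordinal lt_kn); rewrite permE /= => ->;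
    case: (fP (Ordinal lt_kn)).
have lt_jn := ltn_trans lt_jk lt_kn.
have := papp_ord (perm f_inj) (Ordinal lt_kn); rewrite permE /= => ->.
have := papp_ord (perm f_inj) (Ordinal lt_jn); rewrite permE /= => ->.
have [vj cj] := fP (Ordinal lt_jn); have [vk ck] := fP (Ordinal lt_kn).
rewrite ltnNge; apply/negP; rewrite leq_eqVlt =>
  /predU1P[/val_inj/f_inj/(congr1 val)/= e|lt_f].
  by rewrite e ltnn in lt_jk.
have := @cnt_rank_lt (fun i => v i == s k) _ _ _ lt_f; rewrite /= vk eqxx =>
  /(_ isT).
rewrite ck /=; move: cj; rewrite /= sjk => ->.
have := @cnt_rank_lt (fun i => s i == s k) _ _ _ lt_jk; rewrite sjk eqxx =>
  /(_ isT).
by move=> /ltn_trans h /h; rewrite ltnn.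
Qed.

End Realization.

(** * Labels of positions and values, and which labelings occur *)

Section Labels.

Variable n : nat.
Implicit Types (w : 'S_n) (x y z : 'I_n) (s v : nat -> label).

(* [lR]: moved to the right.  [lM]: fixed, and the middle of a 321.
   [lL]: moved to the left, or fixed without being inverted with anything. *)
Definition lab w (k : nat) : label :=
  if (insub k : option 'I_n) is Some x then
    if x < w x then lR else if (w x == x) && (nw w x != set0) then lM else lL
  else lL.

Definition vlab w (k : nat) : label := lab w (papp w^-1 k).

(** The avoidance of 3421, 4312 and 4321 in a form suited to counting; see [clustered_patterns]. *)
Definition clustered w := forall x, nw w x != set0 -> se w x != set0 ->
  #|nw w x| = 1 /\ #|se w x| = 1.

Lemma lab_ord w x : lab w x =
  if x < w x then lR else if (w x == x) && (nw w x != set0) then lM else lL.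
Proof. by rewrite /lab valK. Qed.

Lemma vlab_papp w k : vlab w (papp w k) = lab w k.
Proof. by rewrite /vlab pappK. Qed.

Lemma labR w x : (lab w x == lR) = (x < w x).
Proof. by rewrite lab_ord; case: ifP => // _; case: ifP. Qed.

Lemma labM w x : (lab w x == lM) = (w x == x) && (nw w x != set0).
Proof.
rewrite lab_ord; case: ifP => [lt_x|_]; last by case: ifP.
by rewrite -val_eqE /= gtn_eqF.
Qed.

Lemma inv_nw w x y : x < y -> w y < w x -> x \in nw w y.
Proof. by move=> xy wxy; rewrite inE xy. Qed.

Lemma inv_se w x y : x < y -> w y < w x -> y \in se w x.
Proof. by move=> xy wxy; rewrite inE xy. Qed.

Lemma mem_neq0 (A : {set 'I_n}) x : x \in A -> A != set0.
Proof. by move=> xA; apply/set0Pn; exists x. Qed.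

(** Suppose the pair is inverted. If both move right, [displacement] gives [y] at least two smaller
    entries on its right besides the larger one on its left. Otherwise it makes [x] a fixed middle,
    so [y] is fixed too, and two fixed points are not inverted. *)
Lemma clustered_mono w x y : clustered w -> x < y -> lab w x = lab w y ->
  w x < w y.
Proof.
move=> cl xy exy; rewrite ltnNge leq_eqVlt; apply/negP =>
  /predU1P[/val_inj/perm_inj e|inv].
  by rewrite e ltnn in xy.
have nwy := mem_neq0 (inv_nw xy inv); have sex := mem_neq0 (inv_se xy inv).
have [Rx|nRx] := boolP (lab w x == lR).
  have lt_y : y < w y by rewrite -labR -exy.
  have := displacement w y; have := card_gt0 (nw w y); rewrite nwy => nw1 d.
  have [|_ se1] := cl y nwy; first by rewrite -card_gt0; lia.
  by rewrite se1 in d; lia.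
have Lx : w x <= x by rewrite leqNgt -labR.
have := displacement w x; have := card_gt0 (se w x); rewrite sex => se1 d.
have nwx : nw w x != set0 by rewrite -card_gt0; lia.
have [nw1 se2] := cl x nwx sex.
have wxx : w x = x by apply: val_inj => /=; lia.
have Mx : lab w x == lM by rewrite labM wxx eqxx.
have /andP[/eqP wyy _] : (w y == y) && (nw w y != set0) by rewrite -labM -exy.
by rewrite wxx wyy ltnNge ltnW in inv.
Qed.

Lemma clustered_realizes w : clustered w -> realizes w (lab w) (vlab w).
Proof.
move=> cl; split=> [k _|j k lt_jk lt_kn e]; first exact: vlab_papp.
have lt_jn := ltn_trans lt_jk lt_kn.
have := @clustered_mono w (Ordinal lt_jn) (Ordinal lt_kn) cl lt_jk e.
by rewrite -!papp_ord.
Qed.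

(** The number of [lR] departures minus [lR] arrivals before [g] is the height of the path. The
    first clause says that an arrival at [g] uses a strand that departed strictly earlier, the third
    that a middle occurs at height 1. *)
Definition valid_labels s v :=
  [/\ forall g, g < n -> cnt (fun k => v k == lR) g.+1 <= cnt (fun k =>
    s k == lR) g,
      forall g, g < n -> (v g == lM) = (s g == lM),
      forall g, g < n -> s g = lM ->
        cnt (fun k => s k == lR) g = (cnt (fun k => v k == lR) g).+1
    & cnt (fun k => s k == lR) n = cnt (fun k => v k == lR) n].

Lemma realizes_cnt w s v l g : realizes w s v -> g <= n ->
  cnt (fun k => v k == l) g = #|[set y : 'I_n | (s y == l) && (w y < g)]|.
Proof.
move=> [wv _] le_gn; rewrite (cnt_card _ le_gn) -(card_preimset _ (@perm_inj _
  w)).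
apply: eq_card => y; rewrite !inE; congr (_ && _).
by rewrite -papp_ord wv.
Qed.

Lemma clustered_valid w : clustered w -> valid_labels (lab w) (vlab w).
Proof.
move=> cl; have wr := clustered_realizes cl; split.
- move=> g lt_gn; rewrite (realizes_cnt _ wr) // (cnt_card _ (ltnW lt_gn)).
  apply: subset_leq_card; apply/subsetP => y; rewrite !inE => /andP[Ry wy].
  rewrite Ry /=; move: Ry; rewrite labR => Ry; lia.
- move=> g lt_gn; have /= := labM w (Ordinal lt_gn).
  have lt_g' : papp w^-1 g < n by rewrite papp_lt.
  have /= := labM w (Ordinal lt_g'); rewrite /vlab => -> ->.
  have eg : w (Ordinal lt_g') = Ordinal lt_gn.
    by apply: val_inj; rewrite -[LHS]papp_ord /= pappKV.
  have [e|ne] := eqVneq (w (Ordinal lt_gn)) (Ordinal lt_gn).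
    have -> : Ordinal lt_g' = Ordinal lt_gn by apply: (@perm_inj _ w);
      rewrite eg e.
    by rewrite e eqxx.
  rewrite eg; case: eqP => // e; case/eqP: ne.
  by rewrite [in LHS]e eg.
- move=> g lt_gn Mg; set x := Ordinal lt_gn.
  have /andP[/eqP wx nwx] : (w x == x) && (nw w x != set0) by rewrite -labM Mg.
  have sex : se w x != set0.
    by rewrite -card_gt0; have := displacement w x; have := card_gt0 (nw w x);
      rewrite nwx wx; lia.
  have [nw1 _] := cl x nwx sex.
  rewrite (realizes_cnt _ wr) ?(cnt_card _ (ltnW lt_gn)); last exact: ltnW.
  rewrite -[g in LHS]/(nat_of_ord x) -[g in RHS]/(nat_of_ord x).
  rewrite -addn1 -nw1 addnC.
  rewrite -(cardsID (nw w x) [set x0 : 'I_n | (lab w x0 == lR) && (x0 < x)]).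
  congr (_ + _); apply: eq_card => y; rewrite !inE labR wx.
    by case: ltngtP => //=; lia.
  have wyx : w y != w x -> w y != x :> nat by rewrite wx -val_eqE.
  have [->|nyx] := eqVneq y x; first by rewrite wx !ltnn andbF.
  have := wyx; rewrite (inj_eq perm_inj) nyx => /(_ isT); lia.
- rewrite (realizes_cnt _ wr) // (cnt_card _ (leqnn n)).
  by apply: eq_card => y; rewrite !inE !ltn_ord.
Qed.

Section Valid.

Variables (w : 'S_n) (s v : nat -> label).
Hypotheses (vld : valid_labels s v) (real : realizes w s v).

Let E g := cnt (fun k => s k == lR) g.
Let V g := cnt (fun k => v k == lR) g.

Lemma valid_height g : g <= n -> V g <= E g.
Proof.
have [VE _ _ VEn] := vld; rewrite leq_eqVlt => /predU1P[->|lt_gn].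
  by rewrite /E VEn.
by apply: leq_trans (VE g lt_gn); apply: cnt_le.
Qed.

Lemma valid_cntM g : g <= n ->
  cnt (fun k => v k == lM) g = cnt (fun k => s k == lM) g.
Proof.
have [_ VM _ _] := vld; elim: g => // g IH lt_gn.
by rewrite !cntS IH ?VM // ltnW.
Qed.

Lemma valid_cntL g : g <= n ->
  V g + cnt (fun k => v k == lL) g = E g + cnt (fun k => s k == lL) g.
Proof.
move=> le_gn; have := cnt_label s g; have := cnt_label v g.
rewrite valid_cntM // /V /E; lia.
Qed.

(** The position and its value have the same rank; an arrival at or before the departure would
    contradict the shift of index in the first clause of [valid_labels]. *)
Lemma valid_R x : s x = lR -> x < w x.
Proof.
move=> sx; have := realizes_rank real (ltn_ord x); rewrite sx papp_ord => rk.
rewrite ltnNge; apply/negP => le_wx.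
have [VE _ _ _] := vld; have := VE (w x) (ltn_ord _).
have := cnt_le (fun k => s k == lR) le_wx; rewrite cntS rk.
have -> : v (w x) = lR by rewrite -papp_ord real.1.
by rewrite eqxx; lia.
Qed.

Lemma valid_L x : s x = lL -> w x <= x.
Proof.
move=> sx; have := realizes_rank real (ltn_ord x); rewrite sx papp_ord => rk.
rewrite leqNgt; apply/negP => lt_wx.
have := cnt_le (fun k => v k == lL) lt_wx; rewrite rk.
have := valid_cntL (ltn_ord x); have := valid_height (ltn_ord x).
by rewrite [cnt (fun k => s k == _) _.+1]cntS sx eqxx /=; lia.
Qed.

Lemma valid_M x : s x = lM -> w x = x.
Proof.
move=> sx; have := realizes_rank real (ltn_ord x); rewrite sx papp_ord => rk.
apply: val_inj; apply: (@cnt_rank_inj (fun k => v k == lM)).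
- by rewrite /= -papp_ord real.1 ?sx.
- by have [_ VM _ _] := vld; rewrite /= VM // sx.
by rewrite /= rk [RHS]valid_cntM // ltnW.
Qed.

Lemma valid_inversion x y : x < y -> w y < w x ->
  [\/ s x = lR /\ s y = lL, s x = lR /\ s y = lM | s x = lM /\ s y = lL].
Proof.
move=> xy inv.
have ne : s x <> s y.
  move=> e; have := real.2 x y xy (ltn_ord y) e; rewrite !papp_ord.
  by rewrite ltnNge ltnW.
move: (@valid_R x) (@valid_L x) (@valid_M x) (@valid_R y) (@valid_L y) (@valid_M
  y) ne.
case: (s x) => [[]|]; case: (s y) => [[]|] // Rx Lx Mx Ry Ly My _; last 1 first.
- by constructor 3.
- by constructor 1.
- by constructor 2.
- by have := Lx erefl; have := Ry erefl; lia.
- by have := Lx erefl; rewrite (My erefl) in inv; lia.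
- by rewrite (Mx erefl) in inv; have := Ry erefl; lia.
Qed.

(** The height of the path is the number of rightward strands over the cut in front of [g]. *)
Lemma valid_height_card g : g <= n ->
  V g + #|[set y : 'I_n | (s y == lR) && (y < g <= w y)]| = E g.
Proof.
move=> le_gn; rewrite /V /E (realizes_cnt _ real) // (cnt_card _ le_gn).
rewrite -(cardsID [set y | w y < g] [set x0 : 'I_n | (s x0 == lR) && (x0 < g)]).
congr (_ + _); apply: eq_card => y; rewrite !inE -?leqNgt.
  case: eqP => //= /valid_R; lia.
by rewrite [RHS]andbC -andbA.
Qed.

(** At height 1 a single strand passes over [x], and [displacement] at a fixed point equates the two
    cardinals. *)
Lemma valid_nw x : s x = lM -> #|nw w x| = 1 /\ #|se w x| = 1.
Proof.
move=> sx; have [_ _ EV _] := vld; have := EV x (ltn_ord x) sx.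
have := displacement w x; rewrite valid_M // => /addnI <-.
rewrite -/(E x) -(valid_height_card (ltnW (ltn_ord x))) -addn1 => /addnI nw1.
suff -> : nw w x = [set y : 'I_n | (s y == lR) && (y < x <= w y)] by [].
apply/setP => y; rewrite !inE valid_M //; apply/idP/idP.
  move=> /andP[yx wyx]; rewrite yx ltnW ?andbT //.
  have [||[-> _]|[-> _]|[_]] // := @valid_inversion y x; last by rewrite sx.
  by rewrite (valid_M sx).
move=> /and3P[_ yx xwy]; rewrite yx ltn_neqAle xwy andbT.
apply: contraTneq yx => /val_inj e.
suff -> : y = x by rewrite ltnn.
by apply: (@perm_inj _ w); rewrite (valid_M sx).
Qed.

Lemma valid_clustered : clustered w.
Proof.
move=> x /set0Pn[y]; rewrite inE => /andP[yx wyx] /set0Pn[z]; rewrite inE =>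
  /andP[xz wxz].
apply: valid_nw.
by case: (valid_inversion yx wyx) => -[_ sx]; case: (valid_inversion xz wxz) =>
  -[]; rewrite ?sx.
Qed.

Lemma valid_lab k : k < n -> lab w k = s k.
Proof.
move=> lt_kn; rewrite -[k]/(nat_of_ord (Ordinal lt_kn)); set x := Ordinal lt_kn.
rewrite lab_ord; case sx: (s x) => [[]|].
- by rewrite valid_R.
- rewrite ltnNge valid_L //=; case: eqP => //= wx.
  (* A fixed [lL] has equal ranks among positions and among values, so the height at [x] is 0 and no
     strand passes over it. *)
  suff -> : nw w x = set0 by rewrite eqxx.
  apply/setP => y; rewrite [LHS]inE inE; apply/negP => /andP[yx wyx].
  have Ry : s y = lR.
    case: (valid_inversion yx wyx) => -[sy _] //.
    by rewrite wx (valid_M sy) ltnNge ltnW in wyx.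
  have := realizes_rank real lt_kn;
    rewrite -[k]/(nat_of_ord x) papp_ord wx sx => rk.
  have := valid_cntL (ltnW lt_kn); rewrite -[k]/(nat_of_ord x) rk => /addIn VE.
  have := valid_height_card (ltnW lt_kn); rewrite -[k]/(nat_of_ord x) -VE.
  rewrite -[RHS]addn0 => /addnI/eqP; rewrite cards_eq0 => /eqP/setP/(_ y).
  by rewrite wx in wyx; rewrite !inE Ry yx (ltnW wyx).
- have [nw1 _] := valid_nw sx; rewrite valid_M // ltnn eqxx /=.
  by rewrite -card_gt0 nw1.
Qed.

End Valid.

End Labels.

(** * Translation of the forbidden patterns *)

Section Patterns.

Variable n : nat.
Implicit Types (w : 'S_n) (x y z : 'I_n).

Lemma pattern4_intro w (p : seq nat) x0 x1 x2 x3 : size p = 4 ->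
  x0 < x1 -> x1 < x2 -> x2 < x3 ->
  (forall i j, i < 4 -> j < 4 ->
    (w (nth x0 [:: x0; x1; x2; x3] i) < w (nth x0 [:: x0; x1; x2; x3] j)) =
    (nth 0 p i < nth 0 p j)) ->
  pattern_contains w p.
Proof.
move=> sp x01 x12 x23 iso.
exists (fun i => nth x0 [:: x0; x1; x2; x3] i); split; last first.
  by move=> [i lt_i] [j lt_j] /=; apply: iso; rewrite -sp.
move=> [i lt_i] [j lt_j] /=; move: lt_i lt_j; rewrite sp.
by case: i => [|[|[|[|]]]] //; case: j => [|[|[|[|]]]] //= _ _ _; lia.
Qed.

Lemma pattern3_intro w (p : seq nat) x0 x1 x2 : size p = 3 ->
  x0 < x1 -> x1 < x2 ->
  (forall i j, i < 3 -> j < 3 ->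
    (w (nth x0 [:: x0; x1; x2] i) < w (nth x0 [:: x0; x1; x2] j)) =
    (nth 0 p i < nth 0 p j)) ->
  pattern_contains w p.
Proof.
move=> sp x01 x12 iso.
exists (fun i => nth x0 [:: x0; x1; x2] i); split; last first.
  by move=> [i lt_i] [j lt_j] /=; apply: iso; rewrite -sp.
move=> [i lt_i] [j lt_j] /=; move: lt_i lt_j; rewrite sp.
by case: i => [|[|[|]]] //; case: j => [|[|[|]]] //= _ _ _; lia.
Qed.

Ltac check_pattern :=
  let i := fresh "i" in let j := fresh "j" in
  move=> i j; do 4?[case: i => [|i]] => //; do 4?[case: j => [|j]] => //= _ _;
    lia.

Lemma has321P w : pattern_contains w [:: 3; 2; 1] <-> has321 w.
Proof.
split=> [[f [fm fi]]|[x [y [z [xy yz wxy wyz]]]]].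
  pose o i (h : i < 3) := f (@Ordinal 3 i h).
  exists (o 0 isT), (o 1 isT), (o 2 isT).
  by split; rewrite ?fi //; apply: fm.
by apply: (@pattern3_intro w _ x y z) => //; check_pattern.
Qed.

(** Two larger entries on the left of a middle form 3421 or 4321 with it and a smaller entry on its
    right; two smaller entries on the right form 4312 or 4321 with it and a larger one on its
    left. *)
Lemma clustered_patterns w :
  (forall p, p \in [:: [:: 3; 4; 2; 1]; [:: 4; 3; 1; 2]; [:: 4; 3; 2; 1]] ->
     ~ pattern_contains w p) <-> clustered w.
Proof.
split=> [avoid|cl p].
  move=> x /[dup] nwx /set0Pn[y]; rewrite inE => /andP[yx wyx].
  move=> /[dup] sex /set0Pn[z]; rewrite inE => /andP[xz wxz].
  split; apply/eqP; rewrite eqn_leq card_gt0 ?nwx ?sex andbT leqNgt; apply/negP.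
    case/card_gt1P=> y1 [y2 []]; rewrite !inE =>
      /andP[yx1 wyx1] /andP[yx2 wyx2].
    wlog lt_y : y1 y2 yx1 wyx1 yx2 wyx2 / y1 < y2 => [H|] ne.
      have [|lt_y|e] := ltngtP y1 y2; first by move=> lt_y; apply: (H y1 y2).
        by apply: (H y2 y1) => //; rewrite eq_sym.
      by rewrite (val_inj e) eqxx in ne.
    have [lt_w|lt_w|/val_inj/perm_inj e] := ltngtP (w y1) (w y2).
    - apply: (avoid [:: 3; 4; 2; 1]) => //.
      by apply: (@pattern4_intro w _ y1 y2 x z) => //; check_pattern.
    - apply: (avoid [:: 4; 3; 2; 1]) => //.
      by apply: (@pattern4_intro w _ y1 y2 x z) => //; check_pattern.
    - by rewrite e eqxx in ne.
  case/card_gt1P=> y1 [y2 []]; rewrite !inE => /andP[yx1 wyx1] /andP[yx2 wyx2].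
  wlog lt_y : y1 y2 yx1 wyx1 yx2 wyx2 / y1 < y2 => [H|] ne.
    have [|lt_y|e] := ltngtP y1 y2; first by move=> lt_y; apply: (H y1 y2).
      by apply: (H y2 y1) => //; rewrite eq_sym.
    by rewrite (val_inj e) eqxx in ne.
  have [lt_w|lt_w|/val_inj/perm_inj e] := ltngtP (w y1) (w y2).
  - apply: (avoid [:: 4; 3; 1; 2]) => //.
    by apply: (@pattern4_intro w _ y x y1 y2) => //; check_pattern.
  - apply: (avoid [:: 4; 3; 2; 1]) => //.
    by apply: (@pattern4_intro w _ y x y1 y2) => //; check_pattern.
  - by rewrite e eqxx in ne.
have nw2 x y1 y2 z : y1 < y2 -> y2 < x -> x < z -> w x < w y1 -> w x < w y2 ->
  ~ w z < w x.
  move=> y12 yx xz w1 w2 wz.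
  have [||+ _] := cl x.
    by apply/set0Pn; exists y2; rewrite inE yx.
    by apply/set0Pn; exists z; rewrite inE xz.
  apply/eqP; rewrite neq_ltn; apply/orP; right; apply/card_gt1P.
  by exists y1, y2; rewrite !inE yx w1 w2 (ltn_trans y12) // -val_eqE /=
    ltn_eqF.
have se2 x y1 y2 z : y1 < y2 -> x < y1 -> z < x -> w y1 < w x -> w y2 < w x ->
  ~ w x < w z.
  move=> y12 yx xz w1 w2 wz.
  have [||_ +] := cl x.
    by apply/set0Pn; exists z; rewrite inE xz.
    by apply/set0Pn; exists y1; rewrite inE yx.
  apply/eqP; rewrite neq_ltn; apply/orP; right; apply/card_gt1P.
  by exists y1, y2; rewrite !inE yx w1 w2 (ltn_trans yx) // -val_eqE /= ltn_eqF.
rewrite !inE => /or3P[] /eqP -> [f [fm fi]];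
  pose o i (h : i < 4) := f (@Ordinal 4 i h).
- by apply: (@nw2 (o 2 isT) (o 0 isT) (o 1 isT) (o 3 isT)); rewrite ?fi //;
    apply: fm.
- by apply: (@se2 (o 1 isT) (o 2 isT) (o 3 isT) (o 0 isT)); rewrite ?fi //;
    apply: fm.
- by apply: (@nw2 (o 2 isT) (o 0 isT) (o 1 isT) (o 3 isT)); rewrite ?fi //;
    apply: fm.
Qed.

Lemma pattern4231P w : pattern_contains w [:: 4; 2; 3; 1] <->
  exists c x y a : 'I_n, [/\ c < x, x < y, y < a & [/\ w a < w x,
    w x < w y & w y < w c]].
Proof.
split=> [[f [fm fi]]|[c [x [y [a [cx xy ya [wax wxy wyc]]]]]]].
  pose o i (h : i < 4) := f (@Ordinal 4 i h).
  exists (o 0 isT), (o 1 isT), (o 2 isT), (o 3 isT).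
  by split; rewrite ?fi //; try exact: fm; split; rewrite fi.
by apply: (@pattern4_intro w _ c x y a) => //; check_pattern.
Qed.

End Patterns.

(** * The bijection between clustered permutations and walks *)

Definition src (l : letter) : label := omap fst l.
Definition tgt (l : letter) : label := omap snd l.
Definition join_labels (a b : label) : letter :=
  if (a, b) is (Some a', Some b') then Some (a', b') else None.

(** The default letter reads as [lL] beyond the word, as [lab] does outside the permutation, and
    adds nothing to the counts of [lR]. *)
Definition slab (z : seq letter) k := src (nth (Some (false, false)) z k).
Definition tlab (z : seq letter) k := tgt (nth (Some (false, false)) z k).

Notation cntR s := (cnt (fun k => s k == lR)).

Lemma cntSl P g : cnt P g.+1 = P 0 + cnt (fun k => P k.+1) g.
Proof. by rewrite /cnt /= -[1]addn0 iotaDl count_map. Qed.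

Lemma label_eqR (b : bool) : (Some b == lR) = b.
Proof. by case: b. Qed.

(** The guard on each letter, unfolded along the word: an arrival at [g] needs a positive height
    before [g], which is the first inequality. *)
Lemma walkP pm e z : reflect
  [/\ forall g, g < size z -> cntR (tlab z) g.+1 <= e + cntR (slab z) g,
      forall g, g < size z -> slab z g = lM -> e + cntR (slab z) g =
        (cntR (tlab z) g).+1
    & e + cntR (slab z) (size z) = cntR (tlab z) (size z)]
  (walk (fun=> true) pm e z).
Proof.
elim: z pm e => [|l z IH] pm e.
  rewrite /=; apply: (iffP eqP) => [->|[_ _]]; first by split.
  by rewrite addn0.
have sE g : cntR (slab (l :: z)) g.+1 = (src l == lR) +
  cntR (slab z) g := cntSl _ g.
have tE g : cntR (tlab (l :: z)) g.+1 = (tgt l == lR) +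
  cntR (tlab z) g := cntSl _ g.
have s0 : cntR (slab (l :: z)) 0 = 0 by [].
have t0 : cntR (tlab (l :: z)) 0 = 0 by [].
case: l sE tE s0 t0 => [[a b]|] sE tE s0 t0 /=.
- have aE := label_eqR a; have bE := label_eqR b.
  apply: (iffP andP) => [[b_e /IH[c1 c2 c3]]|[c1 c2 c3]].
    split=> [[|g] lt_g|[|g] lt_g //|]; rewrite ?sE ?tE ?s0 ?t0 /= ?aE ?bE.
    + by move: b_e; rewrite (_ : cntR (tlab z) 0 = 0) //; case: (b) => /=; lia.
    + by have := c1 g lt_g; move: b_e; case: (b); lia.
    + by move=> Mg; have := c2 g lt_g Mg; move: b_e; case: (b); lia.
    + by move: c3 b_e; case: (b); lia.
  have b_e : b ==> (0 < e).
    by have := c1 0 isT; rewrite tE s0 /= bE; case: (b) => //=; lia.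
  split=> //; apply/IH; split=> [g lt_g|g lt_g Mg|].
  + by have := c1 g.+1 lt_g; rewrite sE tE /= aE bE; move: b_e; case: (b); lia.
  + by have := c2 g.+1 lt_g Mg; rewrite sE tE /= aE bE; move: b_e; case: (b);
      lia.
  + by move: c3; rewrite sE tE /= aE bE; move: b_e; case: (b); lia.
apply: (iffP andP) => [[/eqP e1 /IH[c1 c2 c3]]|[c1 c2 c3]].
  split=> [[|g] lt_g|[|g] lt_g Mg|]; rewrite ?sE ?tE ?s0 ?t0 /= ?add0n //.
  - exact: c1.
  - by rewrite e1.
  - exact: c2.
split; first by have := c2 0 isT erefl; rewrite s0 t0 addn0 => ->.
apply/IH; split=> [g lt_g|g lt_g Mg|].
- by have := c1 g.+1 lt_g; rewrite sE tE.
- by have := c2 g.+1 lt_g Mg; rewrite sE tE.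
- by move: c3; rewrite sE tE.
Qed.

Lemma tlab_slab z g : (tlab z g == lM) = (slab z g == lM).
Proof. by rewrite /tlab /slab; case: (nth _ z g) => [[]|]. Qed.

Lemma walk_valid n (z : seq letter) : size z = n ->
  walk (fun=> true) false 0 z <-> valid_labels n (slab z) (tlab z).
Proof.
move=> <-; split=> [/walkP[c1 c2 c3]|[c1 _ c2 c3]].
  by split=> // g lt_g; apply: tlab_slab.
by apply/walkP.
Qed.

Section Encoding.

Variable n : nat.
Implicit Types (w : 'S_n) (z : n.-tuple letter).

Fact size_enc w : size (mkseq (fun g =>
  join_labels (lab w g) (vlab w g)) n) == n.
Proof. by rewrite size_mkseq. Qed.

Definition enc w : n.-tuple letter := Tuple (size_enc w).

Lemma slab_enc w k : clustered w -> k < n -> slab (enc w) k = lab w k.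
Proof.
move=> /clustered_valid[_ VM _ _] lt_kn; rewrite /slab /= nth_mkseq //.
by move: (VM k lt_kn); case: (lab w k) => [[]|]; case: (vlab w k) => [[]|].
Qed.

Lemma tlab_enc w k : clustered w -> k < n -> tlab (enc w) k = vlab w k.
Proof.
move=> /clustered_valid[_ VM _ _] lt_kn; rewrite /tlab /= nth_mkseq //.
by move: (VM k lt_kn); case: (lab w k) => [[]|]; case: (vlab w k) => [[]|].
Qed.

Lemma eq_cnt (P Q : pred nat) g : (forall k, k < g -> P k = Q k) -> cnt P g =
  cnt Q g.
Proof.
move=> e; rewrite /cnt; apply: eq_in_count => k; rewrite mem_iota /=; exact: e.
Qed.

Lemma cnt_slab_enc w g : clustered w -> g <= n -> cntR (slab (enc w)) g =
  cntR (lab w) g.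
Proof.
move=> cl le_gn; apply: eq_cnt => k lt_kg.
by rewrite slab_enc // (leq_trans lt_kg).
Qed.

Lemma cnt_tlab_enc w g : clustered w -> g <= n -> cntR (tlab (enc w)) g =
  cntR (vlab w) g.
Proof.
move=> cl le_gn; apply: eq_cnt => k lt_kg.
by rewrite tlab_enc // (leq_trans lt_kg).
Qed.

Lemma enc_realizes w : clustered w -> realizes w (slab (enc w)) (tlab (enc w)).
Proof.
move=> cl; have [r1 r2] := clustered_realizes cl; split=>
  [k lt_kn|j k lt_jk lt_kn].
  by rewrite slab_enc // tlab_enc ?papp_lt // r1.
by rewrite !slab_enc ?(ltn_trans lt_jk) //; apply: r2.
Qed.

Lemma enc_valid w : clustered w -> valid_labels n (slab (enc w)) (tlab (enc w)).
Proof.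
move=> cl; have [c1 c2 c3 c4] := clustered_valid cl; split.
- move=> g lt_gn; rewrite cnt_slab_enc ?cnt_tlab_enc ?(ltnW lt_gn) //;
    exact: c1.
- by move=> g lt_gn; rewrite slab_enc ?tlab_enc ?c2.
- move=> g lt_gn; rewrite slab_enc // cnt_slab_enc ?cnt_tlab_enc ?(ltnW lt_gn)
    //.
  exact: c3.
- by rewrite cnt_slab_enc ?cnt_tlab_enc.
Qed.

Lemma enc_inj w w' : clustered w -> clustered w' -> enc w = enc w' -> w = w'.
Proof.
move=> cl cl' e; apply: (realizes_uniq (enc_realizes cl)).
by rewrite e; apply: enc_realizes.
Qed.

Lemma enc_surj z : walk (fun=> true) false 0 z -> exists2 w,
  clustered w & enc w = z.
Proof.
move=> /(walk_valid (size_tuple z)) vld.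
have [w real] : exists w : 'S_n, realizes w (slab z) (tlab z).
  apply: realizes_exists => l; have [_ _ _ EV] := vld.
  have EM := valid_cntM vld (leqnn n).
  case: l => [[]|] //.
  have := cnt_label (slab z) n; have := cnt_label (tlab z) n.
  rewrite EV EM; lia.
have cl := valid_clustered vld real; exists w => //.
have labE := valid_lab vld real.
apply: val_inj; apply: (@eq_from_nth _ (Some (false, false))).
  by rewrite !size_tuple.
move=> k; rewrite size_tuple => lt_kn; rewrite /= nth_mkseq // labE //.
have -> : vlab w k = tlab z k.
  rewrite /vlab labE ?papp_lt // -real.1 ?papp_lt // pappKV //.
by rewrite /slab /tlab; case: (nth _ z k) => [[]|].
Qed.

Lemma card_clustered (Q : pred (seq letter)) :
  #|[set w : 'S_n | `[< clustered w >] && Q (enc w)]| =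
  #|[set z : n.-tuple letter | walk (fun=> true) false 0 z && Q z]|.
Proof.
rewrite -(card_in_imset (f := enc)); last first.
  move=> w w'; rewrite !inE => /andP[/asboolP cl _] /andP[/asboolP cl' _].
  exact: enc_inj.
apply: eq_card => z; rewrite inE; apply/imsetP/andP.
  move=> [w]; rewrite inE => /andP[/asboolP cl Qw] ->; split=> //.
  apply/(walk_valid (size_tuple _)); exact: enc_valid.
move=> [/enc_surj[w cl <-] Qw]; exists w => //.
by rewrite inE Qw andbT; apply/asboolP.
Qed.

End Encoding.

Fixpoint middles_allowed (m : bool ->
  bool) (pm : bool) (z : seq letter) : bool :=
  if z is l :: z' then ((l == None) ==> m pm) &&
    middles_allowed m (l == None) z'
  else true.

(** Separates the rule on consecutive middles from the walk, so that one bijection serves the three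
    classes. *)
Lemma walk_middles m pm e z :
  walk m pm e z = walk (fun=> true) pm e z && middles_allowed m pm z.
Proof.
elim: z pm e => [|[[a b]|] z IH] pm e /=; rewrite ?andbT // IH.
  by rewrite andbA.
by case: (m pm) => /=; rewrite ?andbF ?andbA.
Qed.

Lemma middles_false pm z :
  middles_allowed (fun=> false) pm z = (None \notin z).
Proof.
by elim: z pm => //= l z IH pm; rewrite IH inE negb_or implybF eq_sym.
Qed.

Lemma middles_true pm z : middles_allowed (fun=> true) pm z.
Proof. by elim: z pm => //= l z IH pm; rewrite implybT IH. Qed.

Lemma middles_negbP z : reflect
  (forall g, g.+1 < size z -> slab z g = lM -> slab z g.+1 <> lM)
  (middles_allowed negb false z).
Proof.
suff H (pm : bool) : reflect ((pm -> 0 < size z -> slab z 0 <> lM) /\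
    forall g, g.+1 < size z -> slab z g = lM -> slab z g.+1 <> lM)
    (middles_allowed negb pm z).
  by apply: (iffP (H false)) => [[]|].
have srcM (l : letter) : src l = lM <-> l == None by case: l => [[a b]|].
elim: z pm => [|l z IH] pm; first by constructor.
apply: (iffP andP) => [[l_pm /IH[c0 c]]|[c0 c]].
  split=> [pmT _ /srcM lN|[|g] lt_g]; first by rewrite lN pmT in l_pm.
    by move=> /srcM lN; apply: c0.
  exact: c.
split; first by apply/implyP => lN; apply/negP => /c0; apply=> //; apply/srcM.
apply/IH; split=> [lN lt0|g lt_g]; first by apply: (c 0) => //; apply/srcM.
exact: (c g.+1).
Qed.

Section Classes.

Variable n : nat.
Implicit Types (w : 'S_n).

Lemma clustered_inversion w (x y : 'I_n) : clustered w -> x < y -> w y < w x ->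
  [\/ lab w x = lR /\ lab w y = lL, lab w x = lR /\ lab w y = lM
    | lab w x = lM /\ lab w y = lL].
Proof.
move=> cl; exact: (valid_inversion (clustered_valid cl) (clustered_realizes
  cl)).
Qed.

Lemma clustered_middle w (x : 'I_n) : clustered w -> lab w x = lM ->
  [/\ w x = x, #|nw w x| = 1 & #|se w x| = 1].
Proof.
move=> cl Mx; have [] := valid_nw (clustered_valid cl) (clustered_realizes cl)
  Mx.
by split=> //; apply: (valid_M (clustered_valid cl) (clustered_realizes cl)).
Qed.

Lemma no321_clustered w : ~ has321 w <-> clustered w /\ None \notin val (enc w).
Proof.
split=> [no321|[cl noM] [x [y [z [xy yz wxy wyz]]]]].
  have cl : clustered w.
    move=> x /set0Pn[y]; rewrite inE => /andP[yx wyx] /set0Pn[z]; rewrite inE =>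
      /andP[xz wxz].
    by case: no321; exists y, x, z.
  split=> //; apply/negP => /(nthP (Some (false, false)))[k];
    rewrite size_tuple => lt_kn ek.
  have Mk : lab w (Ordinal lt_kn) = lM.
    by rewrite -(slab_enc cl lt_kn) /slab ek.
  have [_ /eqP nw1 /eqP se1] := clustered_middle cl Mk.
  have [/cards1P[y ny] /cards1P[z sz]] := (nw1, se1).
  have : y \in nw w (Ordinal lt_kn) by rewrite ny inE.
  have : z \in se w (Ordinal lt_kn) by rewrite sz inE.
  rewrite !inE => /andP[h1 h2] /andP[h3 h4].
  by apply: no321; exists y, (Ordinal lt_kn), z.
have My : lab w y = lM.
  by case: (clustered_inversion cl xy wxy) => -[_ e];
    case: (clustered_inversion cl yz wyz) => -[];
    rewrite e.
case/negP: noM; apply/(nthP (Some (false, false))); exists y;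
  first by rewrite size_tuple.
have := slab_enc cl (ltn_ord y); rewrite My /slab.
by case: (nth _ _ y) => [[]|].
Qed.

(** Two adjacent middles form a 4231 with the larger entry left of the first and the smaller entry
    right of the second. Conversely, let [x < y] be the inner entries of a 4231. If [x.+1] were not
    a middle, it would be a second larger entry left of [y] when labelled [lR], or a second smaller
    entry right of [x] when labelled [lL]. *)
Lemma avoids4231 w : clustered w ->
  ~ pattern_contains w [:: 4; 2; 3; 1] <-> middles_allowed negb false (enc w).
Proof.
move=> cl; split=> [avoid|/middles_negbP noMM /pattern4231P].
  apply/middles_negbP => g; rewrite size_tuple => lt_g.
  have lt_g' := ltnW lt_g; rewrite !slab_enc // => Mx My; apply: avoid;
    apply/pattern4231P.
  set x := Ordinal lt_g'; set y := Ordinal lt_g.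
  have [wx /eqP/cards1P[c nc] _] := @clustered_middle w x cl Mx.
  have [wy _ /eqP/cards1P[a na]] := @clustered_middle w y cl My.
  have : c \in nw w x by rewrite nc inE.
  have : a \in se w y by rewrite na inE.
  rewrite !inE wx wy => /andP[ya way] /andP[cx wcx]; exists c, x, y, a.
  have wcy : w c != w y.
    by rewrite (inj_eq perm_inj) -val_eqE /=; rewrite /= in cx; lia.
  have wax : w a != w x.
    by rewrite (inj_eq perm_inj) -val_eqE /=; rewrite /= in ya; lia.
  rewrite wx wy -!val_eqE /= in wcy wax wcx way *.
  by split=> //; rewrite ?wx ?wy /=; split; lia.
move=> [c [x [y [a [cx xy ya [wax wxy wyc]]]]]].
have wxc := ltn_trans wxy wyc; have way := ltn_trans wax wxy.
have mid (u : 'I_n) : c < u -> u < a -> w a < w u -> w u < w c -> lab w u = lM.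
  move=> cu ua wau wuc.
  by case: (clustered_inversion cl cu wuc) => -[_ e];
    case: (clustered_inversion cl ua wau) => -[];
    rewrite e.
have Mx := mid x cx (ltn_trans xy ya) wax wxc.
have My := mid y (ltn_trans cx xy) ya way wyc.
have [wx _ /eqP/cards1P[sx sxE]] := clustered_middle cl Mx.
have [wy /eqP/cards1P[ny nyE] _] := clustered_middle cl My.
have lt_x1 : x.+1 < n by apply: leq_ltn_trans (ltn_ord y).
have Mx1 : lab w (Ordinal lt_x1) = lM.
  have [lt_y|le_y] := ltnP x.+1 y; last first.
    by rewrite (_ : Ordinal lt_x1 = y) //; apply: val_inj => /=; lia.
  set u := Ordinal lt_x1; have cu : c < u by rewrite /= ltnW.
  case Lu: (lab w u) => [[]|] //.
    have Rc : lab w c = lR.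
      have [[]|[]|[Mc _]] // := clustered_inversion cl cx wxc.
      have [wc _ _] := clustered_middle cl Mc.
      by move: wxc; rewrite wx wc ltnNge ltnW.
    have wcu := clustered_mono cl cu (etrans Rc (esym Lu)).
    have : u \in nw w y by rewrite inE lt_y (ltn_trans wyc).
    have : c \in nw w y by rewrite inE (ltn_trans cx xy) wyc.
    by rewrite nyE !inE => /eqP ec /eqP eu; move: cu; rewrite eu ec ltnn.
  have La : lab w a = lL.
    have [[]|[_ Ma]|[]] // := clustered_inversion cl ya way.
    have [wa _ _] := clustered_middle cl Ma.
    by move: way; rewrite wa wy ltnNge ltnW.
  have ua : u < a by apply: ltn_trans ya.
  have wua := clustered_mono cl ua (etrans Lu (esym La)).
  have : u \in se w x by rewrite inE ltnSn (ltn_trans wua).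
  have : a \in se w x by rewrite inE (ltn_trans xy ya) wax.
  by rewrite sxE !inE => /eqP ea /eqP eu; move: ua; rewrite eu ea ltnn.
have := noMM x; rewrite size_tuple => /(_ lt_x1); rewrite !slab_enc //.
by move=> /(_ Mx); apply.
Qed.

End Classes.

(** * The window of a contained heap *)

Section Crossing.

Variable n : nat.
Implicit Types (w : 'S_n) (x y : 'I_n) (c : nat).

Lemma crossing_out w c : n <= c.+1 -> crossing c w = 0.
Proof.
move=> le_nc; apply/eqP; rewrite cards_eq0; apply/eqP/setP => x.
by rewrite !inE; have := ltn_ord (w x); lia.
Qed.

Lemma crossing_lt w c : 0 < crossing c w -> c.+1 < n.
Proof. by apply: contraTT; rewrite -leqNgt => /crossing_out ->. Qed.

Lemma crossing_gt0 w c x : x <= c -> c < w x -> 0 < crossing c w.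
Proof. by move=> xc cw; apply/card_gt0P; exists x; rewrite inE xc. Qed.

Lemma card_preim_lt w g : g <= n -> #|[set x : 'I_n | w x < g]| = g.
Proof.
move=> le_gn; rewrite -[RHS](card_ord_lt le_gn) -[in RHS](card_preimset _
  (@perm_inj _ w)).
by apply: eq_card => x; rewrite !inE.
Qed.

(** The initial segment is mapped into itself, hence onto itself by cardinality. *)
Lemma crossing_eq0 w c : crossing c w = 0 -> forall x, (w x <= c) = (x <= c).
Proof.
move=> c0 x; have [le_nc|lt_cn] := leqP n c.
  by rewrite !(leq_trans (ltnW (ltn_ord _)) le_nc).
have sub : [set x : 'I_n | x < c.+1] \subset [set x | w x < c.+1].
  apply/subsetP => y; rewrite !inE !ltnS => yc; rewrite leqNgt; apply/negP =>
    cy.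
  by have := crossing_gt0 yc cy; rewrite c0.
have /subset_cardP e : #|[set x : 'I_n | x < c.+1]| = #|[set x | w x < c.+1]|.
  by rewrite card_preim_lt // card_ord_lt.
by have := e sub x; rewrite !inE !ltnS => <-.
Qed.

End Crossing.

(** * The places moved by a connected 321-avoiding permutation *)

Section Core.

Variables (k i j : nat) (h : 'S_k).
Hypotheses (no321 : ~ has321 h) (le_ij : i <= j) (lt_jk : j.+1 < k)
  (supp : forall c, (0 < crossing c h) = (i <= c <= j)).
Implicit Types q : 'I_k.

Lemma crossing_outside c : (c < i) || (j < c) -> crossing c h = 0.
Proof. by move=> out; apply/eqP; rewrite -leqn0 leqNgt supp; lia. Qed.

Lemma core_fixed q : (q < i) || (j.+1 < q) -> h q = q.
Proof.
move=> out; apply: val_inj; apply/eqP; rewrite eqn_leq.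
have c0 : crossing q h = 0 by apply: crossing_outside; lia.
rewrite (crossing_eq0 c0) leqnn /=; have [->|q_gt0] := posnP q; first by [].
have c1 : crossing q.-1 h = 0 by apply: crossing_outside; lia.
by have := crossing_eq0 c1 q; lia.
Qed.

Lemma core_stable q : (i <= h q <= j.+1) = (i <= q <= j.+1).
Proof.
have c1 : crossing j.+1 h = 0 by apply: crossing_outside; lia.
rewrite (crossing_eq0 c1); congr (_ && _).
have [->|i_gt0] := posnP i; first by [].
have c0 : crossing i.-1 h = 0 by apply: crossing_outside; lia.
by have := crossing_eq0 c0 q; lia.
Qed.

(** Some strand crosses a column next to [q]; were [q] fixed, it would be inverted with it, and
    without 321 the right end of an inversion moves left. *)
Lemma core_moved q : i <= q <= j.+1 -> h q != q.
Proof.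
move=> core; apply/eqP => hq.
have no (x : 'I_k) : x < q -> h q < h x -> False.
  by move=> xq inv; have := no321_deficiency no321 xq inv; rewrite hq ltnn.
have [qj|jq] := leqP q j.
  have /card_gt0P[x] : 0 < crossing q h by rewrite supp; lia.
  rewrite inE leq_eqVlt => /andP[/predU1P[/val_inj ->|xq]];
    first by rewrite hq ltnn.
  by move=> inv; apply: (no x); rewrite ?hq.
have /card_gt0P[x] : 0 < crossing q.-1 h by rewrite supp; lia.
rewrite inE => /andP[xq inv]; apply: (no x); first by lia.
have : h x != h q by rewrite (inj_eq perm_inj) -val_eqE /=; lia.
rewrite -val_eqE /= hq; lia.
Qed.

(** A step of exactly one place thins out an internal column: column [q] itself if [i < q < j],
    column [i.+1] if [q = i], column [j.-1] if [q = j]. Only one strand can cross it. *)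
Lemma core_move_right q : (forall c, i < c < j -> 1 < crossing c h) ->
  i.+1 < j -> h q != q.+1 :> nat.
Proof.
move=> big lt_ij; apply/eqP => hq.
have core : i <= q <= j.+1.
  by rewrite leqNgt [q <= _]leqNgt -negb_or; apply/negP => /core_fixed e;
    rewrite e in hq; lia.
have hcore : i <= h q <= j.+1 by rewrite core_stable.
have no (x : 'I_k) : x < q -> h q < h x -> False.
  by move=> xq inv; have := no321_deficiency no321 xq inv; rewrite hq; lia.
have [iq|qi|eq_i] := ltngtP i q; last 1 first.
- have /card_gt1P[x [y []]] : 1 < crossing i.+1 h by apply: big; lia.
  rewrite !inE => /andP[x1 hx] /andP[y1 hy] ne.
  have mid (z : 'I_k) : z <= i.+1 -> i.+1 < h z -> z = i.+1 :> nat.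
    move=> z1 hz; have := core_stable z; have := ltn_ord (h z).
    have [zi|iz|ez] := ltngtP z i; [|by lia|].
      by have /core_fixed ez : (z < i) || (j.+1 < z);
        [rewrite zi | rewrite ez in hz; lia].
    have ezq : z = q by apply: val_inj => /=; lia.
    by rewrite ezq in hz; lia.
  by case/eqP: ne; apply: val_inj => /=; rewrite (mid x) // (mid y).
- have [qj|jq|eq_j] := ltngtP q j.
  + have /card_gt1P[x [y []]] : 1 < crossing q h by apply: big; lia.
    have one (z : 'I_k) : z <= q -> q < h z -> z = q.
      rewrite leq_eqVlt => /predU1P[/val_inj//|zq hz]; case: (no z zq).
      have : h z != h q by rewrite (inj_eq perm_inj) -val_eqE /=; lia.
      by rewrite -val_eqE /= hq; lia.
    by rewrite !inE => /andP[/one h1 /h1 ->] /andP[/one h2 /h2 ->];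
      rewrite eqxx.
  + by lia.
  + have /card_gt1P[x [y []]] : 1 < crossing j.-1 h by apply: big; lia.
    rewrite !inE => /andP[x1 hx] /andP[y1 hy] ne.
    have mid (z : 'I_k) : z <= j.-1 -> j.-1 < h z -> h z = j :> nat.
      move=> z1 hz; have := core_stable z.
      have : h z != h q by rewrite (inj_eq perm_inj) -val_eqE /=; lia.
      have [zi|iz] := ltnP z i.
        by have ez : h z = z by [apply: core_fixed; rewrite zi];
          rewrite ez in hz *; lia.
      by rewrite -val_eqE /= hq; lia.
    case/eqP: ne; apply: (@perm_inj _ h); apply: val_inj => /=.
    by rewrite (mid x) // (mid y).
- by lia.
Qed.

End Core.

Lemma cntD P m d : cnt P (m + d) = cnt P m + cnt (fun e => P (m + e)) d.
Proof. by elim: d => [|d IH]; rewrite ?addn0 // addnS !cntS IH addnA. Qed.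

Lemma cnt_eq0 (P : pred nat) g : (forall k, k < g -> ~~ P k) -> cnt P g = 0.
Proof. by elim: g => // g IH nP; rewrite cntS IH ?(negbTE (nP g _)) // =>
  k /ltnW; apply: nP. Qed.

(** * Strands along a length-additive factorization *)

Definition prefix n (p w : 'S_n) := forall x y, inv_pair p x y ->
  inv_pair w x y.

Section Prefix.

Variables (n : nat) (p w : 'S_n).
Hypotheses (cl : clustered w) (pw : prefix p w).

Lemma prefix_inv (x y : 'I_n) : x < y -> p y < p x -> w y < w x.
Proof. by move=> xy inv; rewrite -inv_pairP //; apply: pw;
  rewrite inv_pairP. Qed.

Let q := (p^-1 * w)%g.

(** No larger entry stands left of a rightward strand in [w], hence none does in [p] or in the
    remaining factor; [displacement] then says that neither factor moves it left. *)
Lemma prefix_R k : lab w k = lR -> k <= papp p k <= papp w k.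
Proof.
have [le_nk|lt_kn] := leqP n k.
  by rewrite /lab insubF // ltnNge le_nk.
rewrite -[k]/(nat_of_ord (Ordinal lt_kn)) !papp_ord; set x := Ordinal lt_kn =>
  Rx.
have noR (y : 'I_n) : y < x -> ~ w x < w y.
  move=> yx wyx; by case: (clustered_inversion cl yx wyx) => -[_]; rewrite Rx.
apply/andP; split.
  have := displacement p x; suff -> : nw p x = set0 by rewrite cards0; lia.
  apply/setP => y; rewrite !inE; apply/negP => /andP[yx pyx].
  exact: (noR y yx (prefix_inv yx pyx)).
have := displacement q (p x); rewrite permM permK.
suff -> : nw q (p x) = set0 by rewrite cards0; lia.
apply/setP => Y; rewrite !inE; apply/negP => /andP[].
rewrite -(permKV p Y); set y := (p^-1 Y)%g; rewrite !permM !permK => pyx wyx.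
have [yx|xy|/val_inj e] := ltngtP y x; first exact: noR wyx.
  by have := prefix_inv xy pyx; rewrite ltnNge ltnW.
by rewrite e ltnn in wyx.
Qed.

Lemma prefix_L k : lab w k = lL -> papp w k <= papp p k <= k.
Proof.
have [le_nk|lt_kn] := leqP n k; first by rewrite !papp_out // leqnn.
rewrite -[k]/(nat_of_ord (Ordinal lt_kn)) !papp_ord; set x := Ordinal lt_kn =>
  Lx.
have noL (y : 'I_n) : x < y -> ~ w y < w x.
  move=> yx wyx; by case: (clustered_inversion cl yx wyx) => -[]; rewrite Lx.
apply/andP; split; last first.
  have := displacement p x; suff -> : se p x = set0 by rewrite cards0; lia.
  apply/setP => y; rewrite !inE; apply/negP => /andP[yx pyx].
  exact: (noL y yx (prefix_inv yx pyx)).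
have := displacement q (p x); rewrite permM permK.
suff -> : se q (p x) = set0 by rewrite cards0; lia.
apply/setP => Y; rewrite !inE; apply/negP => /andP[].
rewrite -(permKV p Y); set y := (p^-1 Y)%g; rewrite !permM !permK => pyx wyx.
have [yx|xy|/val_inj e] := ltngtP y x; last by rewrite e ltnn in wyx.
  by have := prefix_inv yx pyx; rewrite ltnNge ltnW.
exact: noL wyx.
Qed.

(** Rightward strands only advance, so after [p] their number among the first [m] places lies
    between its final and its initial value, the two boundary paths. Leftward strands behave
    dually. *)
Lemma prefix_cntR m : cnt (fun c =>
  lab w (papp p^-1 c) == lR) m <= cntR (lab w) m.
Proof.
apply: (cnt_map (@papp_inj _ p^-1%g)) => c lt_cm /eqP Rc; rewrite Rc; split=>
  //.
have /andP[+ _] := prefix_R Rc; rewrite pappKV => le;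
  exact: leq_ltn_trans le lt_cm.
Qed.

Lemma cntR_prefix m : cntR (vlab w) m <= cnt (fun c =>
  lab w (papp p^-1 c) == lR) m.
Proof.
apply: (cnt_map (@papp_inj _ (w^-1 * p)%g)) => c lt_cm /eqP Rc.
rewrite pappM pappK -/(vlab w c) Rc; split=> //.
have /andP[_] := prefix_R Rc; rewrite pappKV => le;
  exact: leq_ltn_trans le lt_cm.
Qed.

Lemma prefix_cntL m :
  cnt (fun c => lab w c == lL) m <= cnt (fun c => lab w (papp p^-1 c) == lL) m.
Proof.
apply: (cnt_map (@papp_inj _ p)) => c lt_cm /eqP Lc; rewrite pappK Lc; split=>
  //.
have /andP[_ le] := prefix_L Lc; exact: leq_ltn_trans le lt_cm.
Qed.

Lemma cntL_prefix m :
  cnt (fun c => lab w (papp p^-1 c) == lL) m <= cnt (fun c => vlab w c == lL) m.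
Proof.
apply: (cnt_map (@papp_inj _ (p^-1 * w)%g)) => c lt_cm /eqP Lc.
rewrite pappM vlab_papp Lc; split=> //.
have /andP[+ _] := prefix_L Lc; rewrite pappKV => le;
  exact: leq_ltn_trans le lt_cm.
Qed.

End Prefix.

(* [E] and [V] are the two boundary paths of a heap, read from some column on: the
   heap of [h] lies between them at the vertical offset [r].  In the second case
   [h] has two columns and is found inside a braid s_c s_(c+1) s_c. *)
Definition fits (E V : nat -> nat) (mid : pred nat) k (h : 'S_k) :=
  (exists r, forall c, 0 < crossing c h ->
     V c.+1 <= r + cntR (vlab h) c.+1 /\ r + cntR (lab h) c.+1 <= E c.+1) \/
  (exists c, (forall d, (0 < crossing d h) = (c <= d <= c.+1)) /\ mid c.+1).

Definition core_shape k (h : 'S_k) i j :=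
  [/\ ~ has321 h, i <= j, j.+1 < k, forall c, (0 < crossing c h) = (i <= c <= j)
    & forall c, i < c < j -> 1 < crossing c h].

Section CoreCounts.

Variables (k i j : nat) (h : 'S_k).
Hypothesis shape : core_shape h i j.

Lemma core_cnt_lab c : i <= c <= j -> cntR (lab h) c.+1 =
  cnt (fun e => i + e < papp h (i + e)) (c.+1 - i).
Proof.
have [no321 le_ij lt_jk supp big] := shape => ic.
have -> : c.+1 = i + (c.+1 - i) by lia.
rewrite cntD cnt_eq0 ?add0n; last first.
  move=> q lt_qi; have lt_qk : q < k by lia.
  have := labR h (Ordinal lt_qk);
    rewrite (core_fixed le_ij lt_jk supp) /= ?lt_qi // => ->.
  by rewrite ltnn.
rewrite [in RHS](_ : i + (c.+1 - i) - i = c.+1 - i); last by lia.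
apply: eq_cnt => e lt_e; have lt_k : i + e < k by lia.
by have := labR h (Ordinal lt_k); rewrite -papp_ord /=.
Qed.

Lemma core_cnt_vlab c : i <= c <= j -> cntR (vlab h) c.+1 =
  cnt (fun e => papp h^-1 (i + e) < i + e) (c.+1 - i).
Proof.
have [no321 le_ij lt_jk supp big] := shape => ic.
have lt_hV (q : nat) : q < k -> papp h^-1 q < k by rewrite papp_lt.
have vE (q : nat) : q < k -> (vlab h q == lR) = (papp h^-1 q < q).
  move=> lt_qk; have /= := labR h (Ordinal (lt_hV q lt_qk)).
  by rewrite -papp_ord /= pappKV.
have -> : c.+1 = i + (c.+1 - i) by lia.
rewrite cntD cnt_eq0 ?add0n; last first.
  move=> q lt_qi; have lt_qk : q < k by lia.
  have := core_fixed le_ij lt_jk supp (q := Ordinal lt_qk); rewrite /= lt_qi =>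
    /(_ isT) e.
  rewrite vE // -[papp _ _]/(papp h^-1 (Ordinal lt_qk)) papp_ord.
  by rewrite -[X in (h^-1)%g X]e permK ltnn.
rewrite [in RHS](_ : i + (c.+1 - i) - i = c.+1 - i); last by lia.
by apply: eq_cnt => e lt_e; rewrite vE //; lia.
Qed.

Lemma core_cnt_vlab0 : cntR (vlab h) i.+1 = 0.
Proof.
have [_ le_ij lt_jk supp _] := shape.
rewrite core_cnt_vlab ?leqnn // subSnn /cnt /= !addn0.
have lt_ik : i < k by lia.
have lt_hk : papp h^-1 i < k by rewrite papp_lt.
have := core_stable le_ij lt_jk supp (Ordinal lt_hk);
  rewrite -papp_ord /= pappKV; lia.
Qed.

End CoreCounts.

(** * A contained heap lies between the boundary paths *)

Section ContainsFits.

Variables (n k i j t : nat) (w a g b : 'S_n) (h : 'S_k).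
Hypotheses (cl : clustered w) (shape : core_shape h i j) (le_tk : t + k <= n).
Hypothesis gE : forall m, papp g m = if t <= m then t + papp h (m - t) else m.
Hypotheses (wE : w = (a * g * b)%g) (ag : additive a g) (agb : additive (a *
  g)%g b).

Implicit Types q : 'I_k.

Fact pos_proof (q : 'I_k) : t + q < n.
Proof. by have := ltn_ord q; lia. Qed.

Definition pos (q : 'I_k) : 'I_n := Ordinal (pos_proof q).
(** The strand of [w], named by its initial position, that stands at place [t + q] when the
    translate of [h] starts to act. *)
Definition strand (q : 'I_k) : 'I_n := (a^-1 (pos q))%g.

Lemma strand_inj : injective strand.
Proof.
by move=> q q' /perm_inj/(congr1 val)/= /addnI/val_inj.
Qed.

Lemma g_pos q : g (pos q) = pos (h q).
Proof.
by apply: val_inj; rewrite -[LHS]papp_ord gE /= leq_addr addKn papp_ord.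
Qed.

Lemma papp_gV (q : nat) : q < k -> papp g^-1 (t + q) = t + papp h^-1 q.
Proof.
move=> lt_qk; apply: (@papp_inj _ g);
  rewrite pappKV gE leq_addr addKn pappKV //.
Qed.

Lemma ag_prefix : prefix (a * g)%g w.
Proof. by rewrite wE. Qed.

Lemma a_prefix : prefix a w.
Proof. by move=> x y /ag; apply: ag_prefix. Qed.

Lemma strand_inversion q q' : q < q' -> h q' < h q ->
  strand q < strand q' /\ w (strand q') < w (strand q).
Proof.
move=> qq' inv.
have lt_pos : pos q < pos q' by rewrite /= ltn_add2l.
have inv_g : g (pos q') < g (pos q) by rewrite !g_pos /= ltn_add2l.
have lt_s := additive_inversion ag lt_pos inv_g; split=> //.
by apply: (prefix_inv ag_prefix) => //; rewrite !permM !permKV.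
Qed.

Lemma strand_right q : q < h q -> lab w (strand q) != lL.
Proof.
move=> qh; have : 0 < #|se h q| by have := displacement h q; lia.
move=> /card_gt0P[q']; rewrite inE => /andP[qq' inv].
have [lt_s inv_w] := strand_inversion qq' inv.
by case: (clustered_inversion cl lt_s inv_w) => -[-> _].
Qed.

Lemma strand_left q : h q < q -> lab w (strand q) != lR.
Proof.
move=> qh; have : 0 < #|nw h q| by have := displacement h q; lia.
move=> /card_gt0P[q']; rewrite inE => /andP[qq' inv].
have [lt_s inv_w] := strand_inversion qq' inv.
by case: (clustered_inversion cl lt_s inv_w) => -[_ ->].
Qed.

(** Inversions of [h] at [q] inject into those of [w] at its strand, which has one on each side. *)
Lemma strand_middle q : lab w (strand q) = lM -> h q <= q.+1 /\ q <= (h q).+1.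
Proof.
move=> Mq; have [_ nw1 se1] := clustered_middle cl Mq.
have le_nw : #|nw h q| <= 1.
  rewrite -nw1 -(card_imset _ strand_inj); apply: subset_leq_card.
  apply/subsetP => _ /imsetP[q' + ->]; rewrite !inE => /andP[qq' inv].
  by have [-> ->] := strand_inversion qq' inv.
have le_se : #|se h q| <= 1.
  rewrite -se1 -(card_imset _ strand_inj); apply: subset_leq_card.
  apply/subsetP => _ /imsetP[q' + ->]; rewrite !inE => /andP[qq' inv].
  by have [-> ->] := strand_inversion qq' inv.
by have := displacement h q; lia.
Qed.

(* Every strand of [h] that is the middle of a 321 of [w] moves by one, which does
   not happen when [h] has an internal column. *)
Lemma strand_dichotomy :
  (forall q : 'I_k, i <= q <= j.+1 -> (lab w (strand q) == lR) = (q < h q)) \/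
  j <= i.+1 /\
  (forall q : 'I_k, i <= q <= j.+1 -> (lab w (strand q) == lL) = (h q < q)).
Proof.
have [no321 le_ij lt_jk supp big] := shape.
have moved := core_moved no321 le_ij lt_jk supp.
have [/'forall_implyP H|] := boolP [forall q : 'I_k, (i <= q <= j.+1) ==>
    ((lab w (strand q) == lR) == (q < h q))].
  by left=> q /H/eqP.
rewrite negb_forall => /existsP[q]; rewrite negb_imply => /andP[coreq ne].
have {ne} [Mq hq] : lab w (strand q) = lM /\ h q = q.+1 :> nat.
  have := moved q coreq; rewrite -val_eqE /= => nq.
  have [lt_qh|le_hq] := ltnP q (h q).
    rewrite lt_qh in ne; have := strand_right lt_qh; move: ne.
    case Mq: (lab w (strand q)) => [[]|] // _ _.
    by split=> //; have := strand_middle Mq; lia.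
  have lt_hq : h q < q by rewrite ltn_neqAle nq.
  by rewrite ltnNge le_hq (negbTE (strand_left lt_hq)) in ne.
right; have le_ji : j <= i.+1.
  rewrite leqNgt; apply/negP => lt_ij.
  by have := core_move_right no321 le_ij lt_jk supp q big lt_ij;
    rewrite hq eqxx.
split=> // q' coreq'; have := moved q' coreq'; rewrite -val_eqE /= => nq'.
have [lt_qh|le_hq] := ltnP q' (h q').
  by rewrite (negbTE (strand_right lt_qh)) ltnNge ltnW.
have lt_hq : h q' < q' by rewrite ltn_neqAle nq'.
rewrite lt_hq; have := strand_left lt_hq.
case Mq': (lab w (strand q')) => [[]|] // _.
have [_ le_q'] := strand_middle Mq'.
have stable z := core_stable le_ij lt_jk supp z.
pose o d (lt_d : i + d < k) : 'I_k := Ordinal lt_d.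
have lt0 : i + 0 < k by lia.
have lt1 : i + 1 < k by lia.
have s0 := stable (o 0 lt0); have s1 := stable (o 1 lt1).
have hneq (z z' : 'I_k) : z != z' :> nat -> h z != h z' :> nat.
  by move=> ne; rewrite [_ == _ :> nat](inj_eq val_inj) (inj_eq perm_inj).
(* With one column [h] exchanges two places, and two middles are never inverted. *)
have [eji|ne_ji] := eqVneq j i.
  have qi : q = i :> nat by have := stable q; lia.
  have qi' : q' = i.+1 :> nat by have := stable q'; lia.
  have qq' : q < q' by lia.
  have inv : h q' < h q by lia.
  have [lt_s inv_w] := strand_inversion qq' inv.
  by case: (clustered_inversion cl lt_s inv_w) => -[]; rewrite Mq Mq'.
(* With two columns [h] permutes three places without fixed point, hence by displacements 1, 1, -2
   or 2, -1, -1; the steps 1 at [q] and -1 at [q'] do not occur together. *)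
have lt2 : i + 2 < k by lia.
have s2 := stable (o 2 lt2).
have [m0 m1 m2] : [/\ h (o 0 lt0) != i + 0 :> nat, h (o 1 lt1) != i + 1 :> nat &
    h (o 2 lt2) != i + 2 :> nat].
  by split; apply: (moved (o _ _)) => /=; lia.
have d01 := hneq (o 0 lt0) (o 1 lt1); have d02 := hneq (o 0 lt0) (o 2 lt2).
have d12 := hneq (o 1 lt1) (o 2 lt2).
rewrite /= in s0 s1 s2 d01 d02 d12.
have cover (z : 'I_k) : i <= z <= j.+1 -> [\/ z = o 0 lt0, z = o 1 lt1 | z =
  o 2 lt2].
  move=> corez; have : [|| z == i + 0 :> nat, z == i + 1 :> nat | z == i +
    2 :> nat] by lia.
  by case/or3P => /eqP e; [constructor 1 | constructor 2 | constructor 3];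
    apply: val_inj.
by exfalso; case: (cover q coreq) => e; case: (cover q' coreq') => e';
  subst q q';
  rewrite /= in hq le_q' lt_hq; lia.
Qed.

(** [P1] reads the labels of the strands in the order in which [h] finds them, [P2] in the order in
    which it leaves them. *)
Let P1 l c := lab w (papp a^-1 c) == l.
Let P2 l c := lab w (papp (a * g)^-1 c) == l.

Lemma cnt_P12 l : cnt (P2 l) (t + i) = cnt (P1 l) (t + i).
Proof.
have [no321 le_ij lt_jk supp big] := shape.
apply: eq_cnt => c lt_c; rewrite /P2 /P1 invMg pappM;
  congr (lab w (papp _ _) == _).
apply: (@papp_inj _ g); rewrite pappKV gE; case: leqP => // le_tc.
have lt_qk : c - t < k by lia.
have := papp_ord h (Ordinal lt_qk); rewrite (core_fixed le_ij lt_jk supp) /= =>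
  [->|]; lia.
Qed.

Lemma P1_strand l (q : 'I_k) : P1 l (t + q) = (lab w (strand q) == l).
Proof.
by rewrite /P1 /strand -papp_ord.
Qed.

Lemma P2_strand l (q : nat) : q < k -> P2 l (t + q) = P1 l (t + papp h^-1 q).
Proof.
by move=> lt_qk; rewrite /P2 invMg pappM papp_gV.
Qed.

Lemma contains_fits_R :
  (forall q : 'I_k, i <= q <= j.+1 -> (lab w (strand q) == lR) = (q < h q)) ->
  fits (fun c => cntR (lab w) (t + c)) (fun c => cntR (vlab w) (t + c))
    (fun c => lab w (t + c) == lM) h.
Proof.
have [no321 le_ij lt_jk supp big] := shape => claim.
(* The vertical offset is the number of rightward strands standing left of the core. *)
left; exists (cnt (P1 lR) (t + i)) => c; rewrite supp => ic.
have lt_core e : e < c.+1 - i -> i + e < k by lia.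
have c1 : cnt (P1 lR) (t + c.+1) = cnt (P1 lR) (t + i) + cntR (lab h) c.+1.
  rewrite (core_cnt_lab shape) // (_ : t + c.+1 = t + i + (c.+1 - i));
    last by lia.
  rewrite cntD; congr (_ + _); apply: eq_cnt => e lt_e.
  have := claim (Ordinal (lt_core e lt_e));
    rewrite -P1_strand -papp_ord /= -addnA.
  by apply; lia.
have c2 : cnt (P2 lR) (t + c.+1) = cnt (P1 lR) (t + i) + cntR (vlab h) c.+1.
  rewrite (core_cnt_vlab shape) // (_ : t + c.+1 = t + i + (c.+1 - i));
    last by lia.
  rewrite cntD cnt_P12; congr (_ + _); apply: eq_cnt => e lt_e.
  have lt_k := lt_core e lt_e; rewrite -addnA P2_strand //.
  have lt_hk : papp h^-1 (i + e) < k by rewrite papp_lt.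
  have := claim (Ordinal lt_hk); rewrite -P1_strand -papp_ord /= pappKV; apply.
  by rewrite -(core_stable le_ij lt_jk supp (Ordinal lt_hk)) -papp_ord /=
    pappKV; lia.
rewrite -c1 -c2; split; [exact: (cntR_prefix cl ag_prefix)|exact: (prefix_cntR
  cl a_prefix)].
Qed.

(** Only the leftward strands are identified here, so the complementary counts are compared. This
    gives the boundary paths because the number [mu] of middles passed is constant over the columns,
    unless a middle sits at [t + j], which is the second alternative of [fits]. *)
Lemma contains_fits_L : j <= i.+1 ->
  (forall q : 'I_k, i <= q <= j.+1 -> (lab w (strand q) == lL) = (h q < q)) ->
  fits (fun c => cntR (lab w) (t + c)) (fun c => cntR (vlab w) (t + c))
    (fun c => lab w (t + c) == lM) h.
Proof.
have [no321 le_ij lt_jk supp big] := shape => le_ji claim.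
have [Mmid|noM] := boolP ((j == i.+1) && (lab w (t + j) == lM)).
  case/andP: Mmid => /eqP eji Mmid; right; exists i; rewrite -eji; split=> // d.
left; set rL := cnt (P1 lL) (t + i).
have moved := core_moved no321 le_ij lt_jk supp.
have lt_core c e : i <= c <= j -> e < c.+1 - i -> i + e < k by lia.
have compl P Q d : (forall e, e < d -> P e = ~~ Q e) -> cnt P d + cnt Q d = d.
  elim: d => // d IH PQ; rewrite !cntS PQ //; have := IH (fun e lt =>
    PQ e (ltnW lt)).
  by case: (Q d) => /=; lia.
have c1 c : i <= c <= j -> cnt (P1 lL) (t + c.+1) + cntR (lab h) c.+1 = rL +
  (c.+1 - i).
  move=> ic; rewrite (core_cnt_lab shape) // (_ : t + c.+1 = t + i +
    (c.+1 - i)); last by lia.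
  rewrite cntD -addnA; congr (_ + _); apply: compl => e lt_e.
  have core : i <= Ordinal (lt_core c e ic lt_e) <= j.+1 by rewrite /=; lia.
  have := claim _ core; rewrite -P1_strand -papp_ord /= -addnA => ->.
  have := moved _ core; rewrite -val_eqE /= -papp_ord /=; lia.
have c2 c : i <= c <= j -> cnt (P2 lL) (t + c.+1) + cntR (vlab h) c.+1 = rL +
  (c.+1 - i).
  move=> ic; rewrite (core_cnt_vlab shape) // (_ : t + c.+1 = t + i +
    (c.+1 - i)); last by lia.
  rewrite cntD cnt_P12 -addnA; congr (_ + _); apply: compl => e lt_e.
  have lt_k := lt_core c e ic lt_e; rewrite -addnA P2_strand //.
  have lt_hk : papp h^-1 (i + e) < k by rewrite papp_lt.
  have core : i <= Ordinal lt_hk <= j.+1.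
    by rewrite -(core_stable le_ij lt_jk supp (Ordinal lt_hk)) -papp_ord /=
      pappKV; lia.
  have := claim _ core; rewrite -P1_strand -papp_ord /= pappKV => ->.
  by have := moved _ core; rewrite -val_eqE /= -papp_ord /= pappKV; lia.
have vld := clustered_valid cl.
pose mu := cnt (fun c => lab w c == lM) (t + i.+1).
have muE c : i <= c <= j -> cnt (fun c => lab w c == lM) (t + c.+1) = mu.
  move=> ic; have [->//|lt_ic] : c = i \/ c = i.+1 by lia.
  rewrite /mu lt_ic addnS cntS; move: noM; rewrite (_ : j = i.+1); last by lia.
  by rewrite eqxx /= => /negbTE ->; rewrite addn0.
have EVM c : i <= c <= j ->
  [/\ cntR (lab w) (t + c.+1) + cnt (fun c => lab w c == lL) (t + c.+1) + mu =
    t + c.+1,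
      cntR (vlab w) (t + c.+1) + cnt (fun c => vlab w c == lL) (t + c.+1) + mu =
        t + c.+1,
      cnt (fun c => lab w c == lL) (t + c.+1) <= cnt (P1 lL) (t + c.+1)
    & cnt (P2 lL) (t + c.+1) <= cnt (fun c => vlab w c == lL) (t + c.+1)].
  move=> ic; rewrite -{1}(muE c ic) cnt_label -(muE c ic) -(valid_cntM vld)
    ?cnt_label; last by lia.
  split=> //; first exact: (prefix_cntL cl a_prefix).
  exact: (cntL_prefix cl ag_prefix).
have V0 := core_cnt_vlab0 shape.
(* Of the [t + i] places left of the core, [rL] hold leftward strands; [mu] accounts for the
   middles. *)
exists (t + i - rL - mu) => c; rewrite supp => ic.
have ii : i <= i <= j by rewrite leqnn.
have [e1 e2 e3 e4] := EVM c ic; have [f1 f2 f3 f4] := EVM i ii.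
have := c1 c ic; have := c2 c ic; have := c2 i ii; rewrite V0; lia.
Qed.

Lemma contains_fits :
  fits (fun c => cntR (lab w) (t + c)) (fun c => cntR (vlab w) (t + c))
    (fun c => lab w (t + c) == lM) h.
Proof.
case: strand_dichotomy => [|[]]; first exact: contains_fits_R.
exact: contains_fits_L.
Qed.

End ContainsFits.

(** * Building a factorization from a set of strands *)

Lemma perm_of_key n (key : 'I_n -> nat) : injective key ->
  exists a : 'S_n, (forall x y, (a x < a y) = (key x < key y)) /\
    (forall x, a x = #|[set y | key y < key x]| :> nat).
Proof.
move=> key_inj.
have lt_n x : #|[set y | key y < key x]| < n.
  rewrite -[X in _ < X](card_ord n) -cardsT; apply: proper_card.
  by rewrite properE subsetT; apply/subsetPn; exists x; rewrite !inE ?ltnn.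
have mono x y : key x < key y ->
  #|[set z | key z < key x]| < #|[set z | key z < key y]|.
  move=> lt_xy; apply: proper_card; rewrite properE; apply/andP; split.
    by apply/subsetP => z; rewrite !inE => /ltn_trans; apply.
  by apply/subsetPn; exists x; rewrite !inE ?ltnn.
pose f x := Ordinal (lt_n x).
have f_inj : injective f.
  move=> x y /(congr1 val) /= e; apply: key_inj.
  by case: (ltngtP (key x) (key y)) => // /mono; rewrite e ltnn.
exists (perm f_inj); split=> [x y|x]; rewrite !permE //=.
case: (ltngtP (key x) (key y)) => [/mono|/mono lt|/key_inj ->];
  rewrite ?ltnn //.
by rewrite ltnNge ltnW.
Qed.

(* [A] and the strands [xs] are those placed to the left of, and inside, the window
   on which [h] acts: both [A] and its union with the strands have to be closed
   downwards in the order of the noninversions of [w]. *)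
Section Factor.

Variables (n k i j t : nat) (w : 'S_n) (h : 'S_k) (A : {set 'I_n}) (xs : 'I_k ->
  'I_n).
Implicit Types (x y : 'I_n) (q : 'I_k).

Let core : pred 'I_k := [pred q : 'I_k | i <= q <= j.+1].

Hypotheses (le_ij : i <= j) (lt_jk : j.+1 < k) (le_tk : t + k <= n).
Hypotheses (h_fix : forall q, q \notin core -> h q = q)
  (h_stable : forall q, (h q \in core) = (q \in core)).
Hypotheses (card_A : #|A| = t + i) (xs_inj : {in core &, injective xs})
  (xs_A : forall q, q \in core -> xs q \notin A).
Hypotheses (A_down : forall x y, y \in A -> x \notin A -> x < y -> w y < w x)
  (AX_down : forall x y, (y \in A) || (y \in xs @: core) ->
     ~~ ((x \in A) || (x \in xs @: core)) -> x < y -> w y < w x).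
Hypotheses (xs_inv : forall q q', q \in core -> q' \in core -> q < q' ->
  h q' < h q ->
    xs q < xs q' /\ w (xs q') < w (xs q))
  (xs_noninv : forall q q', q \in core -> q' \in core -> q < q' -> h q < h q' ->
    xs q' < xs q -> w (xs q) < w (xs q')).

(** Sorting by this key puts [A] first, in its original order, then the core strands in the order
    given by [s], then the rest. With [s = 1] it yields the factor [a], with [s = h] the product
    [a * g]. *)
Definition block_key (s : 'S_k) x : nat :=
  if x \in A then nat_of_ord x else
  if [pick q in core | xs q == x] is Some q then n + s q else n + k + x.

Variant block_spec (s : 'S_k) x : nat -> Type :=
  | BlockA of x \in A : block_spec s x x
  | BlockX q of q \in core & x = xs q & x \notin A : block_spec s x (n + s q)
  | BlockC of x \notin A & x \notin xs @: core : block_spec s x (n + k + x).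

Lemma blockP s x : block_spec s x (block_key s x).
Proof.
rewrite /block_key; case: ifPn => [xA|xA]; first by constructor.
case: pickP => [q /andP[cq /eqP e]|no]; first exact: BlockX (esym e) xA.
constructor=> //; apply/imsetP => -[q cq e].
by have := no q; rewrite /= e eqxx andbT; move: cq; rewrite /= => ->.
Qed.

Lemma block_key_X s q : q \in core -> block_key s (xs q) = n + s q.
Proof.
move=> cq; case: blockP => [xA|q' cq' e _|_ /negP[]].
- by have := xs_A cq; rewrite xA.
- by rewrite (xs_inj cq cq' e).
- by apply: imset_f.
Qed.

Lemma block_key_inj s : injective (block_key s).
Proof.
move=> x y; case: (blockP s x) => [xA|q cq ex xA|xA xX];
  case: (blockP s y) => [yA|q' cq' ey yA|yA yX] e.
- exact: val_inj.
- by have := ltn_ord x; lia.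
- by have := ltn_ord x; lia.
- by have := ltn_ord y; lia.
- by rewrite ex ey; congr xs; apply: (@perm_inj _ s); apply: val_inj;
    move/addnI: e.
- by have := ltn_ord (s q); lia.
- by have := ltn_ord y; lia.
- by have := ltn_ord (s q'); lia.
- by apply: val_inj; move/addnI: e.
Qed.

Lemma card_below_X (s : 'S_k) q : (forall q', (s q' \in core) =
  (q' \in core)) ->
  q \in core -> #|[set y | block_key s y < n + s q]| = t + s q.
Proof.
move=> s_stable cq.
have -> : [set y | block_key s y < n + s q] =
    A :|: xs @: [set q' | (q' \in core) && (s q' < s q)].
  apply/setP => y; rewrite !inE; case: blockP => [yA|q' cq' ey yA|yA yX].
  - by rewrite yA ltn_addr.
  - rewrite (negbTE yA) ltn_add2l /=; apply/idP/imsetP => [lt|[q2]].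
      by exists q' => //; rewrite inE cq' lt.
    by rewrite inE => /andP[cq2 lt]; rewrite ey => /(xs_inj cq' cq2) ->.
  - rewrite (negbTE yA) /=; have -> : n + k + y < n + s q =
      false by have := ltn_ord (s q); lia.
    apply/esym/imsetP => -[q2]; rewrite inE => /andP[cq2 _] ey.
    by case/negP: yX; rewrite ey imset_f.
rewrite cardsU (_ : A :&: _ = set0); last first.
  apply/setP => y; rewrite !inE; apply/negP => /andP[yA /imsetP[q2]].
  by rewrite inE => /andP[cq2 _] ey; have := xs_A cq2; rewrite -ey yA.
rewrite cards0 subn0 card_A card_in_imset; last first.
  by move=> q1 q2; rewrite !inE => /andP[c1 _] /andP[c2 _]; apply: xs_inj.
have -> : #|[set q' | (q' \in core) && (s q' < s q)]| =
  #|[set q' : 'I_k | i <= q' < s q]|.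
  rewrite -[RHS](card_preimset _ (@perm_inj _ s)); apply: eq_card => q'.
  rewrite !in_set -s_stable; have := ltn_ord (s q); rewrite -s_stable in cq.
  by move: cq; rewrite !inE; lia.
have : #|[set q' : 'I_k | q' < s q]| = s q := card_ord_lt (ltnW (ltn_ord _)).
rewrite -(cardsID [set q' : 'I_k | q' < i]).
have -> : [set q' : 'I_k | q' < s q] :&: [set q' : 'I_k | q' < i] =
  [set q' : 'I_k | q' < i].
  apply/setP => q'; rewrite !inE; rewrite -s_stable in cq; move: cq;
    rewrite !inE; lia.
rewrite card_ord_lt; last by lia.
have -> : [set q' : 'I_k | q' < s q] :\: [set q' : 'I_k | q' < i] =
  [set q' : 'I_k | i <= q' < s q].
  by apply/setP => q'; rewrite !inE -leqNgt.
lia.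
Qed.

Lemma card_below_same x : x \notin xs @: core ->
  #|[set y | block_key 1 y < block_key 1 x]| =
    #|[set y | block_key h y < block_key h x]|.
Proof.
move=> xX; apply: eq_card => y; rewrite !inE.
have ex : block_key 1 x = block_key h x.
  case: (blockP h x) => [xA|q cq e|xA _]; rewrite /block_key.
  - by rewrite xA.
  - by case/negP: xX; rewrite e imset_f.
  - rewrite (negbTE xA); case: pickP => // q /andP[cq /eqP e].
    by case/negP: xX; rewrite -e imset_f.
rewrite ex; have [yX|yX] := boolP (y \in xs @: core).
  case/imsetP: yX => q cq ->; rewrite !block_key_X // perm1.
  case: (blockP h x) => [xA|q' cq' e|xA _].
  - by have := ltn_ord x; lia.
  - by case/negP: xX; rewrite e imset_f.
  - by have := ltn_ord q; have := ltn_ord (h q); lia.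
congr (_ < _).
case: (blockP h y) => [yA|q cq e|yA _]; rewrite /block_key.
- by rewrite yA.
- by case/negP: yX; rewrite e imset_f.
- rewrite (negbTE yA); case: pickP => // q /andP[cq /eqP e].
  by case/negP: yX; rewrite -e imset_f.
Qed.

(** The two sorted arrangements [a] and [a2] differ only inside the core, where they differ by [h].
    Lengths add because [a2] inverts only pairs that [w] inverts: between blocks by [A_down] and
    [AX_down], inside the core by [xs_inv] and [xs_noninv]. *)
Lemma factor_exists : exists a g b : 'S_n,
  [/\ forall m, papp g m = if t <= m then t + papp h (m - t) else m,
      w = (a * g * b)%g & additive a g /\ additive (a * g)%g b].
Proof.
have [a [a_lt aE]] := perm_of_key (@block_key_inj 1%g).
have [a2 [a2_lt a2E]] := perm_of_key (@block_key_inj h).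
have aX q : q \in core -> a (xs q) = t + q :> nat.
  by move=> cq; rewrite aE block_key_X // card_below_X ?perm1 // => q';
    rewrite perm1.
have a2X q : q \in core -> a2 (xs q) = t + h q :> nat.
  by move=> cq; rewrite a2E block_key_X // card_below_X.
have a2C x : x \notin xs @: core -> a2 x = a x.
  by move=> xX; apply: val_inj; rewrite /= aE a2E card_below_same.
exists a, (a^-1 * a2)%g, (a2^-1 * w)%g.
rewrite !mulKVg; split=> //.
  move=> m; have [le_nm|lt_mn] := leqP n m.
    rewrite papp_out //; case: leqP => // le_tm.
    by rewrite papp_out ?subnKC //; lia.
  rewrite -[m]/(nat_of_ord (Ordinal lt_mn)); set M := Ordinal lt_mn.
  rewrite papp_ord permM; have [/imsetP[q cq e]|nX] := boolP (a^-1 M \in xs @: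
    core)%g.
    have mE : M = t + q :> nat by rewrite -(aX q cq) -e permKV.
    by rewrite e a2X // mE leq_addr addKn papp_ord.
  rewrite a2C // permKV; case: leqP => // le_tM.
  have [le_kM|lt_Mk] := leqP k (M - t); first by rewrite papp_out // subnKC.
  have := papp_ord h (Ordinal lt_Mk); rewrite /= => ->;
    rewrite h_fix /= ?subnKC //.
  apply/negP => cM; case/negP: nX; apply/imsetP; exists (Ordinal lt_Mk) => //.
  by apply: (@perm_inj _ a); apply: val_inj; rewrite permKV /= aX //= subnKC.
split=> x y; wlog lt_xy : x y / x < y => [H|].
- move=> inv; have [lt_xy|lt_yx|/val_inj e] := ltngtP x y; first exact: H.
    by rewrite inv_pair_sym; apply: H => //; rewrite inv_pair_sym.
  by rewrite e /inv_pair !ltnn in inv.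
- rewrite !inv_pairP // mulKVg a_lt a2_lt.
  case: (blockP 1%g x) => [xA|q cq ex xA|xA xX]; case: (blockP 1%g y) =>
    [yA|q' cq' ey yA|yA yX].
  + by rewrite ltnNge ltnW.
  + by have := ltn_ord x; lia.
  + by have := ltn_ord x; lia.
  + by rewrite [block_key h y]/block_key yA ex block_key_X // => _;
      have := ltn_ord y; lia.
  + rewrite !perm1 ltn_add2l ex ey !block_key_X // ltn_add2l => lt_q.
    rewrite ltnNge leq_eqVlt; apply/negP => /predU1P[/val_inj/perm_inj e|inv].
      by rewrite e ltnn in lt_q.
    by have [+ _] := xs_inv cq' cq lt_q inv; rewrite -ex -ey ltnNge ltnW.
  + by rewrite perm1; have := ltn_ord q; lia.
  + rewrite [block_key h y]/block_key yA => _; case: (blockP h x) =>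
      [xA'|q cq ex|_ _].
    * by rewrite xA' in xA.
    * by have := ltn_ord y; lia.
    * by have := ltn_ord y; lia.
  + rewrite ey block_key_X // => _; case: (blockP h x) => [xA'|q cq ex|_ _].
    * by rewrite xA' in xA.
    * by case/negP: xX; rewrite ex imset_f.
    * by have := ltn_ord (h q'); lia.
  + by rewrite ltn_add2l ltnNge ltnW.
- move=> inv; have [lt_xy|lt_yx|/val_inj e] := ltngtP x y; first exact: H.
    by rewrite inv_pair_sym; apply: H => //; rewrite inv_pair_sym.
  by rewrite e /inv_pair !ltnn in inv.
rewrite mulKVg !inv_pairP // a2_lt.
have AX_X q : q \in core -> (xs q \in A) || (xs q \in xs @: core).
  by move=> cq; rewrite imset_f ?orbT.
case: (blockP h x) => [xA|q cq ex xA|xA xX]; case: (blockP h y) =>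
  [yA|q' cq' ey yA|yA yX].
+ by rewrite ltnNge ltnW.
+ by have := ltn_ord x; lia.
+ by have := ltn_ord x; lia.
+ by move=> _; apply: A_down.
+ rewrite ltn_add2l => inv; rewrite ex ey.
  have [lt_q|lt_q|/val_inj e] := ltngtP q q'.
  * by have [] := xs_inv cq cq' lt_q inv.
  * by apply: xs_noninv => //; rewrite -ex -ey.
  * by rewrite e ltnn in inv.
+ by have := ltn_ord (h q); lia.
+ by move=> _; apply: A_down.
+ by move=> _; apply: AX_down => //; rewrite ?ey ?AX_X // negb_or xA.
+ by rewrite ltn_add2l ltnNge ltnW.
Qed.

End Factor.

Lemma cnt_rank_lt_card P r g : cnt (fun k => P k && (cnt P k < r)) g =
  minn r (cnt P g).
Proof.
elim: g => [|g IH]; first by rewrite minn0.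
by rewrite !cntS IH; case: (P g) => /=; case: leqP => /=; lia.
Qed.

Lemma cnt_below P m g : m <= g -> cnt (fun k => P k && (k < m)) g = cnt P m.
Proof.
move=> /subnKC <-; rewrite cntD [X in _ + X]cnt_eq0 ?addn0.
  by apply: eq_cnt => k ->; rewrite andbT.
by move=> k _; rewrite negb_and -leqNgt leq_addr orbT.
Qed.

Lemma cnt_add3 (P P1 P2 P3 : pred nat) g :
  (forall k, k < g -> P k = P1 k + P2 k + P3 k :> nat) ->
  cnt P g = cnt P1 g + cnt P2 g + cnt P3 g.
Proof.
elim: g => // g IH e; rewrite !cntS e // IH; last by move=> k /ltnW; apply: e.
lia.
Qed.

Lemma crossing_cnt k (h : 'S_k) c : clustered h -> c < k ->
  cntR (lab h) c.+1 = cntR (vlab h) c.+1 + crossing c h.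
Proof.
move=> cl lt_ck.
rewrite -(valid_height_card (clustered_valid cl) (clustered_realizes cl) lt_ck).
by congr (_ + _); apply: eq_card => x; rewrite !inE labR; lia.
Qed.

Section Cut.

Variables (n : nat) (w : 'S_n) (B : {set 'I_n}) (b : nat).
Hypothesis cl : clustered w.

(** A criterion, label by label, for [B] to be closed downwards in the order of noninversions:
    strands with different labels are separated by the place [b], strands with the same label by
    their order. *)
Definition cut := [/\
  forall x : 'I_n, lab w x = lR -> if x \in B then x < b else b < w x,
  forall x : 'I_n, lab w x = lL -> if x \in B then w x < b else b < x,
  forall x : 'I_n, lab w x = lM -> if x \in B then x <= b else b <= x
  & forall x y : 'I_n, lab w x = lab w y -> lab w x <> lM -> y \in B ->
    x \notin B -> y < x].

Lemma cut_down : cut -> forall x y, y \in B -> x \notin B -> x < y -> w y < w x.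
Proof.
move=> [cR cL cM cc] x y yB xB xy.
have wM (z : 'I_n) : lab w z = lM -> w z = z by case/(clustered_middle cl).
move: (cR x) (cL x) (cM x) (cR y) (cL y) (cM y) (cc x y) (wM x) (wM y).
rewrite yB (negbTE xB).
case: (lab w x) => [[]|]; case: (lab w y) => [[]|] Rx Lx Mx Ry Ly My c wx wy.
- by have := c erefl (fun e => ltac:(discriminate e)) isT isT; lia.
- by have := Rx erefl; have := Ly erefl; lia.
- by have := Rx erefl; have := My erefl; rewrite (wy erefl); lia.
- by have := Lx erefl; have := Ry erefl; lia.
- by have := c erefl (fun e => ltac:(discriminate e)) isT isT; lia.
- by have := Lx erefl; have := My erefl; lia.
- by have := Mx erefl; have := Ry erefl; lia.
- by have := Mx erefl; have := Ly erefl; rewrite (wx erefl); lia.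
- by have := Mx erefl; have := My erefl; lia.
Qed.

End Cut.

(** * A heap between the boundary paths is contained *)

Section FitsContains.

Variables (n k i j t : nat) (w : 'S_n) (h : 'S_k).
Hypotheses (cl : clustered w) (shape : core_shape h i j) (le_tk : t + k <= n).
Implicit Types (x y : 'I_n) (q : 'I_k).

Let no321 : ~ has321 h. Proof. by have [] := shape. Qed.
Let le_ij : i <= j. Proof. by have [] := shape. Qed.
Let lt_jk : j.+1 < k. Proof. by have [] := shape. Qed.
Let supp c : (0 < crossing c h) =
  (i <= c <= j). Proof. by have [] := shape. Qed.
Let h_fix := core_fixed le_ij lt_jk supp.
Let h_stable := core_stable le_ij lt_jk supp.
Let h_moved := core_moved no321 le_ij lt_jk supp.

Let core : pred 'I_k := [pred q : 'I_k | i <= q <= j.+1].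

Let h_fix' q : q \notin core -> h q = q.
Proof. by rewrite inE => nc; apply: h_fix; lia. Qed.

Definition contained := exists a g b : 'S_n,
  [/\ forall m, papp g m = if t <= m then t + papp h (m - t) else m,
      w = (a * g * b)%g & additive a g /\ additive (a * g)%g b].

Let E := cntR (lab w).
Let V := cntR (vlab w).
Let EL := cnt (fun c => lab w c == lL).
Let VL := cnt (fun c => vlab w c == lL).
Let M := cnt (fun c => lab w c == lM).

Let cntE g : g <= n -> E g + EL g + M g = g /\ V g + VL g + M g = g.
Proof.
move=> le_gn; have vld := clustered_valid cl.
split; first exact: cnt_label.
by rewrite /M -(valid_cntM vld le_gn); apply: cnt_label.
Qed.

Let rankR x : lab w x = lR -> V (w x) = E x.
Proof.
move=> Rx; have := realizes_rank (clustered_realizes cl) (ltn_ord x).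
by rewrite Rx papp_ord.
Qed.

Let rankL x : lab w x = lL -> VL (w x) = EL x.
Proof.
move=> Rx; have := realizes_rank (clustered_realizes cl) (ltn_ord x).
by rewrite Rx papp_ord.
Qed.

Let vlab_w x : vlab w (w x) = lab w x.
Proof. by rewrite -papp_ord vlab_papp. Qed.

Section Middle.

Hypotheses (eji : j = i.+1) (Mp : lab w (t + j) = lM).

(** The three core strands are the middle [p] and its only partners [c] and [a]. As [w] inverts all
    three pairs, whatever [h] inverts among them is available. *)
Lemma middle_contained : contained.
Proof.
have lt_pn : t + j < n by lia.
pose p : 'I_n := Ordinal lt_pn.
have [wp /eqP/cards1P[c nc] /eqP/cards1P[a sa]] := @clustered_middle _ w p cl
  Mp.
have : c \in nw w p by rewrite nc inE.
rewrite inE wp => /andP[cp wcp].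
have : a \in se w p by rewrite sa inE.
rewrite inE wp => /andP[pa wap].
have Rc : lab w c = lR.
  by apply/eqP; rewrite labR; exact: ltn_trans wcp.
have La : lab w a = lL.
  have wap' : w a < w p by rewrite wp.
  by case: (clustered_inversion cl pa wap') => -[] //; rewrite [lab w p]Mp.
have mono := clustered_mono cl.
pose A := [set x : 'I_n | match lab w x with
  Some true => x < c | Some false => x < a | None => x < p end].
have lab3 x : [\/ lab w x = lR, lab w x = lL | lab w x = lM].
  by case: (lab w x) => [[]|]; [constructor 1|constructor 2|constructor 3].
pose xs q : 'I_n := if q == i :> nat then c else if q == j :> nat then p else a.
have ca : c < a by apply: ltn_trans pa.
have wac : w a < w c by apply: ltn_trans wcp.
have coreE q : q \in core -> [\/ q = i :> nat /\ xs q = c, q =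
  j :> nat /\ xs q = p
    | q = j.+1 :> nat /\ xs q = a].
  rewrite inE /xs => cq; have [->|n1] := eqVneq (q : nat) i;
    first by constructor 1.
  have [->|n2] := eqVneq (q : nat) j; first by constructor 2.
  by constructor 3; split=> //; lia.
have cutA : cut w A (t + i).
  have pE : p = (t + i).+1 :> nat by rewrite /= eji addnS.
  split=> [x Rx|x Lx|x Mx|x y e nM]; rewrite !inE ?Rx ?Lx ?Mx.
  - case: ltnP => [xc|]; first by lia.
    rewrite leq_eqVlt => /predU1P[/val_inj <-|cx]; first by lia.
    by have := mono c x cx (etrans Rc (esym Rx)); lia.
  - case: ltnP => [xa|]; last by lia.
    by have := mono x a xa (etrans Lx (esym La)); lia.
  - by case: ltnP; lia.
  - rewrite -e; case: (lab3 x) => ex; rewrite ex //; lia.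
pose B := [set x : 'I_n | match lab w x with
  Some true => x <= c | Some false => x <= a | None => x <= p end].
have AXE x : (x \in A) || (x \in xs @: core) = (x \in B).
  have lt_ik : i < k by lia.
  have lt_jk' : j < k by lia.
  have -> : (x \in xs @: core) = [|| x == c, x == p | x == a].
    apply/imsetP/or3P => [[q /coreE[] [_ ->] ->]|[] /eqP ->].
    - by constructor 1.
    - by constructor 2.
    - by constructor 3.
    - by exists (Ordinal lt_ik); rewrite ?inE /xs /= ?eqxx //; lia.
    - exists (Ordinal lt_jk'); first by rewrite inE /=; lia.
      by rewrite /xs /= eqxx (_ : (j == i) = false) //; lia.
    - exists (Ordinal lt_jk); first by rewrite inE /=; lia.
      rewrite /xs /= (_ : (j.+1 == i) = false); last by lia.
      by rewrite (_ : (j.+1 == j) = false) //; lia.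
  have neq y : lab w x <> lab w y -> (x == y) = false by move=> ne; apply/eqP =>
    e; rewrite e in ne.
  have Mp' : lab w p = lM := Mp.
  rewrite !inE; case: (lab3 x) => ex; rewrite ex.
  - by rewrite (neq p) ?(neq a) ?ex ?Mp' ?La // !orbF orbC -leq_eqVlt.
  - by rewrite (neq p) ?(neq c) ?ex ?Mp' ?Rc //= orbC -leq_eqVlt.
  - by rewrite (neq a) ?(neq c) ?ex ?La ?Rc //= orbF orbC -leq_eqVlt.
have cutB : cut w B (t + j).+1.
  have pE : p = t + j :> nat by [].
  split=> [x Rx|x Lx|x Mx|x y e nM]; rewrite !inE ?Rx ?Lx ?Mx.
  - case: (leqP x c) => [xc|cx]; first by lia.
    by have := mono c x cx (etrans Rc (esym Rx)); lia.
  - case: (leqP x a) => [|ax]; last by lia.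
    rewrite leq_eqVlt => /predU1P[/val_inj ->|xa]; first by lia.
    by have := mono x a xa (etrans Lx (esym La)); lia.
  - by case: (leqP x p); lia.
  - by rewrite -e; case: (lab3 x) => ex; rewrite ex //; lia.
have cardA : #|A| = t + i.
  pose PA g := match lab w g with
    Some true => g < c | Some false => g < a | None => g < p end.
  have -> : #|A| = cnt PA n.
    by rewrite (cnt_card _ (leqnn n)); apply: eq_card => x;
      rewrite !inE ltn_ord andbT.
  rewrite (@cnt_add3 PA (fun g => (lab w g == lR) && (g < c))
     (fun g => (lab w g == lL) && (g < a)) (fun g => (lab w g == lM) &&
       (g < p))); last first.
    by move=> g _; rewrite /PA; case: (lab w g) => [[]|] //=; lia.
  (* Height 1 at [p] squeezes the ranks of [c] and [a]: all strands departing before [p] are counted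
     except [c], which leaves [p - 1 = t + i]. *)
  rewrite !cnt_below ?(ltnW (ltn_ord _)) // -/(E c) -/(EL a) -/(M p).
  have [_ _ EV _] := clustered_valid cl.
  have EVp : E p = (V p).+1 by apply: EV.
  have le1 : V p <= E c by rewrite -rankR //; apply: cnt_le; apply: ltnW.
  have lt1 : E c < E p by apply: cnt_rank_lt => //=; rewrite Rc.
  have le2 : EL p <= EL a by apply: cnt_le; apply: ltnW.
  have lt2 : EL a < VL p by rewrite -rankL //; apply: cnt_rank_lt => //=;
    rewrite vlab_w La.
  have [e1 e2] := cntE (ltnW lt_pn).
  by move: EVp le1 lt1 le2 lt2; rewrite /p /= => *; lia.
have sorted q q' : q \in core -> q' \in core -> q < q' ->
  xs q < xs q' /\ w (xs q') < w (xs q).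
  move=> /coreE cq /coreE cq' lt_q.
  case: cq => -[eq ->]; case: cq' => -[eq' ->]; try (by exfalso; lia); by split;
    rewrite ?wp.
apply: (@factor_exists n k i j t w h A xs) => //.
- move=> q q' cq cq' e; have [lt_q|lt_q|/val_inj//] := ltngtP q q'.
    by have [] := sorted q q' cq cq' lt_q; rewrite e ltnn.
  by have [] := sorted q' q cq' cq lt_q; rewrite e ltnn.
- by move=> q /coreE[] [_ ->]; rewrite inE ?Rc ?La ?[lab w p]Mp ltnn.
- exact: cut_down cutA.
- by move=> x y; rewrite !AXE; apply: cut_down cutB x y.
- by move=> q q' cq cq' lt_q _; apply: sorted.
- by move=> q q' cq cq' lt_q _; have [lt _] := sorted q q' cq cq' lt_q;
    rewrite ltnNge ltnW.
Qed.

End Middle.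

Section Formula.

Variable r : nat.
Let Eh := cntR (lab h).
Let Vh := cntR (vlab h).
Hypothesis F : forall c, i <= c <= j ->
  V (t + c.+1) <= r + Vh c.+1 /\ r + Eh c.+1 <= E (t + c.+1).
Hypothesis noM : forall m, i < m <= j -> lab w (t + m) <> lM.

Let clh : clustered h. Proof. by have [/(_ no321)[]] := no321_clustered h. Qed.

Let labh_M q : lab h q <> lM.
Proof.
move=> /(clustered_middle clh)[_ /eqP/cards1P[x nx] /eqP/cards1P[y sy]].
have : x \in nw h q by rewrite nx inE.
have : y \in se h q by rewrite sy inE.
by rewrite !inE => /andP[h1 h2] /andP[h3 h4]; apply: no321; exists x, q, y.
Qed.

Let labh_R q : q < h q -> lab h q = lR.
Proof. by rewrite -labR => /eqP. Qed.

Let labh_L q : h q < q -> lab h q = lL.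
Proof.
move=> lt; have := labR h q; have := @labh_M q; case: (lab h q) => [[]|] //.
by rewrite eqxx; lia.
Qed.

Let cntMh g : g <= k -> cnt (fun c => lab h c == lM) g = 0.
Proof.
move=> le_gk; apply: cnt_eq0 => c lt_c; apply/eqP.
exact: (@labh_M (Ordinal (leq_trans lt_c le_gk))).
Qed.

Let rank_hR q : q < h q -> Vh (h q) = Eh q.
Proof.
move=> /labh_R Rq; have := realizes_rank (clustered_realizes clh) (ltn_ord q).
by rewrite Rq papp_ord.
Qed.

Let rank_hL q : h q < q -> q + Vh (h q) = h q + Eh q.
Proof.
move=> /labh_L Lq; have := realizes_rank (clustered_realizes clh) (ltn_ord q).
rewrite Lq papp_ord => e.
have := cnt_label (lab h) q; have := cnt_label (vlab h) (h q).
rewrite (valid_cntM (clustered_valid clh)) ?cntMh ?(ltnW (ltn_ord _)) // -/(Eh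
  q) -/(Vh (h q)).
by move: e; lia.
Qed.

Let Eh_S q : Eh q.+1 = Eh q + (q < h q).
Proof. by rewrite /Eh cntS labR. Qed.

Let Vh_hS q : h q < q -> Vh (h q).+1 = Vh (h q).
Proof.
by move=> /labh_L Lq; rewrite /Vh cntS -papp_ord vlab_papp Lq addn0.
Qed.

Let lt_ik : i < k. Proof. by lia. Qed.

Let boundary_i : [/\ Eh i = 0, Eh i.+1 = 1 & Vh i.+1 = 0].
Proof.
have Ei : Eh i = 0.
  apply: cnt_eq0 => c lt_c; have lt_ck : c < k by lia.
  have := labR h (Ordinal lt_ck); rewrite h_fix /= ?lt_c // => ->;
    by rewrite ltnn.
have := Eh_S (Ordinal lt_ik); rewrite /= Ei.
have := h_moved (q := Ordinal lt_ik); have := h_stable (Ordinal lt_ik).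
rewrite -val_eqE /= => st mv.
have -> : i < h (Ordinal lt_ik) by lia.
have := crossing_cnt clh lt_ik; rewrite -/(Eh _) -/(Vh _) => e1 e2.
by have := supp i; rewrite leqnn le_ij => s0; split=> //; lia.
Qed.

Let boundary_j : Eh j.+2 = Eh j.+1 /\ (Vh j.+1).+1 = Eh j.+1.
Proof.
have := Eh_S (Ordinal lt_jk); have := h_stable (Ordinal lt_jk); rewrite /= =>
  st.
have -> : (j.+1 < h (Ordinal lt_jk)) = false by lia.
rewrite addn0 => e; split=> //.
have := crossing_cnt clh lt_jk; have := crossing_cnt clh (ltnW lt_jk).
have := supp j; have := supp j.+1; rewrite -!/(Eh _) -!/(Vh _).
have : Vh j.+2 <= (Vh j.+1).+1 by rewrite /Vh cntS; lia.
lia.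
Qed.

Let Eh_le q : i <= q <= j.+1 -> Eh q + i <= q.
Proof.
move=> iq; rewrite (_ : nat_of_ord q = i + (q - i)); last by lia.
rewrite /Eh cntD -/(Eh i); have [-> _ _] := boundary_i.
have : cnt (fun e => lab h (i + e) == lR) (q - i) <= q - i.
  by rewrite /cnt; apply: leq_trans (count_size _ _) _; rewrite size_iota.
lia.
Qed.

Let mu := M (t + i.+1).

Let muE c : i <= c <= j -> M (t + c.+1) = mu.
Proof.
elim: c => [|c IH] ic; first by rewrite /mu (_ : i = 0) //; lia.
have [ici|ne] := eqVneq c.+1 i; first by rewrite /mu ici.
rewrite [t + c.+2]addnS /M cntS -/(M _) IH; last by lia.
by case: eqP => [e|]; rewrite ?addn0 //; case: (@noM c.+1) => //; lia.
Qed.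

Let bounds c : i <= c <= j ->
  [/\ V (t + c.+1) <= r + Vh c.+1, r + Eh c.+1 <= E (t + c.+1),
      EL (t + c.+1) + r + Eh c.+1 + mu <= t + c.+1
    & t + c.+1 <= VL (t + c.+1) + r + Vh c.+1 + mu].
Proof.
move=> ic; have [f1 f2] := F ic; have le_n : t + c.+1 <= n by lia.
have [] := cntE le_n; rewrite (muE ic); split=> //; lia.
Qed.

(** A rightward place of [h] receives the [lR] strand of rank [r + Eh q]; a leftward one receives
    the [lL] strand whose rank, with [r + Eh q] and the [mu] middles, adds up to [t + q]. The bounds
    on [x] and [w x] say that the strand can be at [t + q] when [h] begins and at [t + h q] when it
    ends. *)
Let strand_spec q x :=
  (q < h q -> [/\ lab w x = lR, E x = r + Eh q, x <= t + q & t + h q <= w x]) /\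
  (h q < q -> [/\ lab w x = lL, EL x + mu + r + Eh q = t + q, t +
    q <= x & w x <= t + h q]).

Let strand_exists q : exists x, q \in core -> strand_spec q x.
Proof.
have lt_qn : t + q < n by have := ltn_ord q; lia.
have [cq|nc] := boolP (q \in core); last by exists (Ordinal lt_qn).
have hcore : i <= h q <= j.+1 by rewrite h_stable.
have iq : i <= q <= j.+1 := cq.
have := Eh_S q.
case: (ltngtP q (h q)) => [lt_q|lt_q|e] ES.
- have iqj : i <= q <= j by lia.
  have [_ b2 _ _] := bounds iqj.
  have : r + Eh q < E (t + q.+1) by lia.
  (* The bound on [E] supplies a departure of this rank at or before [t + q]; the bound on [V]
     excludes an arrival before [t + h q]. *)
  move=> /cnt_rank_exists[x [lt_x /eqP Rx Ex]].
  have lt_xn : x < n by have := ltn_ord q; lia.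
  exists (Ordinal lt_xn) => _; split=> [_|]; last by lia.
  split=> //=; first by lia.
  rewrite leqNgt; apply/negP => lt_w.
  have := rankR (x := Ordinal lt_xn) Rx; rewrite /= -/(E x) in Ex *;
    rewrite Ex => rk.
  have vR : vlab w (w (Ordinal lt_xn)) == lR by rewrite vlab_w /= Rx.
  have := @cnt_rank_lt (fun c => vlab w c == lR) _ _ vR lt_w;
    rewrite -!/(V _) rk.
  have hq_gt0 : i <= (h q).-1 <= j by lia.
  have [b1 _ _ _] := bounds hq_gt0.
  rewrite prednK in b1; last by lia.
  by rewrite (rank_hR lt_q) in b1; lia.
- have hqj : i <= h q <= j by lia.
  have [_ _ _ b4] := bounds hqj.
  rewrite (Vh_hS lt_q) in b4; have rk := rank_hL lt_q.
  have lt_iq : i <= q.-1 <= j by lia.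
  have [_ _ b3 _] := bounds lt_iq.
  rewrite prednK in b3; last by lia.
  have : t + q - mu - r - Eh q < VL (t + (h q).+1) by lia.
  (* Dually, the arrival of a leftward strand is found first, among the values, and the strand is
     its preimage. *)
  move=> /cnt_rank_exists[y [lt_y /eqP Ly VLy]].
  have lt_yn : y < n by have := ltn_ord (h q); lia.
  set x := (w^-1 (Ordinal lt_yn))%g.
  have wx : w x = Ordinal lt_yn by rewrite permKV.
  have Lx : lab w x = lL by rewrite -vlab_w wx.
  have ELx : EL x = t + q - mu - r - Eh q by rewrite -rankL // wx.
  exists x => _; split=> [|_]; first by lia.
  split=> //; [by lia| |by rewrite wx /=; lia].
  rewrite leqNgt; apply/negP => lt_x.
  have Lx' : lab w x == lL by rewrite Lx.
  have := @cnt_rank_lt (fun c => lab w c == lL) _ _ Lx' lt_x; rewrite -!/(EL _);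
    lia.
- by have /eqP[] := h_moved iq; apply: val_inj.
Qed.

Lemma formula_contained : contained.
Proof.
have /fin_all_exists[xs xsP] := strand_exists.
have [Ei Ei1 Vi1] := boundary_i; have [Ej Vj] := boundary_j.
have ii : i <= i <= j by rewrite leqnn.
have jj : i <= j <= j by rewrite leqnn andbT.
have [bi1 bi2 bi3 bi4] := bounds ii; have [bj1 bj2 bj3 bj4] := bounds jj.
rewrite Ei1 Vi1 !addnS in bi1 bi2 bi3 bi4; rewrite !addnS in bj1 bj2 bj3 bj4.
have mono := clustered_mono cl.
have lab3 x : [\/ lab w x = lR, lab w x = lL | lab w x = lM].
  by case: (lab w x) => [[]|]; [constructor 1|constructor 2|constructor 3].
have coreP q : q \in core -> (q < h q) \/ (h q < q).
  move=> cq; have /eqP ne := h_moved (q := q) cq.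
  by case: (ltngtP q (h q)) => [|| /val_inj e]; [left|right|case: ne].
have ltE x g : lab w x = lR -> x < g -> E x < E g.
  by move=> Rx; apply: cnt_rank_lt => /=; rewrite Rx.
have ltEL x g : lab w x = lL -> x < g -> EL x < EL g.
  by move=> Rx; apply: cnt_rank_lt => /=; rewrite Rx.
have ltV x g : lab w x = lR -> w x < g -> E x < V g.
  by move=> Rx; rewrite -rankR //; apply: cnt_rank_lt => /=; rewrite vlab_w Rx.
have ltVL x g : lab w x = lL -> w x < g -> EL x < VL g.
  by move=> Rx; rewrite -rankL //; apply: cnt_rank_lt => /=; rewrite vlab_w Rx.
have leE g g' : g <= g' -> E g <= E g' by apply: cnt_le.
have leEL g g' : g <= g' -> EL g <= EL g' by apply: cnt_le.
have leV g g' : g <= g' -> V g <= V g' by apply: cnt_le.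
have leVL g g' : g <= g' -> VL g <= VL g' by apply: cnt_le.
have ES g : E g.+1 <= (E g).+1 by rewrite /E cntS; case: (_ == _); lia.
have ELS g : EL g.+1 <= (EL g).+1 by rewrite /EL cntS; case: (_ == _); lia.
have VS g : V g.+1 <= (V g).+1 by rewrite /V cntS; case: (_ == _); lia.
have VLS g : VL g.+1 <= (VL g).+1 by rewrite /VL cntS; case: (_ == _); lia.
(* The thresholds are ranks: [r] rightward strands, the middles up to [t + i], which number [mu],
   and as many leftward strands as complete [t + i]. In [B] the strands of the core are added. *)
pose A := [set x : 'I_n | match lab w x with
  Some true => E x < r | Some false => EL x + mu + r < t + i | None => x <= t +
    i end].
pose B := [set x : 'I_n | match lab w x with
  Some true => E x < r + Eh j.+1 | Some false => EL x + mu + r + Eh j.+1 < t +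
    j.+2
  | None => x <= t + i end].
have cutA : cut w A (t + i).
  split=> [x Rx|x Lx|x Mx|x y e nM]; rewrite ?in_set ?Rx ?Lx ?Mx.
  - case: (ltnP (E x) r) => h1; rewrite ltnNge; apply/negP => h2.
      by have := leE _ _ h2; have := ES (t + i); lia.
    by have := ltV x (t + i).+1 Rx h2; lia.
  - case: (ltnP (EL x + mu + r) (t + i)) => h1; rewrite ltnNge; apply/negP =>
      h2.
      by have := leVL _ _ h2; rewrite (rankL Lx); have := VLS (t + i); lia.
    by have := ltEL x (t + i).+1 Lx h2; lia.
  - by case: (leqP x (t + i)) => // /ltnW.
  - rewrite -e; case: (lab3 x) => ex; rewrite ex // => h1 h2; rewrite ltnNge;
      apply/negP => h3.
      by have := leE _ _ h3; lia.
    by have := leEL _ _ h3; lia.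
have cutB : cut w B (t + j).+1.
  split=> [x Rx|x Lx|x Mx|x y e nM]; rewrite ?in_set ?Rx ?Lx ?Mx.
  - case: (ltnP (E x) (r + Eh j.+1)) => h1; rewrite ltnNge; apply/negP => h2.
      by have := leE _ _ h2; lia.
    by have := ltV x (t + j).+2 Rx h2; have := VS (t + j).+1; lia.
  - case: (ltnP (EL x + mu + r + Eh j.+1) (t + j.+2)) => h1; rewrite ltnNge;
      apply/negP => h2.
      by have := leVL _ _ h2; rewrite (rankL Lx); lia.
    by have := ltEL x (t + j).+2 Lx h2; have := ELS (t + j).+1; lia.
  - case: (leqP x (t + i)) => h1; first by lia.
    rewrite ltnNge; apply/negP => h2; case: (@noM (x - t)); first by lia.
    by rewrite subnKC //; lia.
  - rewrite -e; case: (lab3 x) => ex; rewrite ex // => h1 h2; rewrite ltnNge;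
      apply/negP => h3.
      by have := leE _ _ h3; lia.
    by have := leEL _ _ h3; lia.
have xsA q : q \in core -> xs q \notin A.
  move=> cq; have iq : i <= q <= j.+1 := cq; have := Eh_le iq.
  have [sR sL] := xsP q cq; rewrite in_set; case: (coreP q cq) => lt_q le_E.
    by have [-> ->] := sR lt_q; lia.
  by have [-> e _ _] := sL lt_q; lia.
have AXE x : (x \in A) || (x \in xs @: core) = (x \in B).
  apply/idP/idP => [/orP[|/imsetP[q cq ->]]|].
  - rewrite !in_set; case: (lab w x) => [[]|] //; first by lia.
    have := Eh_le (q := Ordinal lt_jk); rewrite /= leqnn; lia.
  - have [sR sL] := xsP q cq; rewrite in_set; have iq : i <= q <= j.+1 := cq.
    case: (coreP q cq) => lt_q.
      have [-> -> _ _] := sR lt_q.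
      have lt_qj : q < j.+1 by have := h_stable q; lia.
      by rewrite ltn_add2l; apply: cnt_rank_lt => //=; rewrite labh_R.
    have [-> e _ _] := sL lt_q.
    have : q - Eh q <= j.+1 - Eh j.+1.
      have := cnt_label (lab h) j.+1; have := cnt_label (lab h) q.
      rewrite !cntMh ?(ltnW (ltn_ord _)) ?(ltnW lt_jk) // !addn0 -!/(Eh _).
      have : q <= j.+1 by lia.
      move=> /(cnt_le (fun c => lab h c == lL)); lia.
    have := Eh_le (q := Ordinal lt_jk); rewrite /= leqnn; have := Eh_le iq; lia.
  rewrite in_set => xB; apply/orP; move: xB; rewrite !in_set.
  case: (lab3 x) => ex; rewrite ex => xB; last by left.
  - case: (ltnP (E x) r) => h1; first by left.
    right; have : E x - r < Eh j.+1 by lia.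
    move=> /cnt_rank_exists[q [lt_q /eqP Rq Eq]].
    have lt_qk : q < k by lia.
    have lt_qh : q < h (Ordinal lt_qk) by have := labR h (Ordinal lt_qk);
      rewrite /= Rq eqxx.
    have cq : Ordinal lt_qk \in core.
      rewrite inE /=; apply/andP; split; last by lia.
      rewrite leqNgt; apply/negP => lt_qi; move: lt_qh.
      by rewrite h_fix /= ?lt_qi // ltnn.
    apply/imsetP; exists (Ordinal lt_qk) => //.
    have [/(_ lt_qh)[Rx Ex _ _] _] := xsP _ cq.
    apply: val_inj; apply: (@cnt_rank_inj (fun c => lab w c == lR));
      rewrite /= ?ex ?Rx //.
    by rewrite -!/(E _) Ex /= -[Eh q]/(cntR (lab h) q) Eq; lia.
  - case: (ltnP (EL x + mu + r) (t + i)) => h1; first by left.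
    right; pose EhL := cnt (fun c => lab h c == lL).
    have EhLE g : g <= k -> Eh g + EhL g = g.
      by move=> le_gk; have := cnt_label (lab h) g; rewrite cntMh // addn0.
    have : EL x + mu + r - t < EhL j.+2 by have := EhLE j.+2 lt_jk; lia.
    move=> /cnt_rank_exists[q [lt_q /eqP Lq ELq]].
    have lt_qk : q < k by lia.
    have nR : (q < h (Ordinal lt_qk)) = false.
      by have := labR h (Ordinal lt_qk); rewrite /= Lq.
    have iq : i <= q.
      rewrite leqNgt; apply/negP => lt_qi.
      have lt2 : EhL q < EhL i by apply: cnt_rank_lt => //; rewrite Lq.
      by have := EhLE i (ltnW lt_ik); move: ELq; rewrite -/(EhL q); lia.
    have cq : Ordinal lt_qk \in core by rewrite inE /= iq; lia.
    apply/imsetP; exists (Ordinal lt_qk) => //.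
    have lt_hq : h (Ordinal lt_qk) < q by case: (coreP _ cq) => //=; rewrite nR.
    have [_ /(_ lt_hq)[Lx ELx _ _]] := xsP _ cq.
    apply: val_inj; apply: (@cnt_rank_inj (fun c => lab w c == lL));
      rewrite /= ?ex ?Lx //.
    rewrite -!/(EL _); have := EhLE q (ltnW lt_qk); move: ELq ELx;
      rewrite -/(EhL q) /=; lia.
have cardA : #|A| = t + i.
  pose PA g := match lab w g with
    Some true => E g < r | Some false => EL g < t + i - mu - r | None =>
      g < (t + i).+1 end.
  have -> : #|A| = cnt PA n.
    rewrite (cnt_card _ (leqnn n)); apply: eq_card => x;
      rewrite !in_set ltn_ord andbT /PA.
    by case: (lab w x) => [[]|] //; lia.
  rewrite (@cnt_add3 PA (fun g => (lab w g == lR) && (E g < r))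
     (fun g => (lab w g == lL) && (EL g < t + i - mu - r))
     (fun g => (lab w g == lM) && (g < (t + i).+1))); last first.
    by move=> g _; rewrite /PA; case: (lab w g) => [[]|] //=; lia.
  rewrite (cnt_rank_lt_card (fun g =>
    lab w g == lR)) (cnt_rank_lt_card (fun g => lab w g == lL)).
  have le_n : (t + i).+1 <= n by lia.
  rewrite cnt_below // -/(E n) -/(EL n) -/(M _).
  have := leE _ _ le_n; have := leVL _ _ le_n; have [e1 e2] := cntE (leqnn n).
  have [_ _ _] := clustered_valid cl; rewrite -/(E n) -/(V n) => EVn.
  move: bi1 bi2 bi3 bi4; rewrite /mu addnS; lia.
apply: (@factor_exists n k i j t w h A xs) => //.
- move=> q q' cq cq' e; have [sR sL] := xsP q cq; have [sR' sL'] := xsP q' cq'.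
  case: (coreP q cq) => lt_q; case: (coreP q' cq') => lt_q'.
  + have [_ e1 _ _] := sR lt_q; have [_ e2 _ _] := sR' lt_q';
      rewrite e e2 in e1.
    apply: val_inj; apply: (@cnt_rank_inj (fun c => lab h c == lR));
      rewrite /= ?labh_R //.
    by move/addnI: e1.
  + by have [e1 _ _ _] := sR lt_q; have [e2 _ _ _] := sL' lt_q';
      rewrite e e2 in e1.
  + by have [e1 _ _ _] := sL lt_q; have [e2 _ _ _] := sR' lt_q';
      rewrite e e2 in e1.
  + have [_ e1 _ _] := sL lt_q; have [_ e2 _ _] := sL' lt_q'; rewrite e in e1.
    apply: val_inj; apply: (@cnt_rank_inj (fun c => lab h c == lL));
      rewrite /= ?labh_L //.
    have := cnt_label (lab h) q'; have := cnt_label (lab h) q.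
    by rewrite !cntMh ?(ltnW (ltn_ord _)) // !addn0 -!/(Eh _); lia.
- exact: cut_down cutA.
- by move=> x y; rewrite !AXE; apply: cut_down cutB x y.
- move=> q q' cq cq' lt_q inv.
  have lt1 := no321_exceedance no321 lt_q inv;
    have lt2 := no321_deficiency no321 lt_q inv.
  have [/(_ lt1)[_ _ x1 w1] _] := xsP q cq;
    have [_ /(_ lt2)[_ _ x2 w2]] := xsP q' cq'.
  by split; lia.
- move=> q q' cq cq' lt_q lt_h lt_xs.
  have [sR sL] := xsP q cq; have [sR' sL'] := xsP q' cq'.
  case: (coreP q cq) => lt1; case: (coreP q' cq') => lt2.
  + have [R1 e1 _ _] := sR lt1; have [R2 e2 _ _] := sR' lt2.
    have := ltE _ _ R2 lt_xs; have : Eh q < Eh q' by apply: cnt_rank_lt => //;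
      rewrite labh_R.
    lia.
  + have [_ _ x1 _] := sR lt1; have [_ _ x2 _] := sL' lt2; lia.
  + have [_ _ _ w1] := sL lt1; have [_ _ _ w2] := sR' lt2; lia.
  + have [L1 e1 _ _] := sL lt1; have [L2 e2 _ _] := sL' lt2.
    have := ltEL _ _ L2 lt_xs.
    have : cnt (fun c => lab h c == lL) q < cnt (fun c => lab h c == lL) q'.
      by apply: cnt_rank_lt => //; rewrite labh_L.
    have := cnt_label (lab h) q'; have := cnt_label (lab h) q.
    by rewrite !cntMh ?(ltnW (ltn_ord _)) // !addn0 -!/(Eh _); lia.
Qed.

End Formula.

Lemma fits_contained :
  fits (fun c => E (t + c)) (fun c => V (t + c)) (fun c => lab w (t +
    c) == lM) h ->
  contained.
Proof.
have [_ _ _ _ big] := shape.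
case=> [[r F]|[c [supp_c /eqP Mc]]]; last first.
  have ei : i = c by have := supp c; have := supp i; have := supp_c c;
    have := supp_c i; lia.
  have ej : j = i.+1.
    by have := supp j; have := supp c.+1; have := supp_c j; have := supp_c c.+1;
      lia.
  by apply: middle_contained => //; rewrite ej ei.
have F' c : i <= c <= j -> V (t + c.+1) <= r + cntR (vlab h) c.+1 /\
    r + cntR (lab h) c.+1 <= E (t + c.+1) by rewrite -supp; apply: F.
have clh : clustered h by have [/(_ no321)[]] := no321_clustered h.
(* A middle in the window forces height 1 on both sides, so columns [m.-1] and [m] of [h] have at
   most one entry and neither is internal. *)
have mid m : i < m <= j -> lab w (t + m) = lM -> j = i.+1.
  move=> im Mm; have lt_n : t + m < n by lia.
  have [_ VM EV _] := clustered_valid cl.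
  have := EV _ lt_n Mm; rewrite -/(E _) -/(V _) => EVm.
  have EVS : E (t + m.+1) = (V (t + m.+1)).+1.
    rewrite addnS /E /V !cntS -/(E _) -/(V _) EVm Mm.
    by have := VM _ lt_n; rewrite Mm eqxx; case: (vlab w (t + m)) => [[]|].
  have small c : i <= c <= j -> E (t + c.+1) = (V (t + c.+1)).+1 ->
    crossing c h <= 1.
    move=> ic e; have [f1 f2] := F' c ic; have lt_ck : c < k by lia.
    by have := crossing_cnt clh lt_ck; lia.
  have s1 : crossing m.-1 h <= 1 by apply: small; rewrite ?prednK ?EVm //; lia.
  have s2 : crossing m h <= 1 by apply: small => //; lia.
  by have := big m.-1; have := big m; lia.
have [/andP[/eqP eji /eqP Mj]|noM] := boolP ((j == i.+1) && (lab w (t +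
  j) == lM)).
  exact: middle_contained.
apply: (formula_contained F') => m im Mm; case/negP: noM.
have eji := mid m im Mm; rewrite eji eqxx /=.
by rewrite -eji (_ : j = m) ?Mm //; lia.
Qed.

End FitsContains.

(** * Finite automaton and conclusion *)

Lemma cnt_leq P g : cnt P g <= g.
Proof. by rewrite /cnt; apply: leq_trans (count_size _ _) _;
  rewrite size_iota. Qed.

Lemma heap_core_shape k (h : 'S_k) :
  connected_perm h -> fully_commutative h -> two_in_internal_columns h ->
  exists i j, core_shape h i j.
Proof.
move=> co fc two; have [i [j [le_ij supp big]]] := heap_shape co fc two.
have lt_j := ltn_ord j.
exists i, j; split=> //; [exact: fully_commutative_no321|lia| |] => c.
  have [lt_c|le_c] := ltnP c k.-1; first exact: (supp (Ordinal lt_c)).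
  by rewrite crossing_out; lia.
move=> ic; have lt_c : c < k.-1 by lia.
exact: (big (Ordinal lt_c)).
Qed.

Section FitsTheory.

Variables (k i j : nat) (h : 'S_k).
Hypothesis shape : core_shape h i j.
Implicit Types E V : nat -> nat.

Lemma fits_ext E E' V V' (mid mid' : pred nat) :
  (forall g, g < k -> E g = E' g) -> (forall g, g < k -> V g = V' g) ->
  (forall g, g < k -> mid g = mid' g) -> fits E V mid h -> fits E' V' mid' h.
Proof.
move=> eE eV em; have lt_k c : 0 < crossing c h -> c.+1 < k.
  exact: crossing_lt.
case=> [[r F]|[c [supp mc]]]; [left|right].
  by exists r => c cr; rewrite -eE -?eV ?lt_k //; apply: F.
exists c; split=> //; rewrite -em ?mc //; apply: lt_k; rewrite supp; lia.
Qed.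

(** The constant is absorbed in the offset [r]. Subtracting it is possible since the lower path of
    [h] is 0 at the first column, which forces [d <= r]. *)
Lemma fits_shift E V mid d :
  fits (fun c => d + E c) (fun c => d + V c) mid h <-> fits E V mid h.
Proof.
have [_ le_ij _ supp _] := shape.
split=> -[[r F]|]; try (by right); left.
  have le_dr : d <= r.
    have := F i; rewrite supp leqnn le_ij (core_cnt_vlab0 shape) => /(_ isT);
      lia.
  by exists (r - d) => c cr; have := F c cr; lia.
by exists (d + r) => c cr; have := F c cr; lia.
Qed.

(** With offset [k], the lower path climbs at most to [k] inside the window and the heap of [h]
    reaches at most [2 * k]. *)
Lemma fits_high e V mid E : 2 * k <= e -> (forall c, V c <= c) ->
  fits (fun c => e + E c) V mid h.
Proof.
move=> le_e le_V; left; exists k => c cr.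
have lt_k := crossing_lt cr.
by have := le_V c.+1; have := cnt_leq (fun q => lab h q == lR) c.+1; lia.
Qed.

Lemma heap_contains_fits n (w : 'S_n) : clustered w -> heap_contains w h <->
  exists2 t, t + k <= n & fits (fun c => cntR (lab w) (t + c))
    (fun c => cntR (vlab w) (t + c)) (fun c => lab w (t + c) == lM) h.
Proof.
move=> cl; have k_gt1 : 1 < k by case: shape => _ _; lia.
rewrite heap_containsP //; split=>
  [[t [a [g [b [le_tk gE wE [ag agb]]]]]]|[t le_tk fit]].
  exists t => //; exact: (contains_fits cl shape le_tk gE wE ag agb).
have [a [g [b [gE wE add]]]] := fits_contained cl shape le_tk fit.
by exists t, a, g, b.
Qed.

End FitsTheory.

(** * Avoidance read on windows of the word *)

Definition height (z : seq letter) : nat :=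
  cntR (slab z) (size z) - cntR (tlab z) (size z).

(* Only the height at the beginning of the window [y] and its letters matter. *)
Definition window_fits (h : {k : nat & 'S_k}) (e : nat) (y : seq letter) : bool
  :=
  `[< fits (fun c => e + cntR (slab y) c) (cntR (tlab y)) (fun c =>
    slab y c == lM) (tagged h) >].

Lemma slab_take z t c : c < t -> slab (take t z) c = slab z c.
Proof. by move=> lt_ct; rewrite /slab nth_take. Qed.

Lemma tlab_take z t c : c < t -> tlab (take t z) c = tlab z c.
Proof. by move=> lt_ct; rewrite /tlab nth_take. Qed.

Lemma cntR_slab_drop z t c :
  cntR (slab z) (t + c) = cntR (slab z) t + cntR (slab (drop t z)) c.
Proof.
by rewrite cntD; congr (_ + _); apply: eq_cnt => e _; rewrite /slab nth_drop.
Qed.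

Lemma cntR_tlab_drop z t c :
  cntR (tlab z) (t + c) = cntR (tlab z) t + cntR (tlab (drop t z)) c.
Proof.
by rewrite cntD; congr (_ + _); apply: eq_cnt => e _; rewrite /tlab nth_drop.
Qed.

Lemma cntR_slab_take z t c : c <= t -> cntR (slab (take t z)) c =
  cntR (slab z) c.
Proof.
by move=> le_ct; apply: eq_cnt => e lt_e; rewrite slab_take // (leq_trans lt_e).
Qed.

Lemma cntR_tlab_take z t c : c <= t -> cntR (tlab (take t z)) c =
  cntR (tlab z) c.
Proof.
by move=> le_ct; apply: eq_cnt => e lt_e; rewrite tlab_take // (leq_trans lt_e).
Qed.

Lemma height_take z t : t <= size z ->
  height (take t z) = cntR (slab z) t - cntR (tlab z) t.
Proof.
by move=> le_t; rewrite /height size_takel // cntR_slab_take // cntR_tlab_take.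
Qed.

Section Windows.

Variable H : {fset {k : nat & 'S_k}}.
Hypothesis hH : forall h, h \in H -> exists i j, core_shape (tagged h) i j.

Definition window_free (z : seq letter) : bool :=
  `[< forall h t, h \in H -> t + tag h <= size z ->
        ~~ window_fits h (height (take t z)) (take (tag h) (drop t z)) >].

Lemma heap_avoid_window n (w : 'S_n) : clustered w ->
  (forall h, h \in H -> ~ heap_contains w (tagged h)) <-> window_free (enc w).
Proof.
move=> cl; set z := val (enc w); have sz : size z = n by rewrite size_tuple.
have vld := enc_valid cl.
have E h t : h \in H -> t + tag h <= n ->
  window_fits h (height (take t z)) (take (tag h) (drop t z)) <->
  fits (fun c => cntR (lab w) (t + c)) (fun c => cntR (vlab w) (t + c))
    (fun c => lab w (t + c) == lM) (tagged h).
  move=> hHh le_t; have [i [j shape]] := hH hHh.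
  have le_tn : t <= n by lia.
  rewrite /window_fits -(rwP (asboolP _)) height_take ?sz //.
  (* Counted from the beginning of the word, both paths are raised by the arrivals before [t]; what
     remains of the departures is the height. *)
  apply: iff_trans (iff_sym (fits_shift shape _ _ _ (cntR (tlab z) t))) _.
  have le_VE : cntR (tlab z) t <= cntR (slab z) t := valid_height vld le_tn.
  split; apply: fits_ext => g lt_g /=.
  - rewrite cntR_slab_take ?(ltnW lt_g) // addnA (subnKC le_VE) -cntR_slab_drop.
    by rewrite cnt_slab_enc //; lia.
  - rewrite cntR_tlab_take ?(ltnW lt_g) // -cntR_tlab_drop.
    by rewrite cnt_tlab_enc //; lia.
  - by rewrite slab_take // /slab nth_drop -/(slab z (t + g)) slab_enc //; lia.
  - rewrite cntR_slab_take ?(ltnW lt_g) // addnA (subnKC le_VE) -cntR_slab_drop.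
    by rewrite cnt_slab_enc //; lia.
  - rewrite cntR_tlab_take ?(ltnW lt_g) // -cntR_tlab_drop.
    by rewrite cnt_tlab_enc //; lia.
  - by rewrite slab_take // /slab nth_drop -/(slab z (t + g)) slab_enc //; lia.
split=> [avoid|/asboolP free h hHh].
  apply/asboolP => h t hHh; rewrite sz => le_t; apply/negP =>
    /(E h t hHh le_t) fit.
  have [i [j shape]] := hH hHh.
  by apply: (avoid h hHh); apply/(heap_contains_fits shape cl); exists t.
have [i [j shape]] := hH hHh.
move=> /(heap_contains_fits shape cl)[t le_t /(E h t hHh le_t) fit].
by have := free h t hHh; rewrite sz fit => /(_ le_t).
Qed.

Lemma card_avoiders (P : seq (seq nat)) (m : bool -> bool) n :
  (forall w : 'S_n, (forall p, p \in P -> ~ pattern_contains w p) <->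
     clustered w /\ middles_allowed m false (enc w)) ->
  #|avoiders P H n| = #|[set z : n.-tuple letter | walk m false 0 z &&
    window_free z]|.
Proof.
move=> Pm.
have -> : avoiders P H n = [set w : 'S_n | `[< clustered w >] &&
    (middles_allowed m false (enc w) && window_free (enc w))].
  apply/setP => w; rewrite !inE; apply/asboolP/andP.
    move=> [/Pm[cl mid] avoid]; split; first exact/asboolP.
    by rewrite mid; apply/(heap_avoid_window cl).
  move=> [/asboolP cl /andP[mid free]]; split; first exact/Pm.
  exact/(heap_avoid_window cl).
rewrite (card_clustered n (fun z => middles_allowed m false z &&
  window_free z)).
by apply: eq_card => z; rewrite !inE [in RHS]walk_middles andbA.
Qed.

(** * The automaton recognizing walks without forbidden windows *)

Section WindowAutomaton.

Variable m : bool -> bool.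

Let K := \max_(h <- H) tag h.
(** The threshold of [fits_high] for the longest window. *)
Let D := 2 * K.

Let tag_le h : h \in H -> tag h <= K.
Proof. by move=> hHh; apply: (@leq_bigmax_seq _ _ xpredT (fun h => tag h)). Qed.

Definition next_height (e : nat) (l : letter) : nat :=
  if l is Some (a, b) then e + a - b else e.

Definition letter_ok (pm : bool) (e : nat) (l : letter) : bool :=
  if l is Some (a, b) then b ==> (0 < e) else m pm && (e == 1).

Lemma walk_cons pm e l z :
  walk m pm e (l :: z) = letter_ok pm e l &&
    walk m (l == None) (next_height e l) z.
Proof. by case: l => [[a b]|] //=; rewrite andbA. Qed.

(** Tests the windows ending at the last letter read. Their initial height is recovered from the
    current height [e] by undoing the letters of [y]. *)
Definition suffix_ok (e : nat) (s : seq letter) : bool :=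
  `[< forall h, h \in H -> tag h <= size s ->
      let y := drop (size s - tag h) s in
      ~~ window_fits h (e + cntR (tlab y) (size y) - cntR (slab y) (size y)) y
        >].

Definition last_letters (s : seq letter) : seq letter := drop (size s - K) s.

Fact size_last_letters s : size (last_letters s) <= K.
Proof. by rewrite size_drop; lia. Qed.

Local Notation state := (option ('I_D.+1 * bool * (K.-bseq letter))).

(** A state holds the height, whether the last letter was [None], and the last [K] letters. The
    state [None] is dead: an illegal letter, a height above [D] or a completed forbidden window
    leads there. *)
Definition step (q : state) (l : letter) : state :=
  if q is Some (e, pm, s) then
    let e' := next_height e l in
    if [&& letter_ok pm e l, e' <= D & suffix_ok e' (rcons s l)] then
      Some (inord e', l == None, Bseq (size_last_letters (rcons s l)))
    else None
  else None.

Definition accept (q : state) : bool := if q is Some (e, _,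
  _) then e == 0 :> nat else false.

Definition initial : state := Some (ord0, false, [bseq]).

Lemma foldl_dead z : foldl step None z = None.
Proof. by elim: z. Qed.

Definition nonneg (x : seq letter) :=
  forall t, t <= size x -> cntR (tlab x) t <= cntR (slab x) t.

(** The height and window tests of the automaton, stated on the whole word read so far rather than
    on its last [K] letters. *)
Fixpoint prefixes_ok (x z : seq letter) : bool :=
  if z is l :: z' then
    [&& height (rcons x l) <= D, suffix_ok (height (rcons x l)) (rcons x l)
      & prefixes_ok (rcons x l) z']
  else true.

Lemma rcons_last_letters s l :
  rcons (last_letters s) l = drop (size s - K) (rcons s l).
Proof. by rewrite drop_rcons // leq_subr. Qed.

(** No window is longer than [K], so the letters kept in the state suffice. *)
Lemma suffix_ok_last e s l :
  suffix_ok e (rcons (last_letters s) l) = suffix_ok e (rcons s l).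
Proof.
have E h : h \in H -> tag h <= size (rcons s l) ->
    tag h <= size (rcons (last_letters s) l) /\
    drop (size (rcons (last_letters s) l) - tag h) (rcons (last_letters s) l) =
    drop (size (rcons s l) - tag h) (rcons s l).
  move=> /tag_le le_K; rewrite rcons_last_letters drop_drop size_drop
    !size_rcons => le_s.
  by split; first lia; congr (drop _ _); lia.
apply/asboolP/asboolP => ok h hHh le_s.
  by have [le_s' <-] := E h hHh le_s; apply: ok.
have le_s' : tag h <= size (rcons s l).
  by move: le_s; rewrite rcons_last_letters size_drop size_rcons; lia.
by have [_ ->] := E h hHh le_s'; apply: ok.
Qed.

Lemma last_letters_rcons s l :
  last_letters (rcons (last_letters s) l) = last_letters (rcons s l).
Proof.
rewrite rcons_last_letters /last_letters drop_drop size_drop !size_rcons.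
by congr (drop _ _); lia.
Qed.

Lemma height_rcons x l pm : nonneg x -> letter_ok pm (height x) l ->
  height (rcons x l) = next_height (height x) l /\ nonneg (rcons x l).
Proof.
move=> nn ok.
have xE : x = take (size x) (rcons x l) by rewrite -cats1 take_size_cat.
have sE t : t <= size x -> cntR (slab (rcons x l)) t = cntR (slab x) t.
  by move=> le_t; rewrite [in RHS]xE cntR_slab_take.
have tE t : t <= size x -> cntR (tlab (rcons x l)) t = cntR (tlab x) t.
  by move=> le_t; rewrite [in RHS]xE cntR_tlab_take.
have sS : cntR (slab (rcons x l)) (size x).+1 = cntR (slab x) (size x) +
  (src l == lR).
  by rewrite cntS sE // /slab nth_rcons ltnn eqxx.
have tS : cntR (tlab (rcons x l)) (size x).+1 = cntR (tlab x) (size x) +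
  (tgt l == lR).
  by rewrite cntS tE // /tlab nth_rcons ltnn eqxx.
have le0 := nn (size x) (leqnn _).
split.
  rewrite /height size_rcons sS tS; move: ok; rewrite /height.
  by case: l {xE sE tE sS tS} => [[[] []]|] /=; lia.
move=> t; rewrite size_rcons leq_eqVlt => /predU1P[->|lt_t].
  rewrite sS tS; move: ok; rewrite /height.
  by case: l {xE sE tE sS tS} => [[[] []]|] /=; lia.
by rewrite sE ?tE //; apply: nn.
Qed.

(** The invariant [nonneg] keeps the truncated subtraction in [height] faithful along the run. *)
Lemma foldl_accept x pm z : nonneg x -> height x <= D ->
  accept (foldl step (Some (inord (height x), pm,
    Bseq (size_last_letters x))) z) =
  walk m pm (height x) z && prefixes_ok x z.
Proof.
elim: z x pm => [|l z IH] x pm nn le_D; first by rewrite /= inordK // andbT.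
rewrite walk_cons [foldl _ _ _]/= /step inordK ?ltnS //= suffix_ok_last.
case: (boolP (letter_ok pm (height x) l)) => [ok|_] /=;
  last by rewrite -/step foldl_dead.
have [hE nn'] := height_rcons nn ok; rewrite -hE.
case: (leqP _ D) => [le_D'|_] /=; last by rewrite -/step foldl_dead andbF.
case: (suffix_ok _ _) => /=; last by rewrite -/step foldl_dead andbF.
rewrite -IH //; congr (accept (foldl _ (Some (_, _, _)) _)).
by apply: val_inj => /=; rewrite last_letters_rcons.
Qed.

Lemma prefixes_okP x z : reflect
  (forall g, 0 < g -> g <= size z -> height (x ++ take g z) <= D /\
     suffix_ok (height (x ++ take g z)) (x ++ take g z))
  (prefixes_ok x z).
Proof.
elim: z x => [|l z IH] x; first by constructor=> -[].
have catE g : x ++ take g.+1 (l :: z) =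
  rcons x l ++ take g z by rewrite cat_rcons.
have cat1 : x ++ take 1 (l :: z) = rcons x l by rewrite catE take0 cats0.
apply: (iffP and3P) => [[h1 h2 /IH h3] [//|[|g]] _ le_g|ok].
- by rewrite cat1.
- by rewrite catE; apply: h3.
- have [] := ok 1 isT isT; rewrite cat1 => h1 h2; split=> //; apply/IH =>
    g g_gt0 le_g.
  by rewrite -catE; apply: ok.
Qed.

(* A height exceeding [D] leaves room for any [h], so avoidance bounds the heights
   and makes the automaton finite. *)
Lemma prefixes_window_free h0 z : h0 \in H -> walk m false 0 z ->
  prefixes_ok [::] z = window_free z.
Proof.
move=> h0H; rewrite walk_middles => /andP[wz _].
have [_ _ _ EVn] := (walk_valid erefl).1 wz.
have VE t : t <= size z -> cntR (tlab z) t <= cntR (slab z) t.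
  exact: (valid_height ((walk_valid erefl).1 wz)).
have window (h : {k : nat & 'S_k}) t : t + tag h <= size z ->
    let s := take (t + tag h) z in let y := drop (size s - tag h) s in
    y = take (tag h) (drop t z) /\
    height s + cntR (tlab y) (size y) - cntR (slab y) (size y) =
      height (take t z).
  move=> le_t /=; rewrite size_takel // addnK.
  have yE : drop t (take (t + tag h) z) = take (tag h) (drop t z).
    by rewrite take_drop addnC.
  split=> //; rewrite yE size_takel ?size_drop; last by lia.
  rewrite !height_take //; last by lia.
  rewrite cntR_slab_take // cntR_tlab_take // cntR_slab_drop cntR_tlab_drop.
  have := VE _ le_t; rewrite cntR_slab_drop cntR_tlab_drop.
  have := VE t; lia.
apply/prefixes_okP/asboolP => [ok h t hHh le_t|free g g_gt0 le_g].
  have [i [j [_ _ k_gt1 _ _]]] := hH hHh.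
  have g_gt0 : 0 < t + tag h by rewrite addn_gt0 (leq_trans _ k_gt1) ?orbT.
  have [_ /asboolP/(_ h hHh)] := ok _ g_gt0 le_t; rewrite cat0s size_takel //.
  rewrite leq_addl => /(_ isT).
  by have /= [] := window h t le_t; rewrite size_takel // => -> ->.
rewrite cat0s; split.
  rewrite leqNgt; apply/negP => high.
  have le1 := cnt_le (fun k => slab z k == lR) le_g.
  have le2 : cntR (tlab z) (size z) <= cntR (tlab z) g + (size z - g).
    by rewrite -{1}(subnKC le_g) cntD leq_add2l cnt_leq.
  have le_K := tag_le h0H.
  have high' : 2 * K < height (take g z) := high.
  (* A letter lowers the height by at most one and the walk ends at 0, so more than [2 * K] letters
     remain: room for a whole window of [h0]. *)
  have he : height (take g z) <= size z - g by rewrite height_take //; lia.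
  have := free h0 g h0H; rewrite (_ : g + tag h0 <= size z) => [/(_ isT)/negP|];
    last by lia.
  apply; apply/asboolP; apply: fits_high => [|c]; last exact: cnt_leq.
  by apply: leq_trans (ltnW high'); rewrite leq_mul2l.
apply/asboolP => h hHh /=; rewrite size_takel // => le_h.
have le_t : (g - tag h) + tag h <= size z by rewrite subnK.
have /= [] := window h (g - tag h) le_t; rewrite subnK // size_takel // => ->
  ->.
exact: free.
Qed.

Lemma window_rational h0 : h0 \in H ->
  rational_fps (fun n => #|[set z : n.+1.-tuple letter | walk m false 0 z &&
    window_free z]|%:R)%R.
Proof.
move=> h0H; apply: (@rational_automaton _ _ step accept initial) => n.
congr (_%:R)%R; apply: eq_card => z; rewrite !inE.
have -> : initial = Some (inord (height [::]), false,
  Bseq (size_last_letters [::])).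
  congr (Some (_, _, _)); first by apply: val_inj; rewrite /= inordK.
  exact: val_inj.
rewrite foldl_accept // => [|t]; last by rewrite leqn0 => /eqP ->.
by apply: andb_id2l => wz; rewrite (prefixes_window_free h0H wz).
Qed.

End WindowAutomaton.

End Windows.

Lemma middle_patterns n (w : 'S_n) :
  (forall p, p \in [:: [:: 3; 4; 2; 1]; [:: 4; 3; 1; 2]; [:: 4; 3; 2; 1]] ->
     ~ pattern_contains w p) <->
  clustered w /\ middles_allowed (fun=> true) false (enc w).
Proof.
by rewrite clustered_patterns middles_true; split=> [|[]].
Qed.

Lemma freely_braided_patterns n (w : 'S_n) :
  (forall p, p \in [:: [:: 3; 4; 2; 1]; [:: 4; 2; 3; 1]; [:: 4; 3; 1; 2]; [:: 4;
    3; 2; 1]] ->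
     ~ pattern_contains w p) <->
  clustered w /\ middles_allowed negb false (enc w).
Proof.
split=> [avoid|[cl /(avoids4231 cl) av] p].
  have cl : clustered w.
    apply/clustered_patterns => p pP; apply: avoid.
    by move: pP; rewrite !inE => /or3P[] ->; rewrite ?orbT.
  by split=> //; apply/(avoids4231 cl); apply: avoid.
rewrite !inE => /or4P[] /eqP -> //; move/clustered_patterns: cl; exact.
Qed.

Lemma short_patterns n (w : 'S_n) :
  (forall p, p \in [:: [:: 3; 2; 1]] -> ~ pattern_contains w p) <->
  clustered w /\ middles_allowed (fun=> false) false (enc w).
Proof.
rewrite middles_false -no321_clustered -has321P.
by split=> [H|H p]; [apply: H | rewrite inE => /eqP ->].
Qed.

Theorem corollary2p5 (H : {fset {k : nat & 'S_k}})
    (hH : forall h, h \in H ->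
       [/\ connected_perm (tagged h), fully_commutative (tagged h)
         & two_in_internal_columns (tagged h)]) :
  (rational_fps (avoiders_gf [:: [:: 3; 2; 1]] H) ->
     rational_fps (avoiders_gf
       [:: [:: 3; 4; 2; 1]; [:: 4; 2; 3; 1]; [:: 4; 3; 1; 2];
           [:: 4; 3; 2; 1]] H) /\
     rational_fps (avoiders_gf
       [:: [:: 3; 4; 2; 1]; [:: 4; 3; 1; 2]; [:: 4; 3; 2; 1]] H)) /\
  (algebraic_fps (avoiders_gf [:: [:: 3; 2; 1]] H) ->
     algebraic_fps (avoiders_gf
       [:: [:: 3; 4; 2; 1]; [:: 4; 2; 3; 1]; [:: 4; 3; 1; 2];
           [:: 4; 3; 2; 1]] H) /\
     algebraic_fps (avoiders_gf
       [:: [:: 3; 4; 2; 1]; [:: 4; 3; 1; 2]; [:: 4; 3; 2; 1]] H)).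
Proof.
have shapes h : h \in H -> exists i j, core_shape (tagged h) i j.
  by move=> /hH[co fc two]; apply: heap_core_shape.
have gfE P m : (forall n (w : 'S_n), (forall p, p \in P ->
  ~ pattern_contains w p) <->
    clustered w /\ middles_allowed m false (enc w)) ->
    avoiders_gf P H = fun n => (#|[set z : n.+1.-tuple letter |
       walk m false 0 z && window_free H z]|%:R)%R.
  by move=> Pm; apply: funext => n;
    rewrite /avoiders_gf (card_avoiders shapes (Pm n.+1)).
rewrite (gfE _ _ short_patterns) (gfE _ _ middle_patterns) (gfE _ _
  freely_braided_patterns).
have [-> |/fset0Pn[h0 h0H]] := eqVneq H fset0; last first.
  have rat m := window_rational shapes m h0H.
  by split=> _; split; try apply: rational_algebraic; apply: rat.
(* Without [H] the window condition is vacuous and the three series are those of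
   [walk_gf_transfer]. *)
have gf0 m : (fun n => (#|[set z : n.+1.-tuple letter |
    walk m false 0 z && window_free fset0 z]|%:R)%R) = walk_gf m.
  apply: funext => n; congr (_%:R)%R; apply: eq_card => z; rewrite !inE.
  by rewrite (_ : window_free fset0 z) ?andbT //; apply/asboolP => h t;
    rewrite inE.
by rewrite !gf0; have [rat alg] := walk_gf_transfer; split.
Qed.
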